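(* Let $2\le p<3$, $\gamma\in(0,1]$ with $2+\gamma>p$, let $V$ be a Banach space, $\mathbf x$ a weak-geometric $p$-rough path on $[0,T]$ with values in $\mathbb R^\ell$ controlled by $\omega$, and $\varpi(\tau)=\tau^{(2+\gamma)/p}$. Let $\vec f=(\vec f_1,\dots,\vec f_\ell)$ be vector fields on $V$ with $\vec f_i\,\mathrm{id}\in\mathcal C^{2+\gamma}_b(V,V)$ for each $i$. For $0\le s\le t\le T$ and $a\in V$, let $\alpha\in[0,1]\mapsto y_{s,t}(\alpha,a)$ be the solution of $$y_{s,t}(\alpha,a)=a+\int_0^\alpha\sum_i\vec f_i\,\mathrm{id}(y_{s,t}(\beta,a))\,\mathbf x^i_{s,t}\,\mathrm d\beta+\frac12\int_0^\alpha\sum_{i,j}[\vec f_i,\vec f_j]\,\mathrm{id}(y_{s,t}(\beta,a))\,\mathbf x^{i,j}_{s,t}\,\mathrm d\beta ,$$ and set $\chi_{t,s}(a):=y_{s,t}(1,a)$. Then $\chi$ is an almost flow which generates a Lipschitz manifold of solutions. Moreover $\chi^\pi$ converges, as the mesh of $\pi$ goes to $0$, to Davie's flow $\psi$, i.e. to the Lipschitz flow which is the limit of $\phi^\pi$ for $$\phi_{t,s}(a)=a+\sum_i\vec f_i\,\mathrm{id}(a)\,\mathbf x^i_{s,t}+\sum_{i,j}\vec f_i\vec f_j\,\mathrm{id}(a)\,\mathbf x^{i,j}_{s,t}.$$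
   Context: Notation. $\omega$ is a control on $[0,T]$: $\omega_{s,t}\ge0$ for $0\le s\le t\le T$, super-additive ($\omega_{r,s}+\omega_{s,t}\le\omega_{r,t}$), continuous near the diagonal, $\omega_{s,s}=0$. $\|g\|_\infty$ is the sup norm. $\delta:\mathbb R_+\to\mathbb R_+$ denotes a non-decreasing function with $\lim_{T'\to0}\delta_{T'}=0$. $\mathcal C_b^{2+\gamma}$: bounded functions with bounded Fréchet derivatives up to order $2$, the second one $\gamma$-Hölder (Lipschitz if $\gamma=1$). Vector fields. Each $\vec f_i$ acts as a first-order differential operator: $\vec f_i g(a)=\mathrm dg(a)(f_i(a))$ with $f_i=\vec f_i\,\mathrm{id}:V\to V$; thus $\vec f_i\vec f_j\,\mathrm{id}(a)=\mathrm df_j(a)(f_i(a))$. The Lie bracket is $[\vec f_i,\vec f_j]=\vec f_i\vec f_j-\vec f_j\vec f_i$, itself a vector field. Weak-geometric $p$-rough path controlled by $\omega$, in coordinates: reals $\mathbf x^i_{s,t},\mathbf x^{i,j}_{s,t}$, $i,j\in\{1,\dots,\ell\}$, with $\mathbf x^i_{r,t}=\mathbf x^i_{r,s}+\mathbf x^i_{s,t}$, $\mathbf x^{i,j}_{r,t}=\mathbf x^{i,j}_{r,s}+\mathbf x^{i,j}_{s,t}+\mathbf x^i_{r,s}\mathbf x^j_{s,t}$ for $r\le s\le t$, $|\mathbf x^i_{s,t}|\le C\omega_{s,t}^{1/p}$, $|\mathbf x^{i,j}_{s,t}|\le C\omega_{s,t}^{2/p}$, and $\mathbf x^{i,j}_{s,t}+\mathbf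 x^{j,i}_{s,t}=\mathbf x^i_{s,t}\mathbf x^j_{s,t}$. Almost flow (with respect to $\omega,\varpi,\gamma$). A family of continuous maps $\chi_{t,s}:V\to V$, $0\le s\le t\le T$, for which there are a non-decreasing function $\delta:\mathbb R_+\to\mathbb R_+$ with $\lim_{T'\to0}\delta_{T'}=0$, a constant $M\ge0$ and a continuous increasing $\eta:[0,\omega_{0,T}]\to\mathbb R_+$ with $\eta(\omega_{s,t})\varpi(\omega_{s,t})^\gamma\le\delta_{T'}\varpi(\omega_{s,t})$ for $0\le s\le t\le T'$, such that for every $T'\in(0,T]$, all $0\le r\le s\le t\le T'$, $a,b\in V$: $\chi_{t,t}=\mathrm{id}$; $\|\chi_{t,s}-\mathrm{id}\|_\infty\le\delta_{T'}$; $|\chi_{t,s}(b)-\chi_{t,s}(a)|\le(1+\delta_{T'})|b-a|+\eta(\omega_{s,t})|b-a|^\gamma$; $\|\chi_{t,s}\circ\chi_{s,r}-\chi_{t,r}\|_\infty\le M\varpi(\omega_{r,t})$. Iterated product. For a partition $\pi$ of $[0,T]$ and $s\le t$, if $t_i<\dots<t_j$ are the points of $\pi$ in $[s,t]$, $\chi^\pi_{t,s}:=\chi_{t,t_j}\circ\chi_{t_j,t_{j-1}}\circ\dots\circ\chi_{t_{i+1},t_i}\circ\chi_{t_i,s}$; if there are none, $\chi^\pi_{t,s}:=\chi_{t,s}$ (same for $\phi^\pi$). Convergence is pointwise: $\chi^\pi_{t,s}(a)\to\psi_{t,s}(a)$ for all $s\le t$, $a\in V$. A flow is a family $(\psi_{t,s})_{s\le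 t}$ with $\psi_{t,t}=\mathrm{id}$ and $\psi_{t,s}\circ\psi_{s,r}=\psi_{t,r}$ for $r\le s\le t$; Lipschitz if the $\psi_{t,s}$ are Lipschitz with uniformly bounded constants. Manifold of solutions generated by $\chi$ (solutions to $\mathrm dy=\chi_{\mathrm dt}(y)$). A family of paths $\{y_{r\curvearrowright\cdot}(a)\}_{r\in[0,T],a\in V}$, $y_{r\curvearrowright\cdot}(a):[r,T]\to V$, with $y_{r\curvearrowright r}(a)=a$, such that for each $(r,a)$ there is a constant $C$ with $|y_{r\curvearrowright t}(a)-\chi_{t,s}(y_{r\curvearrowright s}(a))|\le C\varpi(\omega_{s,t})$ for all $r\le s\le t\le T$. It is Lipschitz if $a\mapsto y_{r\curvearrowright\cdot}(a)$ is uniformly (in $r$) Lipschitz from $V$ to $(\mathcal C([r,T],V),\|\cdot\|_\infty)$. *)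

(* Defs.v *)
From Stdlib Require Import Reals Lra.
From Coquelicot Require Import Coquelicot.
From mathcomp Require seq.

Open Scope R_scope.

(** [rpow x a] is [x ^ a] for [x >= 0] and [a > 0], with [0 ^ a = 0]; the
    standard [Rpower] is not usable at [0], where [Rpower 0 a = 1]. *)
Definition rpow (x a : R) : R := if Rle_dec x 0 then 0 else Rpower x a.

Definition sum_idx {V : AbelianMonoid} (l : nat) (u : nat -> V) : V :=
  sum_n_m u 1 l.

Definition in_idx (l i : nat) : Prop := (1 <= i <= l)%nat.

Section Calculus.

Context {V : CompleteNormedModule R_AbsRing}.

(** The Fréchet differential [dg(a)] of [g] at [a], as a total operator: it is
    unspecified when [g] is not differentiable at [a] (see [diff_unique]). *)
Definition diff (g : V -> V) (a v : V) : V :=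
  iota (fun w => exists L : V -> V, filterdiff g (locally a) L /\ w = L v).

Lemma diff_unique (g L : V -> V) (a v : V) :
  filterdiff g (locally a) L -> diff g a v = L v.
Proof.
intros HL; unfold diff.
assert (Hu : forall L', filterdiff g (locally a) L' -> forall u, L' u = L u).
{ intros L' HL' u.
  assert (Hsmall : forall eps : posreal,
            norm (minus (L' u) (L u)) <= 2 * eps * norm u).
  { intros eps.
    destruct HL as [Hlin HL]; destruct HL' as [Hlin' HL'].
    specialize (HL a (fun P HP => HP) eps).
    specialize (HL' a (fun P HP => HP) eps).
    destruct (filter_and _ _ HL HL') as [d Hd0].
    assert (Hd : forall y : V, ball a d y ->
      norm (minus (minus (g y) (g a)) (L (minus y a)))
        <= eps * norm (minus y a) /\
      norm (minus (minus (g y) (g a)) (L' (minus y a)))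
        <= eps * norm (minus y a)) by exact Hd0.
    clear Hd0.
    assert (Hn := norm_ge_0 u); assert (Hd0 := cond_pos d).
    pose (t := d / (2 * (norm u + 1))).
    assert (Ht : 0 < t) by (apply Rdiv_lt_0_compat; lra).
    assert (Htu : norm (scal t u) < d).
    { apply Rle_lt_trans with (Rabs t * norm u); [apply (norm_scal t u)|].
      rewrite (Rabs_pos_eq t) by lra.
      apply Rle_lt_trans with (t * (norm u + 1)); [nra|].
      unfold t; replace (d / (2 * (norm u + 1)) * (norm u + 1)) with (d / 2)
        by (field; lra); lra. }
    pose (h := scal t u : V); change (scal t u) with h in Htu.
    assert (Hb : exists b : V, minus b a = h).
    { exists (plus a h); unfold minus; rewrite (plus_comm a h), <- plus_assoc.
      etransitivity; [apply f_equal; apply (@plus_opp_r V)|].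
      apply (@plus_zero_r V). }
    destruct Hb as [b Hb].
    destruct (Hd b) as [H1 H2].
    { apply (norm_compat1 a b d).
      change (norm (minus b a) < d); rewrite Hb; exact Htu. }
    rewrite Hb in H1, H2.
    set (D := minus (g b) (g a)) in H1, H2.
    assert (H3 : norm (minus (L' h) (L h)) <= 2 * eps * norm h).
    { replace (minus (L' h) (L h)) with (plus (minus (L' h) D) (minus D (L h)))
        by (symmetry; apply (@minus_trans V)).
      eapply Rle_trans; [apply (@norm_triangle R_AbsRing V)|].
      replace (minus (L' h) D) with (opp (minus D (L' h)))
        by apply (@opp_minus V).
      assert (Ho := @norm_opp R_AbsRing V (minus D (L' h))).
      change (norm (opp (minus D (L' h))) = norm (minus D (L' h))) in Ho.
      rewrite Ho; lra. }
    unfold h in H3.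
    replace (minus (L' (scal t u)) (L (scal t u)))
      with (scal t (minus (L' u) (L u))) in H3
      by (transitivity (minus (scal t (L' u)) (scal t (L u)));
          [ apply (@scal_minus_distr_l R_Ring V)
          | apply f_equal2; symmetry;
            [apply (linear_scal L' Hlin') | apply (linear_scal L Hlin)] ]).
    set (w := minus (L' u) (L u)) in *.
    assert (E1 : norm w <= Rabs (/ t) * norm (scal t w)).
    { replace w with (scal (/ t) (scal t w)) at 1
        by (etransitivity; [apply (@scal_assoc R_Ring V)|];
            replace (mult (/ t) t) with (@one R_Ring)
              by (symmetry; apply (Rinv_l t); lra);
            apply (@scal_one R_Ring V)).
      apply (@norm_scal R_AbsRing V (/ t) (scal t w)). }
    assert (E2 : norm (scal t u) <= Rabs t * norm u)
      by apply (@norm_scal R_AbsRing V t u).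
    assert (Hit := Rinv_0_lt_compat t Ht).
    rewrite Rabs_pos_eq in E1, E2 by lra.
    assert (He := cond_pos eps).
    eapply Rle_trans; [exact E1|].
    apply Rle_trans with (/ t * (2 * eps * (t * norm u))).
    - apply Rmult_le_compat_l; [lra|].
      eapply Rle_trans; [exact H3|].
      apply Rmult_le_compat_l; [lra|exact E2].
    - right; field; lra. }
  assert (H0 : norm (minus (L' u) (L u)) = 0).
  { apply Rle_antisym; [|apply norm_ge_0].
    apply Rnot_lt_le; intros Hpos.
    assert (Hn := norm_ge_0 u).
    assert (He : 0 < norm (minus (L' u) (L u)) / (4 * (norm u + 1)))
      by (apply Rdiv_lt_0_compat; lra).
    specialize (Hsmall (mkposreal _ He)); simpl in Hsmall.
    set (m := norm (minus (L' u) (L u))) in *.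
    assert (m / (4 * (norm u + 1)) * (4 * (norm u + 1)) = m)
      by (field; lra).
    nra. }
  apply norm_eq_zero in H0.
  transitivity (plus (minus (L' u) (L u)) (L u)).
  - unfold minus; rewrite <- plus_assoc.
    symmetry; etransitivity; [apply f_equal; apply (@plus_opp_l V)|].
    apply (@plus_zero_r V).
  - rewrite H0; apply (@plus_zero_l V). }
assert (Hex : exists! w, exists L0, filterdiff g (locally a) L0 /\ w = L0 v).
{ exists (L v); split; [exists L; split; [exact HL|reflexivity]|].
  intros w [L0 [H0 ->]]; symmetry; apply Hu, H0. }
destruct (iota_correct _ Hex) as [L0 [H0 E]].
exact (eq_trans E (Hu L0 H0 v)).
Qed.

(** A vector field is represented by its coefficient [F : V -> V], the image
    of the identity; it acts on [g] by [a |-> dg(a)(F(a))]. In the same way,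
    [lie F G] is the image of the identity under the bracket. *)
Definition vf (F g : V -> V) (a : V) : V := diff g a (F a).

Definition lie (F G : V -> V) (a : V) : V := minus (vf F G a) (vf G F a).

(** The second derivative is [D2 a : V -> L(V, V)], [h |-> (v |-> D2 a h v)].
    The sixth clause is the Fréchet differentiability of [diff f] with values
    in [L(V, V)] equipped with the operator norm, and the bounds are bounds on
    the operator norms. *)
Definition Cb_2plus (gamma : R) (f : V -> V) : Prop :=
  exists (D2 : V -> V -> V -> V) (C : R),
    (forall a, ex_filterdiff f (locally a)) /\
    (forall a, norm (f a) <= C) /\
    (forall a v, norm (diff f a v) <= C * norm v) /\
    (forall a h, is_linear (D2 a h)) /\
    (forall a v, is_linear (fun h => D2 a h v)) /\
    (forall a (eps : posreal), locally a (fun b => forall v,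
       norm (minus (minus (diff f b v) (diff f a v)) (D2 a (minus b a) v))
         <= eps * norm (minus b a) * norm v)) /\
    (forall a h v, norm (D2 a h v) <= C * norm h * norm v) /\
    (forall a b h v, norm (minus (D2 b h v) (D2 a h v))
       <= C * rpow (norm (minus b a)) gamma * norm h * norm v).

End Calculus.

(** Two-parameter families are functions of two reals of which only the values
    on [0 <= s <= t <= T] matter. Continuity near the diagonal means joint
    continuity, relative to this domain, on some strip [t - s < eps]. *)
Record control (T : R) (omega : R -> R -> R) : Prop := {
  control_ge0 : forall s t, 0 <= s -> s <= t -> t <= T -> 0 <= omega s t;
  control_super : forall r s t, 0 <= r -> r <= s -> s <= t -> t <= T ->
    omega r s + omega s t <= omega r t;
  control_cont : exists eps : posreal,
    forall s t, 0 <= s -> s <= t -> t <= T -> t - s < eps ->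
      filterlim (fun q : R * R => omega (fst q) (snd q))
        (within (fun q : R * R => 0 <= fst q /\ fst q <= snd q /\ snd q <= T)
           (locally (s, t)))
        (locally (omega s t));
  control_diag : forall s, 0 <= s -> s <= T -> omega s s = 0
}.

(** [x1 i s t] and [x2 i j s t] are the coordinates of the first and second
    levels, for [i, j] in [1, ..., l]. *)
Record weak_geometric_rough_path (l : nat) (p T : R) (omega : R -> R -> R)
    (x1 : nat -> R -> R -> R) (x2 : nat -> nat -> R -> R -> R) : Prop := {
  rough_chen1 : forall i r s t, in_idx l i ->
    0 <= r -> r <= s -> s <= t -> t <= T ->
    x1 i r t = x1 i r s + x1 i s t;
  rough_chen2 : forall i j r s t, in_idx l i -> in_idx l j ->
    0 <= r -> r <= s -> s <= t -> t <= T ->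
    x2 i j r t = x2 i j r s + x2 i j s t + x1 i r s * x1 j s t;
  rough_bound : exists C : R,
    (forall i s t, in_idx l i -> 0 <= s -> s <= t -> t <= T ->
       Rabs (x1 i s t) <= C * rpow (omega s t) (1 / p)) /\
    (forall i j s t, in_idx l i -> in_idx l j ->
       0 <= s -> s <= t -> t <= T ->
       Rabs (x2 i j s t) <= C * rpow (omega s t) (2 / p));
  rough_geometric : forall i j s t, in_idx l i -> in_idx l j ->
    0 <= s -> s <= t -> t <= T ->
    x2 i j s t + x2 j i s t = x1 i s t * x1 j s t
}.

(** A family [chi] is applied as [chi t s a], for the image of [a] under
    [chi_{t,s}] with [s <= t]. *)

Section Flows.

Context {V : CompleteNormedModule R_AbsRing}.

Definition vanishing_modulus (delta : R -> R) : Prop :=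
  (forall u, 0 <= u -> 0 <= delta u) /\
  (forall u v, 0 <= u -> u <= v -> delta u <= delta v) /\
  filterlim delta (at_right 0) (locally 0).

Definition almost_flow (T : R) (omega : R -> R -> R) (varpi : R -> R)
    (gamma : R) (chi : R -> R -> V -> V) : Prop :=
  (forall s t a, 0 <= s -> s <= t -> t <= T -> continuous (chi t s) a) /\
  exists (delta : R -> R) (M : R) (eta : R -> R),
    vanishing_modulus delta /\
    0 <= M /\
    (forall u, 0 <= u <= omega 0 T -> 0 <= eta u) /\
    (forall u v, 0 <= u -> u < v -> v <= omega 0 T -> eta u < eta v) /\
    (forall u, 0 <= u <= omega 0 T ->
       filterlim eta (within (fun v => 0 <= v <= omega 0 T) (locally u))
         (locally (eta u))) /\
    forall T', 0 < T' <= T ->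
      (forall s t, 0 <= s -> s <= t -> t <= T' ->
         eta (omega s t) * rpow (varpi (omega s t)) gamma
           <= delta T' * varpi (omega s t)) /\
      (forall t a, 0 <= t -> t <= T' -> chi t t a = a) /\
      (forall s t a, 0 <= s -> s <= t -> t <= T' ->
         norm (minus (chi t s a) a) <= delta T') /\
      (forall s t a b, 0 <= s -> s <= t -> t <= T' ->
         norm (minus (chi t s b) (chi t s a))
           <= (1 + delta T') * norm (minus b a)
              + eta (omega s t) * rpow (norm (minus b a)) gamma) /\
      (forall r s t a, 0 <= r -> r <= s -> s <= t -> t <= T' ->
         norm (minus (chi t s (chi s r a)) (chi t r a))
           <= M * varpi (omega r t)).

Definition partition_of (T : R) (pi : list R) : Prop :=
  sorted Rlt pi /\ seq.head 0 pi = 0 /\ seq.last 0 pi = T.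

Fixpoint chain (chi : R -> R -> V -> V) (us : list R) (t s : R) (a : V) : V :=
  match us with
  | nil => chi t s a
  | cons u us' => chain chi us' t u (chi u s a)
  end.

Definition points_in (s t : R) (pi : list R) : list R :=
  List.filter (fun u =>
    if Rle_dec s u then if Rle_dec u t then true else false else false) pi.

Definition iterated_product (chi : R -> R -> V -> V) (pi : list R)
    (t s : R) (a : V) : V :=
  chain chi (points_in s t pi) t s a.

(** [seq_step pi] is the mesh of [pi]. *)
Definition iterated_product_cvg (T : R) (chi psi : R -> R -> V -> V) : Prop :=
  forall s t a, 0 <= s -> s <= t -> t <= T ->
    filterlim (fun pi => iterated_product chi pi t s a)
      (within (partition_of T) (locally_dist seq_step))
      (locally (psi t s a)).

Definition flow (T : R) (psi : R -> R -> V -> V) : Prop :=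
  (forall t a, 0 <= t -> t <= T -> psi t t a = a) /\
  (forall r s t a, 0 <= r -> r <= s -> s <= t -> t <= T ->
     psi t s (psi s r a) = psi t r a).

Definition lipschitz_flow (T : R) (psi : R -> R -> V -> V) : Prop :=
  flow T psi /\
  exists L : R, forall s t a b, 0 <= s -> s <= t -> t <= T ->
    norm (minus (psi t s b) (psi t s a)) <= L * norm (minus b a).

(** [y r t a] is the value at time [t >= r] of the path started at [a] at
    time [r]. *)
Definition manifold_of_solutions (T : R) (omega : R -> R -> R)
    (varpi : R -> R) (chi : R -> R -> V -> V) (y : R -> R -> V -> V) : Prop :=
  (forall r a, 0 <= r -> r <= T -> y r r a = a) /\
  (forall r a, 0 <= r -> r <= T ->
     exists C : R, forall s t, r <= s -> s <= t -> t <= T ->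
       norm (minus (y r t a) (chi t s (y r s a))) <= C * varpi (omega s t)).

Definition lipschitz_manifold (T : R) (y : R -> R -> V -> V) : Prop :=
  (forall r a t, 0 <= r -> r <= t -> t <= T ->
     filterlim (fun u => y r u a)
       (within (fun u => r <= u <= T) (locally t)) (locally (y r t a))) /\
  exists L : R, forall r a b t, 0 <= r -> r <= t -> t <= T ->
    norm (minus (y r t b) (y r t a)) <= L * norm (minus b a).

End Flows.

Section OneStep.

Context {V : CompleteNormedModule R_AbsRing}.
Context (l : nat) (f : nat -> V -> V).
Context (x1 : nat -> R -> R -> R) (x2 : nat -> nat -> R -> R -> R).

Definition drift1 (s t : R) (b : V) : V :=
  sum_idx l (fun i => scal (x1 i s t) (f i b)).

Definition drift2 (s t : R) (b : V) : V :=
  sum_idx l (fun i => sum_idx l (fun j =>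
    scal (x2 i j s t) (lie (f i) (f j) b))).

Definition log_ode_solution (s t : R) (a : V) (z : R -> V) : Prop :=
  forall alpha, 0 <= alpha <= 1 ->
    ex_RInt (fun beta => drift1 s t (z beta)) 0 alpha /\
    ex_RInt (fun beta => drift2 s t (z beta)) 0 alpha /\
    z alpha = plus a
      (plus (RInt (fun beta => drift1 s t (z beta)) 0 alpha)
            (scal (1 / 2) (RInt (fun beta => drift2 s t (z beta)) 0 alpha))).

Definition davie (t s : R) (a : V) : V :=
  plus a
    (plus (sum_idx l (fun i => scal (x1 i s t) (f i a)))
          (sum_idx l (fun i => sum_idx l (fun j =>
             scal (x2 i j s t) (vf (f i) (f j) a))))).

End OneStep.

(* Main.v *)
Require Import Defs.
From Stdlib Require Import Reals Lra Lia List Wf_nat ClassicalEpsilon.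
From Coquelicot Require Import Coquelicot.

(** Write [eps] for [omega s t ^ (1 / p)], so that [varpi (omega s t)] is
    [eps ^ (2 + gamma)], and [theta] for [(2 + gamma) / p]. As [theta > 1],
    errors of size [varpi (omega s t)] made on each interval of a partition add
    up to a quantity that vanishes with the mesh.

    Davie's scheme [phi] comes first. By Chen's relations the composition of
    two steps of [phi] differs from a single step by Taylor remainders of order
    [2 + gamma]. As the fields are of class [2 + gamma], this defect is not only
    small but also Lipschitz in the starting point, with a constant of the same
    order (lemma [step_comp_defect]). This is what keeps long products of [phi]
    Lipschitz: the steps themselves have Lipschitz constants [1 + K eps], whose
    product over a fine partition is unbounded. Davie's argument of cutting an
    interval where [omega] reaches half of its value shows that every product
    of [phi] along a grid stays within [O (varpi)] of one step, both uniformly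
    and for the Lipschitz seminorm (lemmas [grid_product_close_local] and
    [grid_product_close]). The products along dyadic grids then converge to a
    Lipschitz flow [psi] at distance [O (varpi)] from [phi] (theorem
    [scheme_flow]).

    The map [chi] is compared with [phi] on single steps only. Grönwall's
    inequality bounds its Lipschitz constant by [1 + K eps] (lemma
    [solves_lipschitz]). Expanding the differential equation to third order,
    with [F1] and [F2] its two drifts, gives
    [chi = id + F1 + (dF1 F1 + F2) / 2 + O (eps ^ 3)] (lemma
    [solves_expansion]), and the relation [x^ij + x^ji = x^i x^j] turns the
    second-order term into that of [phi] (lemma [log_drift_second_order]).
    So [chi] is within [O (varpi)] of [phi], hence of [psi]. It follows that
    [chi] is an almost flow because [phi] is one, that the paths of [psi] solve
    [dy = chi (y)], and, by telescoping against the Lipschitz flow [psi], that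
    the iterated products of [phi] and of [chi] both converge to [psi] (lemma
    [iterated_product_cvg_of_close]). *)

(** * Identities in modules over the reals *)

(** Linear identities between vectors are proved by reflection: both sides are
    evaluated to their coefficient functions on the list of atoms, and only the
    equalities of coefficients remain. *)
Inductive vexpr :=
| VAtom (n : nat)
| VZero
| VPlus (e1 e2 : vexpr)
| VOpp (e : vexpr)
| VMinus (e1 e2 : vexpr)
| VScal (r : R) (e : vexpr).

Fixpoint vcoef (e : vexpr) (n : nat) : R :=
  match e with
  | VAtom m => if Nat.eqb m n then 1 else 0
  | VZero => 0
  | VPlus e1 e2 => vcoef e1 n + vcoef e2 n
  | VOpp e => - vcoef e n
  | VMinus e1 e2 => vcoef e1 n - vcoef e2 n
  | VScal r e => r * vcoef e n
  end.

Section Reification.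

Context {V : ModuleSpace R_Ring}.

Fixpoint veval (env : list V) (e : vexpr) : V :=
  match e with
  | VAtom n => nth n env zero
  | VZero => zero
  | VPlus e1 e2 => plus (veval env e1) (veval env e2)
  | VOpp e => opp (veval env e)
  | VMinus e1 e2 => minus (veval env e1) (veval env e2)
  | VScal r e => scal r (veval env e)
  end.

Fixpoint vlin (c : nat -> R) (env : list V) : V :=
  match env with
  | nil => zero
  | v :: env' => plus (scal (c O) v) (vlin (fun n => c (S n)) env')
  end.

Fixpoint vcoef_eq (c c' : nat -> R) (env : list V) : Prop :=
  match env with
  | nil => True
  | _ :: env' =>
      c O = c' O /\ vcoef_eq (fun n => c (S n)) (fun n => c' (S n)) env'
  end.

Lemma vlin_ext (env : list V) :
  forall c c', vcoef_eq c c' env -> vlin c env = vlin c' env.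
Proof.
induction env as [|v env IH]; intros c c'; simpl; [reflexivity|].
intros [-> H]; f_equal; apply IH, H.
Qed.

Lemma vlin_zero (env : list V) : vlin (fun _ => 0) env = zero.
Proof.
induction env as [|v env IH]; simpl; [reflexivity|].
rewrite IH, plus_zero_r; apply (scal_zero_l v).
Qed.

Lemma vlin_plus (env : list V) : forall c c',
  vlin (fun n => c n + c' n) env = plus (vlin c env) (vlin c' env).
Proof.
induction env as [|v env IH]; intros c c'; simpl.
- symmetry; apply plus_zero_l.
- rewrite IH.
  change (c O + c' O) with (plus (c O : R_Ring) (c' O)).
  rewrite (scal_distr_r (c O : R_Ring) (c' O)).
  rewrite <- !plus_assoc; f_equal.
  rewrite !plus_assoc; f_equal; apply plus_comm.
Qed.

Lemma vlin_scal (env : list V) : forall r c,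
  vlin (fun n => r * c n) env = scal r (vlin c env).
Proof.
induction env as [|v env IH]; intros r c; simpl.
- symmetry; apply (scal_zero_r (r : R_Ring)).
- rewrite IH, (scal_distr_l (r : R_Ring)); f_equal.
  symmetry; apply (scal_assoc (r : R_Ring)).
Qed.

Lemma vlin_atom (env : list V) : forall m,
  vlin (fun n => if Nat.eqb m n then 1 else 0) env = nth m env zero.
Proof.
induction env as [|v env IH]; intros [|m]; simpl; auto.
- rewrite vlin_zero, plus_zero_r; apply (scal_one v).
- rewrite IH; etransitivity; [|apply plus_zero_l]; f_equal.
  apply (scal_zero_l v).
Qed.

Lemma veval_vlin (env : list V) (e : vexpr) :
  veval env e = vlin (vcoef e) env.
Proof.
assert (Hopp : forall c, vlin (fun n => - c n) env = opp (vlin c env)).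
{ intros c; rewrite <- (scal_opp_one (vlin c env)).
  rewrite <- (vlin_scal env (-1)); apply vlin_ext.
  generalize c; induction env as [|v env' IH]; intros c0; simpl; auto.
  split; [ring|apply (IH (fun n => c0 (S n)))]. }
induction e as [m| |e1 IH1 e2 IH2|e IH|e1 IH1 e2 IH2|r e IH]; simpl.
- symmetry; apply vlin_atom.
- symmetry; apply vlin_zero.
- rewrite IH1, IH2; symmetry; apply vlin_plus.
- rewrite IH; symmetry; apply Hopp.
- rewrite IH1, IH2; unfold minus; rewrite <- Hopp; symmetry; apply vlin_plus.
- rewrite IH; symmetry; apply vlin_scal.
Qed.

Lemma veval_eq (env : list V) (e1 e2 : vexpr) :
  vcoef_eq (vcoef e1) (vcoef e2) env -> veval env e1 = veval env e2.
Proof. rewrite !veval_vlin; apply vlin_ext. Qed.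

End Reification.

Ltac vec_mem x env :=
  lazymatch env with
  | nil => constr:(false)
  | x :: _ => constr:(true)
  | _ :: ?env' => vec_mem x env'
  end.

Ltac vec_env env e :=
  lazymatch e with
  | plus ?a ?b => let env' := vec_env env a in vec_env env' b
  | minus ?a ?b => let env' := vec_env env a in vec_env env' b
  | opp ?a => vec_env env a
  | scal _ ?a => vec_env env a
  | zero => env
  | _ => lazymatch vec_mem e env with
         | true => env
         | false => constr:(e :: env)
         end
  end.

Ltac vec_index x env :=
  lazymatch env with
  | x :: _ => constr:(O)
  | _ :: ?env' => let n := vec_index x env' in constr:(S n)
  end.

Ltac vec_reify env e :=
  lazymatch e with
  | plus ?a ?b =>
      let a' := vec_reify env a in let b' := vec_reify env b in
      constr:(VPlus a' b')
  | minus ?a ?b =>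
      let a' := vec_reify env a in let b' := vec_reify env b in
      constr:(VMinus a' b')
  | opp ?a => let a' := vec_reify env a in constr:(VOpp a')
  | scal ?r ?a => let a' := vec_reify env a in constr:(VScal r a')
  | zero => constr:(VZero)
  | _ => let n := vec_index e env in constr:(VAtom n)
  end.

(** The reified terms are matched with the goal by conversion, which absorbs
    the different paths by which the operations of a normed module are
    inferred. *)
Ltac vec :=
  match goal with
  | |- @eq ?T ?a ?b =>
      let env0 := vec_env (@nil T) a in
      let env := vec_env env0 b in
      let a' := vec_reify env a in
      let b' := vec_reify env b in
      refine (veval_eq env a' b' _);
      cbv [vcoef_eq vcoef Nat.eqb];
      repeat split; try ring; try field
  end.

(** * Powers *)

Lemma rpow_ge0 (x a : R) : 0 <= rpow x a.
Proof.
unfold rpow; destruct (Rle_dec x 0); [lra|left; apply exp_pos].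
Qed.

Lemma rpow_gt0 (x a : R) : 0 < x -> 0 < rpow x a.
Proof.
intros Hx; unfold rpow; destruct (Rle_dec x 0); [lra|apply exp_pos].
Qed.

Lemma rpow_0 (a : R) : rpow 0 a = 0.
Proof. unfold rpow; destruct (Rle_dec 0 0); [reflexivity|lra]. Qed.

Lemma rpow_pos (x a : R) : 0 < x -> rpow x a = Rpower x a.
Proof. intros Hx; unfold rpow; destruct (Rle_dec x 0); [lra|reflexivity]. Qed.

Lemma rpow_le (x y a : R) : 0 <= a -> x <= y -> rpow x a <= rpow y a.
Proof.
intros Ha Hxy; destruct (Rle_dec x 0) as [Hx|Hx].
- unfold rpow at 1; destruct (Rle_dec x 0); [apply rpow_ge0|lra].
- rewrite !rpow_pos by lra; apply Rle_Rpower_l; lra.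
Qed.

Lemma rpow_lt (x y a : R) : 0 < a -> 0 <= x -> x < y -> rpow x a < rpow y a.
Proof.
intros Ha Hx Hxy; destruct (Req_dec x 0) as [->|Hx0].
- rewrite rpow_0; apply rpow_gt0; lra.
- rewrite !rpow_pos by lra; apply Rlt_Rpower_l; lra.
Qed.

Lemma rpow_add (x a b : R) : rpow x (a + b) = rpow x a * rpow x b.
Proof.
unfold rpow; destruct (Rle_dec x 0); [ring|apply Rpower_plus].
Qed.

Lemma rpow_comp (x a b : R) : rpow (rpow x a) b = rpow x (a * b).
Proof.
destruct (Rle_dec x 0) as [Hx|Hx].
- unfold rpow at 2 3; destruct (Rle_dec x 0); [apply rpow_0|lra].
- rewrite (rpow_pos (rpow x a)) by (apply rpow_gt0; lra).
  rewrite !rpow_pos by lra; apply Rpower_mult.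
Qed.

Lemma rpow_mul (x y a : R) :
  0 <= x -> 0 <= y -> rpow (x * y) a = rpow x a * rpow y a.
Proof.
intros Hx Hy.
destruct (Req_dec x 0) as [->|Hx0]; [rewrite Rmult_0_l, rpow_0; ring|].
destruct (Req_dec y 0) as [->|Hy0]; [rewrite Rmult_0_r, rpow_0; ring|].
rewrite !rpow_pos; try lra; [|apply Rmult_lt_0_compat; lra].
symmetry; apply Rpower_mult_distr; lra.
Qed.

Lemma rpow_1 (x : R) : 0 <= x -> rpow x 1 = x.
Proof.
intros Hx; destruct (Req_dec x 0) as [->|Hx0]; [apply rpow_0|].
rewrite rpow_pos, Rpower_1; lra.
Qed.

Lemma rpow_base1 (a : R) : rpow 1 a = 1.
Proof.
rewrite rpow_pos by lra; unfold Rpower; rewrite ln_1, Rmult_0_r; apply exp_0.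
Qed.

Lemma rpow_ge_1 (x a : R) : 1 <= x -> 0 <= a -> 1 <= rpow x a.
Proof. intros Hx Ha; rewrite <- (rpow_base1 a); apply rpow_le; lra. Qed.

Lemma rpow_le_self (x a : R) : 1 <= x -> a <= 1 -> rpow x a <= x.
Proof.
intros Hx Ha; apply Rle_trans with (rpow x 1); [|rewrite rpow_1; lra].
rewrite !rpow_pos by lra; apply Rle_Rpower; lra.
Qed.

Lemma rpow_ge_self (x a : R) : 0 <= x <= 1 -> 0 <= a <= 1 -> x <= rpow x a.
Proof.
intros Hx Ha; destruct (Req_dec x 0) as [->|Hx0]; [apply rpow_ge0|].
assert (E : x = rpow x a * rpow x (1 - a)).
{ rewrite <- rpow_add; replace (a + (1 - a)) with 1 by ring.
  rewrite rpow_1; lra. }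
assert (H1 : rpow x (1 - a) <= 1)
  by (eapply Rle_trans; [apply (rpow_le x 1); lra|rewrite rpow_base1; lra]).
assert (H := rpow_ge0 x a); nra.
Qed.

Lemma rpow_small (a eps : R) :
  0 < a -> 0 < eps -> exists d, 0 < d /\ forall x, x <= d -> rpow x a <= eps.
Proof.
intros Ha He; exists (rpow eps (/ a)); split; [apply rpow_gt0, He|].
intros x Hx; eapply Rle_trans; [apply rpow_le; [lra|exact Hx]|].
rewrite rpow_comp, Rinv_l, rpow_1; lra.
Qed.

Lemma rpow_continuous (a x : R) : 0 < a -> 0 <= x ->
  filterlim (fun u => rpow u a) (locally x) (locally (rpow x a)).
Proof.
intros Ha Hx; destruct (Req_dec x 0) as [->|Hx0].
- rewrite rpow_0; intros P [eps HP].
  destruct (rpow_small a (eps / 2)) as [d [Hd Hs]]; [lra|destruct eps; simpl; lra|].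
  exists (mkposreal d Hd); intros u Hu; apply HP.
  change (Rabs (u - 0) < d) in Hu; change (Rabs (rpow u a - 0) < eps).
  apply Rabs_def2 in Hu; assert (H := rpow_ge0 u a).
  rewrite Rabs_pos_eq by lra; specialize (Hs u).
  destruct eps; simpl in *; lra.
- assert (Hpos : 0 < x) by lra; rewrite rpow_pos by lra.
  apply filterlim_ext_loc with (fun u => Rpower u a).
  + exists (mkposreal x Hpos); intros u Hu.
    change (Rabs (u - x) < x) in Hu; apply Rabs_def2 in Hu.
    symmetry; apply rpow_pos; lra.
  + apply (continuous_comp (fun u => a * ln u) exp).
    * apply (continuous_mult (fun _ => a) ln); [apply continuous_const|].
      apply continuity_pt_filterlim, derivable_continuous_pt.
      exists (/ x); apply derivable_pt_lim_ln, Hpos.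
    * apply continuity_pt_filterlim, derivable_continuous_pt.
      exists (exp (a * ln x)); apply derivable_pt_lim_exp.
Qed.

(** * Norms and the mean value inequality *)

Section Norms.

Context {V : CompleteNormedModule R_AbsRing}.
Implicit Types a b u v w : V.

Lemma norm_plus_le a b : norm (plus a b) <= norm a + norm b.
Proof. apply (norm_triangle a b). Qed.

Lemma norm_scal_le (r : R) v : norm (scal r v) <= Rabs r * norm v.
Proof. apply (norm_scal r v). Qed.

Lemma norm_scal_bound (r : R) v w (B : R) :
  w = scal r v -> norm v <= B -> norm w <= Rabs r * B.
Proof.
intros -> HB; eapply Rle_trans; [apply norm_scal_le|].
apply Rmult_le_compat_l; [apply Rabs_pos|exact HB].
Qed.

Lemma norm_opp_eq v : norm (opp v) = norm v.
Proof. exact (norm_opp v). Qed.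

Lemma norm_0 : norm (zero : V) = 0.
Proof. exact (@norm_zero R_AbsRing V). Qed.

Lemma norm_eq_0 v : norm v = 0 -> v = zero.
Proof. exact (norm_eq_zero v). Qed.

(** The decomposition of [v] is a premise of the next lemmas, to be checked by
    [vec]. *)
Lemma norm_split2 v a b : v = plus a b -> norm v <= norm a + norm b.
Proof. intros ->; apply norm_plus_le. Qed.

Lemma norm_split3 v a b c : v = plus a (plus b c) ->
  norm v <= norm a + norm b + norm c.
Proof.
intros ->; assert (H := norm_plus_le a (plus b c)).
assert (H' := norm_plus_le b c); lra.
Qed.

Lemma norm_split4 v a b c d : v = plus a (plus b (plus c d)) ->
  norm v <= norm a + norm b + norm c + norm d.
Proof.
intros ->; assert (H := norm_plus_le a (plus b (plus c d))).
assert (H' := norm_split3 (plus b (plus c d)) b c d eq_refl); lra.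
Qed.

Lemma norm_minus_sym a b : norm (minus a b) = norm (minus b a).
Proof.
rewrite <- (norm_opp_eq (minus b a)); f_equal; vec.
Qed.

Lemma norm_minus_self a : norm (minus a a) = 0.
Proof.
replace (minus a a) with (@zero V) by vec; apply norm_0.
Qed.

Lemma norm_minus_eq0 a b : norm (minus a b) <= 0 -> a = b.
Proof.
intros H; replace a with (plus b (minus a b)) by vec.
rewrite (norm_eq_0 (minus a b)).
- vec.
- apply Rle_antisym; [exact H|apply (norm_ge_0 (minus a b))].
Qed.

(** Every point with almost the right increment can be pushed a little further,
    so the supremum of such points is the right end of the interval. *)
Lemma mean_value_inequality (h dh : R -> V) (D : R) :
  (forall t, 0 <= t <= 1 -> is_derive h t (dh t) /\ norm (dh t) <= D) ->
  norm (minus (h 1) (h 0)) <= D.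
Proof.
intros Hh; apply Rle_plus_epsilon; intros eps Heps.
assert (HD : 0 <= D)
  by (destruct (Hh 0) as [_ H]; [lra|]; assert (H' := norm_ge_0 (dh 0)); lra).
assert (Hloc : forall t, 0 <= t <= 1 -> exists d : posreal, forall x,
          Rabs (x - t) < d ->
          norm (minus (h x) (h t)) <= (D + eps) * Rabs (x - t)).
{ intros t Ht; destruct (Hh t Ht) as [[_ Hd] Hn].
  specialize (Hd t (fun P HP => HP) (mkposreal eps Heps)).
  destruct Hd as [d Hd]; exists d; intros x Hx; specialize (Hd x Hx).
  change (norm (minus (minus (h x) (h t)) (scal (x - t) (dh t)))
            <= eps * Rabs (x - t)) in Hd.
  assert (H1 := norm_split2 (minus (h x) (h t))
    (minus (minus (h x) (h t)) (scal (x - t) (dh t)))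
    (scal (x - t) (dh t)) ltac:(vec)).
  assert (H2 := norm_scal_le (x - t) (dh t)).
  assert (H3 := Rabs_pos (x - t)); nra. }
pose (E := fun x => 0 <= x <= 1 /\ norm (minus (h x) (h 0)) <= (D + eps) * x).
assert (HE0 : E 0) by (split; [lra|rewrite norm_minus_self; lra]).
destruct (completeness E) as [s [Hub Hlub]].
{ exists 1; intros x [Hx _]; lra. }
{ exists 0; exact HE0. }
assert (Hs0 := Hub 0 HE0).
assert (Hs1 : s <= 1) by (apply Hlub; intros x [Hx _]; lra).
destruct (Hloc s) as [d Hd]; [lra|]; assert (Hdpos := cond_pos d).
assert (HEs : norm (minus (h s) (h 0)) <= (D + eps) * s).
{ destruct (Classical_Prop.classic (exists x, E x /\ s - d < x)) as [[x [Hx Hxs]]|Hno].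
  - assert (Hxle := Hub x Hx); destruct Hx as [Hx01 Hx].
    assert (Habs : Rabs (x - s) = s - x) by (rewrite Rabs_left1; lra).
    specialize (Hd x); rewrite Habs in Hd.
    rewrite (norm_minus_sym (h x) (h s)) in Hd.
    assert (H1 := norm_split2 (minus (h s) (h 0))
      (minus (h s) (h x)) (minus (h x) (h 0)) ltac:(vec)).
    assert (H2 := Hd ltac:(lra)); lra.
  - exfalso; assert (s <= s - d); [|lra].
    apply Hlub; intros x Hx; apply Rnot_lt_le; intros Hlt.
    apply Hno; exists x; split; assumption. }
destruct (Req_dec s 1) as [->|Hne]; [lra|].
exfalso.
set (x := Rmin 1 (s + d / 2)).
assert (Hx : s < x <= 1 /\ x - s < d).
{ unfold x; apply Rmin_case_strong; intros; lra. }
assert (HEx : E x); [|assert (H := Hub x HEx); lra].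
split; [lra|].
assert (Habs : Rabs (x - s) = x - s) by (rewrite Rabs_pos_eq; lra).
specialize (Hd x); rewrite Habs in Hd.
assert (H1 := norm_split2 (minus (h x) (h 0))
  (minus (h x) (h s)) (minus (h s) (h 0)) ltac:(vec)).
assert (H2 := Hd ltac:(lra)); lra.
Qed.

End Norms.

(** * Regularity of vector fields in terms of finite differences *)

Section Regularity.

Context {V : CompleteNormedModule R_AbsRing} (gamma : R).
Implicit Types a b u v w : V.

(** Bounded maps with a bounded [gamma]-Hölder derivative, read on four points,
    so that the derivative itself need not appear. *)
Record C1_holder (K : R) (g : V -> V) : Prop := {
  C1_bound : forall a, norm (g a) <= K;
  C1_lip : forall a b, norm (minus (g b) (g a)) <= K * norm (minus b a);
  C1_four : forall a b u,
    norm (minus (minus (g (plus b u)) (g b)) (minus (g (plus a u)) (g a)))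
      <= K * norm (minus b a) * rpow (norm u) gamma
}.

(** Bounded maps whose first two derivatives are bounded, the second one being
    [gamma]-Hölder. The Hölder bound shows through the last two clauses, which
    limit the increments in [a] of the first-order Taylor
    remainder of [f] at [a] and of the increments of [df]. *)
Record C2_holder (K : R) (f : V -> V) (df : V -> V -> V) : Prop := {
  C2_bound : forall a, norm (f a) <= K;
  C2_lip : forall a b, norm (minus (f b) (f a)) <= K * norm (minus b a);
  C2_diff_bound : forall a v, norm (df a v) <= K * norm v;
  C2_diff_minus : forall a u v, df a (minus u v) = minus (df a u) (df a v);
  C2_diff_scal : forall a r v, df a (scal r v) = scal r (df a v);
  C2_diff_lip : forall a b v,
    norm (minus (df b v) (df a v)) <= K * norm (minus b a) * norm v;
  C2_taylor : forall a u,
    norm (minus (minus (f (plus a u)) (f a)) (df a u))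
      <= K * norm u * norm u;
  C2_taylor_lip : forall a b u,
    norm (minus (minus (minus (f (plus b u)) (f b)) (df b u))
                (minus (minus (f (plus a u)) (f a)) (df a u)))
      <= K * norm (minus b a) * norm u * rpow (norm u) gamma;
  C2_diff_four : forall a b u v,
    norm (minus (minus (df (plus b u) v) (df b v))
                (minus (df (plus a u) v) (df a v)))
      <= K * norm (minus b a) * rpow (norm u) gamma * norm v
}.

Lemma is_derive_scal_id v (t : R) : is_derive (fun s : R => scal s v) t v.
Proof.
eapply filterdiff_ext_lin; [apply (is_derive_scal_l (K := R_AbsRing)
  (fun s => s) t 1 v (is_derive_id t))|intros y].
change (scal y (scal 1 v) = scal y v); vec.
Qed.

Lemma is_derive_line (g L : V -> V) a v (t : R) :
  filterdiff g (locally (plus a (scal t v))) L ->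
  is_derive (fun s => g (plus a (scal s v))) t (L v).
Proof.
intros HL.
assert (Hline : is_derive (fun s : R => plus a (scal s v)) t v).
{ eapply filterdiff_ext_lin;
    [apply (is_derive_plus (K := R_AbsRing) (V := V) (fun _ => a)
       (fun s => scal s v) t zero v (is_derive_const a t)
       (is_derive_scal_id v t))|intros y].
  change (scal y (plus zero v) = scal y v); vec. }
assert (H := filterdiff_comp' (fun s : R => plus a (scal s v)) g t
  (fun y => scal y v) L Hline HL).
eapply filterdiff_ext_lin; [exact H|intros y].
destruct HL as [Hlin _]; apply (linear_scal L Hlin).
Qed.

Lemma C1_holder_weaken (K K' : R) (g : V -> V) :
  K <= K' -> C1_holder K g -> C1_holder K' g.
Proof.
intros HK [H1 H2 H3]; split; intros.
- eapply Rle_trans; [apply H1|exact HK].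
- eapply Rle_trans; [apply H2|].
  apply Rmult_le_compat_r; [apply norm_ge_0|exact HK].
- eapply Rle_trans; [apply H3|].
  apply Rmult_le_compat_r; [apply rpow_ge0|].
  apply Rmult_le_compat_r; [apply norm_ge_0|exact HK].
Qed.

Lemma C2_holder_weaken (K K' : R) (f : V -> V) (df : V -> V -> V) :
  K <= K' -> C2_holder K f df -> C2_holder K' f df.
Proof.
intros HK [H1 H2 H3 H4 H5 H6 H7 H8 H9]; split; try assumption; intros.
- eapply Rle_trans; [apply H1|exact HK].
- eapply Rle_trans; [apply H2|].
  apply Rmult_le_compat_r; [apply norm_ge_0|exact HK].
- eapply Rle_trans; [apply H3|].
  apply Rmult_le_compat_r; [apply norm_ge_0|exact HK].
- eapply Rle_trans; [apply H6|].
  repeat (apply Rmult_le_compat_r; [apply norm_ge_0|]); exact HK.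
- eapply Rle_trans; [apply H7|].
  repeat (apply Rmult_le_compat_r; [apply norm_ge_0|]); exact HK.
- eapply Rle_trans; [apply H8|].
  apply Rmult_le_compat_r; [apply rpow_ge0|].
  repeat (apply Rmult_le_compat_r; [apply norm_ge_0|]); exact HK.
- eapply Rle_trans; [apply H9|].
  apply Rmult_le_compat_r; [apply norm_ge_0|].
  apply Rmult_le_compat_r; [apply rpow_ge0|].
  apply Rmult_le_compat_r; [apply norm_ge_0|exact HK].
Qed.

Lemma C1_holder_scal (K c : R) (g : V -> V) :
  C1_holder K g -> C1_holder (Rabs c * K) (fun a => scal c (g a)).
Proof.
intros [H1 H2 H3]; split; intros; rewrite ?Rmult_assoc.
- apply (norm_scal_bound c (g a)); [reflexivity|apply H1].
- apply (norm_scal_bound c (minus (g b) (g a))); [vec|apply H2].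
- apply (norm_scal_bound c
    (minus (minus (g (plus b u)) (g b)) (minus (g (plus a u)) (g a))));
    [vec|rewrite <- Rmult_assoc; apply H3].
Qed.

Lemma C2_holder_scal (K c : R) (f : V -> V) (df : V -> V -> V) :
  C2_holder K f df ->
  C2_holder (Rabs c * K) (fun a => scal c (f a)) (fun a v => scal c (df a v)).
Proof.
intros [H1 H2 H3 H4 H5 H6 H7 H8 H9]; split; intros; rewrite ?Rmult_assoc.
- apply (norm_scal_bound c (f a)); [reflexivity|apply H1].
- apply (norm_scal_bound c (minus (f b) (f a))); [vec|apply H2].
- apply (norm_scal_bound c (df a v)); [reflexivity|apply H3].
- rewrite H4; vec.
- rewrite H5; vec.
- apply (norm_scal_bound c (minus (df b v) (df a v)));
    [vec|rewrite <- !Rmult_assoc; apply H6].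
- apply (norm_scal_bound c (minus (minus (f (plus a u)) (f a)) (df a u)));
    [vec|rewrite <- !Rmult_assoc; apply H7].
- apply (norm_scal_bound c
    (minus (minus (minus (f (plus b u)) (f b)) (df b u))
           (minus (minus (f (plus a u)) (f a)) (df a u))));
    [vec|rewrite <- !Rmult_assoc; apply H8].
- apply (norm_scal_bound c
    (minus (minus (df (plus b u) v) (df b v))
           (minus (df (plus a u) v) (df a v))));
    [vec|rewrite <- !Rmult_assoc; apply H9].
Qed.

Lemma C1_holder_plus (K K' : R) (g g' : V -> V) :
  C1_holder K g -> C1_holder K' g' ->
  C1_holder (K + K') (fun a => plus (g a) (g' a)).
Proof.
intros [H1 H2 H3] [H1' H2' H3']; split; intros; rewrite ?Rmult_plus_distr_r.
- eapply Rle_trans; [apply norm_plus_le|apply Rplus_le_compat; auto].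
- eapply Rle_trans; [|apply Rplus_le_compat; [apply (H2 a b)|apply (H2' a b)]].
  apply norm_split2; vec.
- eapply Rle_trans;
    [|apply Rplus_le_compat; [apply (H3 a b u)|apply (H3' a b u)]].
  apply norm_split2; vec.
Qed.

Lemma C2_holder_plus (K K' : R) (f f' : V -> V) (df df' : V -> V -> V) :
  C2_holder K f df -> C2_holder K' f' df' ->
  C2_holder (K + K') (fun a => plus (f a) (f' a))
    (fun a v => plus (df a v) (df' a v)).
Proof.
intros [H1 H2 H3 H4 H5 H6 H7 H8 H9] [H1' H2' H3' H4' H5' H6' H7' H8' H9'].
split; intros; rewrite ?Rmult_plus_distr_r.
- eapply Rle_trans; [apply norm_plus_le|apply Rplus_le_compat; auto].
- eapply Rle_trans; [|apply Rplus_le_compat; [apply (H2 a b)|apply (H2' a b)]].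
  apply norm_split2; vec.
- eapply Rle_trans; [apply norm_plus_le|apply Rplus_le_compat; auto].
- rewrite H4, H4'; vec.
- rewrite H5, H5'; vec.
- eapply Rle_trans;
    [|apply Rplus_le_compat; [apply (H6 a b v)|apply (H6' a b v)]].
  apply norm_split2; vec.
- eapply Rle_trans; [|apply Rplus_le_compat; [apply (H7 a u)|apply (H7' a u)]].
  apply norm_split2; vec.
- eapply Rle_trans;
    [|apply Rplus_le_compat; [apply (H8 a b u)|apply (H8' a b u)]].
  apply norm_split2; vec.
- eapply Rle_trans;
    [|apply Rplus_le_compat; [apply (H9 a b u v)|apply (H9' a b u v)]].
  apply norm_split2; vec.
Qed.

Lemma C1_holder_ext (K : R) (g g' : V -> V) :
  (forall a, g a = g' a) -> C1_holder K g -> C1_holder K g'.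
Proof.
intros E [H1 H2 H3]; split; intros; rewrite <- !E; auto.
Qed.

Lemma C1_holder_zero : C1_holder 0 (fun _ => zero).
Proof.
split; intros; match goal with |- norm ?x <= _ =>
  replace x with (zero : V) by vec end; rewrite norm_0; right; ring.
Qed.

Lemma C2_holder_zero : C2_holder 0 (fun _ => zero) (fun _ _ => zero).
Proof.
split; intros; try vec; match goal with |- norm ?x <= _ =>
  replace x with (zero : V) by vec end; rewrite norm_0; right; ring.
Qed.

Lemma C1_holder_sum (K : R) (l : nat) (g : nat -> V -> V) :
  (forall i, in_idx l i -> C1_holder K (g i)) ->
  C1_holder (INR l * K) (fun a => sum_idx l (fun i => g i a)).
Proof.
unfold sum_idx; induction l as [|l IH]; intros H.
- assert (H0 := C1_holder_zero); rewrite Rmult_0_l.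
  destruct H0 as [H1 H2 H3]; split; intros;
    rewrite !sum_n_m_zero by lia; auto.
- rewrite S_INR, Rmult_plus_distr_r, Rmult_1_l.
  assert (H' := C1_holder_plus _ _ _ _
    (IH (fun i Hi => H i ltac:(unfold in_idx in *; lia)))
    (H (S l) ltac:(unfold in_idx; lia))).
  destruct H' as [H1 H2 H3]; split; intros;
    rewrite !sum_n_Sm by lia; auto.
Qed.

Lemma C2_holder_sum (K : R) (l : nat) (f : nat -> V -> V)
    (df : nat -> V -> V -> V) :
  (forall i, in_idx l i -> C2_holder K (f i) (df i)) ->
  C2_holder (INR l * K) (fun a => sum_idx l (fun i => f i a))
    (fun a v => sum_idx l (fun i => df i a v)).
Proof.
unfold sum_idx; induction l as [|l IH]; intros H.
- assert (H0 := C2_holder_zero); rewrite Rmult_0_l.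
  destruct H0 as [H1 H2 H3 H4 H5 H6 H7 H8 H9]; split; intros;
    rewrite !sum_n_m_zero by lia; auto.
- rewrite S_INR, Rmult_plus_distr_r, Rmult_1_l.
  assert (H' := C2_holder_plus _ _ _ _ _ _
    (IH (fun i Hi => H i ltac:(unfold in_idx in *; lia)))
    (H (S l) ltac:(unfold in_idx; lia))).
  destruct H' as [H1 H2 H3 H4 H5 H6 H7 H8 H9]; split; intros;
    rewrite !sum_n_Sm by lia; auto.
Qed.

End Regularity.

Section Calculus.

Context {V : CompleteNormedModule R_AbsRing} (gamma : R).
Context (Hgamma : 0 < gamma <= 1).
Implicit Types a b u v w : V.

(** The Taylor estimates follow from the mean value inequality along the
    segment from [a] to [a + u]. A second use of it, along the segment from [a]
    to [b], estimates the increment in [a] of the remainder; it produces the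
    values [D2 _ (b - a) u], whose variation the Hölder bound controls. *)
Lemma Cb_2plus_C2_holder (f : V -> V) :
  Cb_2plus gamma f -> exists K, 0 <= K /\ C2_holder gamma K f (diff f).
Proof.
intros (D2 & C & Hex & Hb & Hdb & Hlin2 & Hlin1 & Hd2 & HD2 & HD2h).
assert (HC : 0 <= C)
  by (specialize (Hb zero); assert (H := norm_ge_0 (f zero)); lra).
assert (Hfd : forall a, filterdiff f (locally a) (diff f a)).
{ intros a; destruct (Hex a) as [L HL].
  eapply filterdiff_ext_lin; [exact HL|].
  intros v; symmetry; apply diff_unique, HL. }
assert (Hlin : forall a, is_linear (diff f a)) by (intros a; apply Hfd).
assert (Hscal : forall a r v, diff f a (scal r v) = scal r (diff f a v))
  by (intros a r v; apply (linear_scal _ (Hlin a))).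
assert (Hplus : forall a u v,
          diff f a (plus u v) = plus (diff f a u) (diff f a v))
  by (intros a u v; apply (linear_plus _ (Hlin a))).
assert (Hminus : forall a u v,
          diff f a (minus u v) = minus (diff f a u) (diff f a v)).
{ intros a u v; replace (minus u v) with (plus u (scal (-1) v)) by vec.
  rewrite Hplus, Hscal; vec. }
assert (Hfd2 : forall a w, filterdiff (fun x => diff f x w) (locally a)
                 (fun h => D2 a h w)).
{ intros a w; split; [apply Hlin1|intros x Hx].
  assert (Ha : a = x) by exact (is_filter_lim_locally_unique a x Hx).
  rewrite <- Ha.
  intros eps; assert (Hw := norm_ge_0 w).
  assert (He : 0 < eps / (norm w + 1))
    by (apply Rdiv_lt_0_compat; [apply cond_pos|lra]).
  destruct (Hd2 a (mkposreal _ He)) as [d Hd]; exists d; intros b Hball.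
  eapply Rle_trans; [apply (Hd b Hball w)|]; simpl.
  assert (Hn := norm_ge_0 (minus b a)).
  assert (E : eps / (norm w + 1) * (norm w + 1) = eps) by (field; lra).
  assert (eps / (norm w + 1) * norm w <= eps) by nra.
  change (eps / (norm w + 1) * norm (minus b a) * norm w
            <= eps * norm (minus b a)); nra. }
assert (Hder : forall a v t,
          is_derive (fun s => f (plus a (scal s v))) t
            (diff f (plus a (scal t v)) v))
  by (intros a v t; apply is_derive_line, Hfd).
assert (Hder2 : forall a v w t,
          is_derive (fun s => diff f (plus a (scal s v)) w) t
            (D2 (plus a (scal t v)) v w)).
{ intros a v w t.
  apply (is_derive_line (fun x => diff f x w)
    (fun h => D2 (plus a (scal t v)) h w)), Hfd2. }
assert (Hend : forall a b, plus a (scal 1 (minus b a)) = b)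
  by (intros; vec).
assert (Hst : forall a v, plus a (scal 0 v) = a) by (intros; vec).
assert (Hlip : forall a b, norm (minus (f b) (f a)) <= C * norm (minus b a)).
{ intros a b.
  assert (H := mean_value_inequality (fun s => f (plus a (scal s (minus b a))))
    _ (C * norm (minus b a))
    (fun t _ => conj (Hder a (minus b a) t) (Hdb _ _))).
  cbv beta in H; rewrite Hend, Hst in H; exact H. }
assert (Hdlip : forall a b w, norm (minus (diff f b w) (diff f a w))
                  <= C * norm (minus b a) * norm w).
{ intros a b w.
  assert (H := mean_value_inequality
    (fun s => diff f (plus a (scal s (minus b a))) w)
    _ (C * norm (minus b a) * norm w)
    (fun t _ => conj (Hder2 a (minus b a) w t) (HD2 _ _ _))).
  cbv beta in H; rewrite Hend, Hst in H; exact H. }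
assert (Hunit : forall t u, 0 <= t <= 1 -> norm (scal t u) <= norm u).
{ intros t u Ht; eapply Rle_trans; [apply norm_scal_le|].
  rewrite Rabs_pos_eq by lra; assert (H := norm_ge_0 u); nra. }
assert (Hdfour : forall a b u w,
  norm (minus (minus (diff f (plus b u) w) (diff f (plus a u) w))
              (minus (diff f b w) (diff f a w)))
    <= C * rpow (norm u) gamma * norm (minus b a) * norm w).
{ intros a b u w.
  assert (HD : forall t,
    norm (minus (D2 (plus (plus a u) (scal t (minus b a))) (minus b a) w)
                (D2 (plus a (scal t (minus b a))) (minus b a) w))
      <= C * rpow (norm u) gamma * norm (minus b a) * norm w).
  { intros t; eapply Rle_trans; [apply HD2h|].
    replace (minus (plus (plus a u) (scal t (minus b a)))
                   (plus a (scal t (minus b a)))) with u by vec.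
    apply Rle_refl. }
  assert (H := mean_value_inequality
    (fun s => minus (diff f (plus (plus a u) (scal s (minus b a))) w)
                    (diff f (plus a (scal s (minus b a))) w))
    _ (C * rpow (norm u) gamma * norm (minus b a) * norm w)
    (fun t _ => conj (is_derive_minus _ _ _ _ _
       (Hder2 (plus a u) (minus b a) w t) (Hder2 a (minus b a) w t))
     (HD t))).
  cbv beta in H; rewrite Hend, !Hst in H.
  replace (plus (plus a u) (scal 1 (minus b a))) with (plus b u) in H by vec.
  eapply Rle_trans; [|exact H]; right; f_equal; vec. }
exists C; split; [exact HC|split]; auto.
- intros a u.
  assert (H := mean_value_inequality
    (fun s => minus (f (plus a (scal s u))) (scal s (diff f a u)))
    (fun s => minus (diff f (plus a (scal s u)) u) (diff f a u))
    (C * norm u * norm u)).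
  cbv beta in H.
  eapply Rle_trans; [|apply H; clear H].
  + right; f_equal; rewrite Hst.
    replace (plus a (scal 1 u)) with (plus a u) by vec; vec.
  + intros t Ht; split.
    * apply (is_derive_minus (V := V) (fun s => f (plus a (scal s u)))
        (fun s => scal s (diff f a u))); [apply Hder|].
      apply is_derive_scal_id.
    * eapply Rle_trans; [apply Hdlip|].
      apply Rmult_le_compat_r; [apply norm_ge_0|].
      apply Rmult_le_compat_l; [exact HC|].
      replace (minus (plus a (scal t u)) a) with (scal t u) by vec.
      apply Hunit, Ht.
- intros a b u.
  set (w := minus (diff f b u) (diff f a u)).
  assert (H := mean_value_inequality
    (fun s => minus (minus (f (plus b (scal s u))) (f (plus a (scal s u))))
                    (scal s w))
    (fun s => minus (minus (diff f (plus b (scal s u)) u)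
                           (diff f (plus a (scal s u)) u)) w)
    (C * norm (minus b a) * norm u * rpow (norm u) gamma)).
  cbv beta in H.
  eapply Rle_trans; [|apply H; clear H].
  + right; f_equal; rewrite !Hst; unfold w.
    replace (plus a (scal 1 u)) with (plus a u) by vec.
    replace (plus b (scal 1 u)) with (plus b u) by vec; vec.
  + intros t Ht; split.
    * apply (is_derive_minus (V := V)
        (fun s => minus (f (plus b (scal s u))) (f (plus a (scal s u))))
        (fun s => scal s w)).
      -- apply (is_derive_minus (V := V) (fun s => f (plus b (scal s u)))
           (fun s => f (plus a (scal s u)))); apply Hder.
      -- apply is_derive_scal_id.
    * unfold w.
      eapply Rle_trans; [apply Hdfour|].
      assert (H1 := rpow_le (norm (scal t u)) (norm u) gamma
        ltac:(lra) (Hunit t u Ht)).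
      assert (H2 := norm_ge_0 (minus b a)); assert (H3 := norm_ge_0 u).
      change (C * rpow (norm (scal t u)) gamma * norm (minus b a) * norm u
        <= C * norm (minus b a) * norm u * rpow (norm u) gamma).
      assert (H4 : 0 <= C * norm (minus b a) * norm u)
        by (repeat apply Rmult_le_pos; assumption).
      nra.
- intros a b u w; assert (H := Hdfour a b u w).
  assert (Hn := norm_ge_0 (minus b a)).
  eapply Rle_trans; [|eapply Rle_trans; [exact H|right; ring]].
  right; f_equal; vec.
Qed.

(** For [u] of norm at most [1] this is the Lipschitz bound on [df] and on the
    Taylor remainder; for larger [u] the Lipschitz bound on [f] is better. *)
Lemma C2_holder_four (K : R) (f : V -> V) (df : V -> V -> V) a b u :
  C2_holder gamma K f df ->
  norm (minus (minus (f (plus b u)) (f b)) (minus (f (plus a u)) (f a)))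
    <= 2 * K * norm (minus b a) * norm u.
Proof.
intros [H1 H2 H3 H4 H5 H6 H7 H8 H9].
assert (HK : 0 <= K) by (assert (H := norm_ge_0 (f a)); specialize (H1 a); lra).
assert (Hba := norm_ge_0 (minus b a)); assert (Hu := norm_ge_0 u).
assert (HKb : 0 <= K * norm (minus b a)) by (apply Rmult_le_pos; assumption).
destruct (Rle_dec (norm u) 1) as [Hu1|Hu1].
- assert (E := norm_split2
    (minus (minus (f (plus b u)) (f b)) (minus (f (plus a u)) (f a)))
    (minus (minus (minus (f (plus b u)) (f b)) (df b u))
           (minus (minus (f (plus a u)) (f a)) (df a u)))
    (minus (df b u) (df a u)) ltac:(vec)).
  assert (E1 := H8 a b u); assert (E2 := H6 a b u).
  assert (Hr : rpow (norm u) gamma <= 1)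
    by (rewrite <- (rpow_base1 gamma); apply rpow_le; lra).
  assert (0 <= K * norm (minus b a) * norm u)
    by (apply Rmult_le_pos; assumption).
  nra.
- assert (E := norm_split2
    (minus (minus (f (plus b u)) (f b)) (minus (f (plus a u)) (f a)))
    (minus (f (plus b u)) (f (plus a u))) (opp (minus (f b) (f a)))
    ltac:(vec)).
  rewrite norm_opp_eq in E.
  assert (E1 := H2 (plus a u) (plus b u)); assert (E2 := H2 a b).
  replace (minus (plus b u) (plus a u)) with (minus b a) in E1 by vec.
  nra.
Qed.

(** The product rule on four points. The increments of [f] contribute
    [norm u], which is at most its power [gamma] only for [u] of norm at most
    [1]; for larger [u] the Lipschitz bound is better. *)
Lemma C1_holder_vf (K : R) (f g : V -> V) (df dg : V -> V -> V) :
  C2_holder gamma K f df -> C2_holder gamma K g dg ->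
  C1_holder gamma (5 * (K * K)) (fun a => dg a (f a)).
Proof.
intros Hf [_ _ H3 H4 _ H6 _ _ H9].
assert (Hfour := fun a b u => C2_holder_four K f df a b u Hf).
destruct Hf as [F1 F2 _ _ _ _ _ _ _].
assert (HK : 0 <= K).
{ assert (H := norm_ge_0 (f zero)); specialize (F1 zero); lra. }
assert (Hlip : forall a b, norm (minus (dg b (f b)) (dg a (f a)))
                 <= 2 * (K * K) * norm (minus b a)).
{ intros a b.
  assert (E := norm_split2 (minus (dg b (f b)) (dg a (f a)))
    (minus (dg b (f b)) (dg a (f b))) (dg a (minus (f b) (f a)))
    ltac:(rewrite H4; vec)).
  assert (E1 := H6 a b (f b)); assert (E2 := H3 a (minus (f b) (f a))).
  assert (E3 := F2 a b); assert (E4 := F1 b).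
  assert (Hba := norm_ge_0 (minus b a)).
  assert (K * norm (minus b a) * norm (f b) <= K * norm (minus b a) * K)
    by (apply Rmult_le_compat_l; [apply Rmult_le_pos|]; assumption).
  assert (K * norm (minus (f b) (f a)) <= K * (K * norm (minus b a)))
    by (apply Rmult_le_compat_l; assumption).
  lra. }
assert (HKK : 0 <= K * K) by nra.
split.
- intros a; eapply Rle_trans; [apply H3|].
  assert (K * norm (f a) <= K * K) by (apply Rmult_le_compat_l; auto); lra.
- intros a b; eapply Rle_trans; [apply Hlip|].
  assert (Hba := norm_ge_0 (minus b a)); nra.
- intros a b u.
  set (n := norm (minus b a)); assert (Hn : 0 <= n) by apply norm_ge_0.
  assert (Hu := norm_ge_0 u).
  assert (HKn : 0 <= K * K * n) by (apply Rmult_le_pos; assumption).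
  destruct (Rle_dec (norm u) 1) as [Hu1|Hu1].
  + assert (E := norm_split4
      (minus (minus (dg (plus b u) (f (plus b u))) (dg b (f b)))
             (minus (dg (plus a u) (f (plus a u))) (dg a (f a))))
      (minus (minus (dg (plus b u) (f (plus b u))) (dg b (f (plus b u))))
             (minus (dg (plus a u) (f (plus b u))) (dg a (f (plus b u)))))
      (minus (dg b (minus (f (plus b u)) (f b)))
             (dg a (minus (f (plus b u)) (f b))))
      (minus (dg (plus a u) (minus (f (plus b u)) (f (plus a u))))
             (dg a (minus (f (plus b u)) (f (plus a u)))))
      (dg a (minus (minus (f (plus b u)) (f b)) (minus (f (plus a u)) (f a))))
      ltac:(rewrite !H4; vec)).
    assert (E1 := H9 a b u (f (plus b u))).
    assert (E2 := H6 a b (minus (f (plus b u)) (f b))).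
    assert (E3 := H6 a (plus a u) (minus (f (plus b u)) (f (plus a u)))).
    assert (E4 := H3 a (minus (minus (f (plus b u)) (f b))
                               (minus (f (plus a u)) (f a)))).
    assert (G1 := F1 (plus b u)).
    assert (G2 := F2 b (plus b u)); assert (G3 := F2 (plus a u) (plus b u)).
    assert (G4 := Hfour a b u).
    replace (minus (plus b u) b) with u in G2 by vec.
    replace (minus (plus b u) (plus a u)) with (minus b a) in G3 by vec.
    replace (minus (plus a u) a) with u in E3 by vec.
    fold n in E1, E2, E3, E4, G2, G3, G4.
    assert (Hr := rpow_ge0 (norm u) gamma).
    assert (Hur := rpow_ge_self (norm u) gamma ltac:(lra) ltac:(lra)).
    assert (I1 := Rmult_le_compat_l (K * n * rpow (norm u) gamma) _ _
      ltac:(repeat apply Rmult_le_pos; assumption) G1).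
    assert (I2 := Rmult_le_compat_l (K * n) _ _
      ltac:(repeat apply Rmult_le_pos; assumption) G2).
    assert (I3 := Rmult_le_compat_l (K * norm u) _ _
      ltac:(repeat apply Rmult_le_pos; assumption) G3).
    assert (I4 := Rmult_le_compat_l K _ _ HK G4).
    assert (I5 := Rmult_le_compat_l (K * K * n) _ _ HKn Hur).
    lra.
  + assert (E := norm_split2
      (minus (minus (dg (plus b u) (f (plus b u))) (dg b (f b)))
             (minus (dg (plus a u) (f (plus a u))) (dg a (f a))))
      (minus (dg (plus b u) (f (plus b u))) (dg (plus a u) (f (plus a u))))
      (opp (minus (dg b (f b)) (dg a (f a)))) ltac:(vec)).
    rewrite norm_opp_eq in E.
    assert (E1 := Hlip (plus a u) (plus b u)); assert (E2 := Hlip a b).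
    replace (minus (plus b u) (plus a u)) with (minus b a) in E1 by vec.
    fold n in E1, E2.
    assert (Hr := rpow_ge_1 (norm u) gamma ltac:(lra) ltac:(lra)).
    assert (I := Rmult_le_compat_l (K * K * n) _ _ HKn Hr); lra.
Qed.

Lemma C1_holder_lie (K : R) (f g : V -> V) :
  C2_holder gamma K f (diff f) -> C2_holder gamma K g (diff g) ->
  C1_holder gamma (10 * (K * K)) (lie f g).
Proof.
intros Hf Hg.
assert (H := C1_holder_plus gamma _ _ _ _ (C1_holder_vf K f g _ _ Hf Hg)
  (C1_holder_scal gamma _ (-1) _ (C1_holder_vf K g f _ _ Hg Hf))).
rewrite Rabs_left in H by lra.
replace (5 * (K * K) + - -1 * (5 * (K * K))) with (10 * (K * K)) in H by ring.
revert H; apply C1_holder_ext; intros a; unfold lie, vf; vec.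
Qed.

End Calculus.

(** * One step of a second-order scheme *)

Section OneStepEstimates.

Context {V : CompleteNormedModule R_AbsRing} (gamma : R).
Context (Hgamma : 0 < gamma <= 1).
Implicit Types a b u v w : V.

Definition step (A B : V -> V) a : V := plus a (plus (A a) (B a)).

Definition increment (phi : V -> V) a : V := minus (phi a) a.

Context (K E eps : R).
Context (HK : 1 <= K) (Heps : 0 <= eps <= E).

Let K' := K * (1 + E).
Let w := eps * eps * rpow eps gamma.

Lemma eps_le_rpow : eps <= (1 + E) * rpow eps gamma.
Proof.
assert (Hr := rpow_ge0 eps gamma).
destruct (Rle_dec eps 1) as [H|H].
- assert (H' := rpow_ge_self eps gamma ltac:(lra) ltac:(lra)); nra.
- assert (H' := rpow_ge_1 eps gamma ltac:(lra) ltac:(lra)); nra.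
Qed.

Lemma eps3_le : eps * eps * eps <= K' * w.
Proof.
assert (H := eps_le_rpow); assert (Hr := rpow_ge0 eps gamma).
unfold K', w.
assert (H1 : 0 <= eps * eps) by nra.
assert (H2 := Rmult_le_compat_l _ _ _ H1 H).
assert (H3 : 0 <= eps * eps * ((1 + E) * rpow eps gamma))
  by (apply Rmult_le_pos; [|apply Rmult_le_pos]; lra).
nra.
Qed.

Lemma step_increment_bound (A B : V -> V) (dA : V -> V -> V) a :
  C2_holder gamma (K * eps) A dA -> C1_holder gamma (K * (eps * eps)) B ->
  norm (plus (A a) (B a)) <= K' * eps.
Proof.
intros HA HB; assert (H := norm_plus_le (A a) (B a)).
assert (HAa := C2_bound _ _ _ _ HA a); assert (HBa := C1_bound _ _ _ HB a).
assert (K * eps * eps <= K * eps * E) by (apply Rmult_le_compat_l; nra).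
unfold K'; nra.
Qed.

Lemma step_increment_lip (A B : V -> V) (dA : V -> V -> V) a b :
  C2_holder gamma (K * eps) A dA -> C1_holder gamma (K * (eps * eps)) B ->
  norm (minus (plus (A b) (B b)) (plus (A a) (B a)))
    <= K' * eps * norm (minus b a).
Proof.
intros HA HB.
assert (H := norm_split2 (minus (plus (A b) (B b)) (plus (A a) (B a)))
  (minus (A b) (A a)) (minus (B b) (B a)) ltac:(vec)).
assert (HAa := C2_lip _ _ _ _ HA a b); assert (HBa := C1_lip _ _ _ HB a b).
assert (Hn := norm_ge_0 (minus b a)).
assert (I : K * eps + K * (eps * eps) <= K' * eps).
{ assert (K * eps * eps <= K * eps * E) by (apply Rmult_le_compat_l; nra).
  unfold K'; nra. }
assert (I' := Rmult_le_compat_r _ _ _ Hn I); lra.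
Qed.

(** The second-order part [B] is less regular than [A], its increments being
    only of order [gamma] in [u], but it comes with one more factor [eps]. *)
Lemma step_increment_four (A B : V -> V) (dA : V -> V -> V) a b u v :
  C2_holder gamma (K * eps) A dA -> C1_holder gamma (K * (eps * eps)) B ->
  norm (minus (minus (increment (step A B) (plus b v)) (increment (step A B) b))
              (minus (increment (step A B) (plus a u)) (increment (step A B) a)))
    <= K' * eps * norm (minus v u)
       + 2 * K' * eps * norm (minus b a)
         * (norm u + eps * rpow (norm u) gamma).
Proof.
intros HA HB; unfold increment, step.
assert (H := norm_split3
  (minus
    (minus (minus (plus (plus b v) (plus (A (plus b v)) (B (plus b v))))
                  (plus b v))
           (minus (plus b (plus (A b) (B b))) b))
    (minus (minus (plus (plus a u) (plus (A (plus a u)) (B (plus a u))))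
                  (plus a u))
           (minus (plus a (plus (A a) (B a))) a)))
  (minus (plus (A (plus b v)) (B (plus b v)))
         (plus (A (plus b u)) (B (plus b u))))
  (minus (minus (A (plus b u)) (A b)) (minus (A (plus a u)) (A a)))
  (minus (minus (B (plus b u)) (B b)) (minus (B (plus a u)) (B a)))
  ltac:(vec)).
assert (H1 := step_increment_lip A B dA (plus b u) (plus b v) HA HB).
replace (minus (plus b v) (plus b u)) with (minus v u) in H1 by vec.
assert (H2 := C2_holder_four gamma Hgamma _ _ _ a b u HA).
assert (H3 := C1_four _ _ _ HB a b u).
assert (Hn := norm_ge_0 (minus b a)); assert (Hu := norm_ge_0 u).
assert (Hr := rpow_ge0 (norm u) gamma).
set (n := norm (minus b a)) in *; set (r := rpow (norm u) gamma) in *.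
assert (HKK : K <= K') by (unfold K'; nra).
assert (I2 : 2 * (K * eps) * n * norm u <= 2 * (K' * eps) * n * norm u).
{ repeat (apply Rmult_le_compat_r; [lra|]); nra. }
assert (I3 : K * (eps * eps) * n * r <= 2 * (K' * (eps * eps)) * n * r).
{ repeat (apply Rmult_le_compat_r; [lra|]); nra. }
lra.
Qed.

(** The first two orders of the composition make up a single step with the
    second-order part [B1 + B2 + dA2 (A1)]. There remain the Taylor remainder
    of [A2], the image of [B1] under [dA2] and the increment of [B2]. Each has
    order at least [2 + gamma] in [eps], and so has its Lipschitz constant: in
    [C2_taylor_lip] and [C1_four] the displacement [norm u], of order [eps],
    occurs with the powers [1 + gamma] and [gamma]. *)
Lemma step_comp_defect (A1 A2 B1 B2 : V -> V) (dA1 dA2 : V -> V -> V) :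
  C2_holder gamma (K * eps) A1 dA1 -> C2_holder gamma (K * eps) A2 dA2 ->
  C1_holder gamma (K * (eps * eps)) B1 ->
  C1_holder gamma (K * (eps * eps)) B2 ->
  let defect a : V := minus (step A2 B2 (step A1 B1 a))
    (step (fun x => plus (A1 x) (A2 x))
      (fun x => plus (plus (B1 x) (B2 x)) (dA2 x (A1 x))) a) in
  (forall a, norm (defect a) <= 8 * (K' * K' * K' * K') * w) /\
  (forall a b, norm (minus (defect b) (defect a))
     <= 8 * (K' * K' * K' * K') * w * norm (minus b a)).
Proof.
intros HA1 HA2 HB1 HB2 defect.
set (h := fun a => plus (A1 a) (B1 a) : V).
set (R2 := fun a u => minus (minus (A2 (plus a u)) (A2 a)) (dA2 a u) : V).
assert (Hdec : forall a, defect a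
  = plus (R2 a (h a)) (plus (dA2 a (B1 a)) (minus (B2 (plus a (h a))) (B2 a)))).
{ intros a; unfold defect, R2, h, step.
  assert (E1 : dA2 a (B1 a) = minus (dA2 a (plus (A1 a) (B1 a))) (dA2 a (A1 a))).
  { rewrite <- (C2_diff_minus _ _ _ _ HA2); f_equal; vec. }
  rewrite E1; vec. }
assert (Hh : forall a, norm (h a) <= K' * eps)
  by (intros a; apply (step_increment_bound A1 B1 dA1 a HA1 HB1)).
assert (Hhl : forall a b, norm (minus (h b) (h a)) <= K' * eps * norm (minus b a))
  by (intros a b; apply (step_increment_lip A1 B1 dA1 a b HA1 HB1)).
assert (HKK : K <= K') by (unfold K'; nra).
assert (HK'1 : 1 <= K') by lra.
assert (Hr := rpow_ge0 eps gamma).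
assert (Hw : 0 <= w) by (unfold w; apply Rmult_le_pos; nra).
assert (He3 := eps3_le).
pose (K3 := K' * K' * K').
assert (HK3 : 0 <= K3) by (unfold K3; repeat apply Rmult_le_pos; lra).
assert (Hee : 0 <= eps * eps) by nra.
assert (Heee : 0 <= eps * eps * eps) by (apply Rmult_le_pos; lra).
assert (HKe : K * eps <= K' * eps) by nra.
assert (Hcub : K3 * (eps * eps * eps) <= K' * K' * K' * K' * w).
{ apply Rle_trans with (K3 * (K' * w)); [|unfold K3; right; ring].
  apply Rmult_le_compat_l; assumption. }
assert (Hw4 : K3 * w <= K' * K' * K' * K' * w).
{ apply Rmult_le_compat_r; [exact Hw|]; rewrite <- (Rmult_1_r K3); fold K3.
  apply Rmult_le_compat_l; lra. }
assert (HKK2 : K * K <= K' * K') by nra.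
assert (Q0 : K' * K' <= K3)
  by (unfold K3; rewrite <- (Rmult_1_r (K' * K')) at 1;
      apply Rmult_le_compat_l; nra).
assert (Q1 : K * (K' * K') <= K3)
  by (unfold K3; rewrite Rmult_assoc; apply Rmult_le_compat_r; nra).
assert (Q2 : K * K <= K3) by lra.
assert (Q3 : K * K' <= K3) by nra.
assert (P1 : K * eps * (K' * eps) * (K' * eps) <= K3 * (eps * eps * eps)).
{ apply Rle_trans with (K * (K' * K') * (eps * eps * eps)); [right; ring|].
  apply Rmult_le_compat_r; [exact Heee|]; assumption. }
assert (P2 : K * eps * (K * (eps * eps)) <= K3 * (eps * eps * eps)).
{ apply Rle_trans with (K * K * (eps * eps * eps)); [right; ring|].
  apply Rmult_le_compat_r; [exact Heee|]; assumption. }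
assert (P3 : K * (eps * eps) * (K' * eps) <= K3 * (eps * eps * eps)).
{ apply Rle_trans with (K * K' * (eps * eps * eps)); [right; ring|].
  apply Rmult_le_compat_r; [exact Heee|]; assumption. }
split.
- intros a; rewrite Hdec.
  assert (H := norm_split3 _ (R2 a (h a)) (dA2 a (B1 a))
    (minus (B2 (plus a (h a))) (B2 a)) eq_refl).
  assert (H1 := C2_taylor _ _ _ _ HA2 a (h a)); fold (R2 a (h a)) in H1.
  assert (H2 := C2_diff_bound _ _ _ _ HA2 a (B1 a)).
  assert (H3 := C1_lip _ _ _ HB2 a (plus a (h a))).
  replace (minus (plus a (h a)) a) with (h a) in H3 by vec.
  assert (Ha := Hh a); assert (Hb := C1_bound _ _ _ HB1 a).
  assert (Hn := norm_ge_0 (h a)); assert (Hn' := norm_ge_0 (B1 a)).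
  assert (I1 : K * eps * norm (h a) * norm (h a)
                 <= K * eps * (K' * eps) * (K' * eps)).
  { rewrite (Rmult_assoc (K * eps)), (Rmult_assoc (K * eps) (K' * eps)).
    apply Rmult_le_compat_l; [nra|apply Rmult_le_compat; lra]. }
  assert (I2 : K * eps * norm (B1 a) <= K * eps * (K * (eps * eps)))
    by (apply Rmult_le_compat_l; nra).
  assert (I3 : K * (eps * eps) * norm (h a) <= K * (eps * eps) * (K' * eps))
    by (apply Rmult_le_compat_l; nra).
  assert (0 <= K' * K' * K' * K' * w)
    by (repeat (apply Rmult_le_pos; [|lra]); lra).
  lra.
- intros a b; rewrite !Hdec.
  set (n := norm (minus b a)); assert (Hn : 0 <= n) by apply norm_ge_0.
  set (d := minus (h b) (h a) : V).
  assert (Hd : norm d <= K' * eps * n) by apply Hhl.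
  assert (Hd2 : norm d <= 2 * (K' * eps)).
  { assert (H := norm_split2 d (h b) (opp (h a)) ltac:(unfold d; vec)).
    rewrite norm_opp_eq in H.
    assert (H1 := Hh a); assert (H2 := Hh b); lra. }
  assert (Hd0 := norm_ge_0 d); assert (Ha0 := norm_ge_0 (h a)).
  assert (Ha := Hh a).
  (* the two remainders are compared through the increment [h a] based at [b] *)
  assert (H1 : norm (minus (R2 b (h b)) (R2 a (h a)))
                 <= 3 * (K3 * (eps * eps * eps)) * n + K3 * w * n).
  { assert (H := norm_split3 (minus (R2 b (h b)) (R2 a (h a)))
      (minus (minus (A2 (plus (plus b (h a)) d)) (A2 (plus b (h a))))
             (dA2 (plus b (h a)) d))
      (minus (dA2 (plus b (h a)) d) (dA2 b d))
      (minus (R2 b (h a)) (R2 a (h a)))).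
    assert (E1 : plus (plus b (h a)) d = plus b (h b)) by (unfold d; vec).
    assert (E2 : dA2 b d = minus (dA2 b (h b)) (dA2 b (h a)))
      by apply (C2_diff_minus _ _ _ _ HA2).
    assert (T1 := C2_taylor _ _ _ _ HA2 (plus b (h a)) d).
    assert (T2 := C2_diff_lip _ _ _ _ HA2 b (plus b (h a)) d).
    replace (minus (plus b (h a)) b) with (h a) in T2 by vec.
    assert (T3 := C2_taylor_lip _ _ _ _ HA2 a b (h a)).
    fold (R2 a (h a)) (R2 b (h a)) n in T3.
    rewrite E1 in H, T1; rewrite E2 in H.
    specialize (H ltac:(unfold R2; vec)); rewrite <- E2 in H.
    assert (J1 : K * eps * norm d * norm d
                   <= K * eps * (2 * (K' * eps)) * (K' * eps * n)).
    { rewrite (Rmult_assoc (K * eps)), (Rmult_assoc (K * eps) (2 * _)).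
      apply Rmult_le_compat_l; [nra|apply Rmult_le_compat; lra]. }
    assert (J2 : K * eps * norm (h a) * norm d
                   <= K * eps * (K' * eps) * (K' * eps * n)).
    { rewrite (Rmult_assoc (K * eps)), (Rmult_assoc (K * eps) (K' * eps)).
      apply Rmult_le_compat_l; [nra|apply Rmult_le_compat; lra]. }
    assert (J3 : rpow (norm (h a)) gamma <= K' * rpow eps gamma).
    { eapply Rle_trans; [apply rpow_le; [lra|exact Ha]|].
      rewrite rpow_mul by lra; apply Rmult_le_compat_r; [exact Hr|].
      apply rpow_le_self; lra. }
    assert (J4 : K * eps * n * norm (h a) * rpow (norm (h a)) gamma
                   <= K * eps * n * (K' * eps) * (K' * rpow eps gamma)).
    { apply Rmult_le_compat.
      - repeat apply Rmult_le_pos; lra.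
      - apply rpow_ge0.
      - apply Rmult_le_compat_l; [repeat apply Rmult_le_pos; lra|exact Ha].
      - exact J3. }
    assert (J5 : K * eps * n * (K' * eps) * (K' * rpow eps gamma)
                   <= K3 * w * n).
    { apply Rle_trans with (K * (K' * K') * w * n); [unfold w; right; ring|].
      repeat (apply Rmult_le_compat_r; [lra|]); assumption. }
    assert (P1n := Rmult_le_compat_r n _ _ Hn P1).
    lra. }
  assert (H2 : norm (minus (dA2 b (B1 b)) (dA2 a (B1 a)))
                 <= 2 * (K3 * (eps * eps * eps)) * n).
  { assert (H := norm_split2 (minus (dA2 b (B1 b)) (dA2 a (B1 a)))
      (minus (dA2 b (B1 b)) (dA2 a (B1 b))) (dA2 a (minus (B1 b) (B1 a)))
      ltac:(rewrite (C2_diff_minus _ _ _ _ HA2); vec)).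
    assert (T1 := C2_diff_lip _ _ _ _ HA2 a b (B1 b)); fold n in T1.
    assert (T2 := C2_diff_bound _ _ _ _ HA2 a (minus (B1 b) (B1 a))).
    assert (T3 := C1_bound _ _ _ HB1 b).
    assert (T4 := C1_lip _ _ _ HB1 a b); fold n in T4.
    assert (J1 : K * eps * n * norm (B1 b) <= K * eps * n * (K * (eps * eps)))
      by (apply Rmult_le_compat_l; [repeat apply Rmult_le_pos|]; lra).
    assert (J2 : K * eps * norm (minus (B1 b) (B1 a))
                   <= K * eps * (K * (eps * eps) * n))
      by (apply Rmult_le_compat_l; [repeat apply Rmult_le_pos|]; lra).
    assert (P2n := Rmult_le_compat_r n _ _ Hn P2).
    lra. }
  assert (H3 : norm (minus (minus (B2 (plus b (h b))) (B2 b))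
                           (minus (B2 (plus a (h a))) (B2 a)))
                 <= K3 * (eps * eps * eps) * n + K3 * w * n).
  { assert (H := norm_split2
      (minus (minus (B2 (plus b (h b))) (B2 b))
             (minus (B2 (plus a (h a))) (B2 a)))
      (minus (B2 (plus b (h b))) (B2 (plus b (h a))))
      (minus (minus (B2 (plus b (h a))) (B2 b))
             (minus (B2 (plus a (h a))) (B2 a))) ltac:(vec)).
    assert (T1 := C1_lip _ _ _ HB2 (plus b (h a)) (plus b (h b))).
    replace (minus (plus b (h b)) (plus b (h a))) with d in T1
      by (unfold d; vec).
    assert (T2 := C1_four _ _ _ HB2 a b (h a)); fold n in T2.
    assert (J3 : rpow (norm (h a)) gamma <= K' * rpow eps gamma).
    { eapply Rle_trans; [apply rpow_le; [lra|exact Ha]|].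
      rewrite rpow_mul by lra; apply Rmult_le_compat_r; [exact Hr|].
      apply rpow_le_self; lra. }
    assert (J1 : K * (eps * eps) * norm d <= K * (eps * eps) * (K' * eps * n))
      by (apply Rmult_le_compat_l; [repeat apply Rmult_le_pos|]; lra).
    assert (J2 : K * (eps * eps) * n * rpow (norm (h a)) gamma
                   <= K * (eps * eps) * n * (K' * rpow eps gamma))
      by (apply Rmult_le_compat_l; [repeat apply Rmult_le_pos|]; lra).
    assert (J5 : K * (eps * eps) * n * (K' * rpow eps gamma) <= K3 * w * n).
    { apply Rle_trans with (K * K' * w * n); [unfold w; right; ring|].
      repeat (apply Rmult_le_compat_r; [lra|]); nra. }
    assert (P3n := Rmult_le_compat_r n _ _ Hn P3).
    lra. }
  eapply Rle_trans; [apply norm_split3 with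
    (a := minus (R2 b (h b)) (R2 a (h a)))
    (b := minus (dA2 b (B1 b)) (dA2 a (B1 a)))
    (c := minus (minus (B2 (plus b (h b))) (B2 b))
                (minus (B2 (plus a (h a))) (B2 a)))|].
  { vec. }
  assert (C1n := Rmult_le_compat_r n _ _ Hn Hcub).
  assert (C2n := Rmult_le_compat_r n _ _ Hn Hw4).
  lra.
Qed.

End OneStepEstimates.

(** * Controls *)

Section Control.

Context (T : R) (omega : R -> R -> R) (Hom : control T omega).

Lemma control_mono (r r' s s' : R) :
  0 <= r -> r <= r' -> r' <= s' -> s' <= s -> s <= T ->
  omega r' s' <= omega r s.
Proof.
intros; assert (H4 := control_super _ _ Hom r r' s).
assert (H5 := control_super _ _ Hom r' s' s).
assert (H6 := control_ge0 _ _ Hom r r'); assert (H7 := control_ge0 _ _ Hom s' s).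
lra.
Qed.

(** Continuity at the points of the diagonal becomes uniform by
    compactness. *)
Lemma control_small (eps : R) : 0 < eps ->
  exists h, 0 < h /\ forall s t, 0 <= s -> s <= t -> t <= T ->
    t - s <= h -> omega s t <= eps.
Proof.
intros Heps; destruct (control_cont _ _ Hom) as [e He].
assert (Hloc : forall x, exists d : posreal, 0 <= x <= T ->
  forall s t, 0 <= s -> s <= t -> t <= T ->
    Rabs (s - x) < d -> Rabs (t - x) < d -> omega s t <= eps).
{ intros x; destruct (Rle_dec 0 x) as [Hx0|Hx0];
    [|exists (mkposreal 1 Rlt_0_1); lra].
  destruct (Rle_dec x T) as [HxT|HxT]; [|exists (mkposreal 1 Rlt_0_1); lra].
  assert (Hc := He x x Hx0 (Rle_refl x) HxT).
  rewrite Rminus_diag in Hc; specialize (Hc (cond_pos e)).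
  rewrite (control_diag _ _ Hom x Hx0 HxT) in Hc.
  destruct (Hc (fun z => z <= eps)) as [d Hd].
  { exists (mkposreal eps Heps); intros z Hz.
    change (Rabs (z - 0) < eps) in Hz; apply Rabs_def2 in Hz; lra. }
  exists d; intros _ s t Hs Hst Ht H1 H2.
  apply (Hd (s, t)); [split; assumption|simpl; lra]. }
pose (d := fun x => proj1_sig (constructive_indefinite_description _ (Hloc x))).
assert (Hd := fun x => proj2_sig (constructive_indefinite_description _ (Hloc x))).
change (forall x, 0 <= x <= T -> forall s t,
  0 <= s -> s <= t -> t <= T ->
  Rabs (s - x) < d x -> Rabs (t - x) < d x -> omega s t <= eps) in Hd.
destruct (compactness_value_1d 0 T
  (fun x => mkposreal (d x / 2) (is_pos_div_2 (d x)))) as [h Hh].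
exists (h / 2); split; [apply is_pos_div_2|].
intros s t Hs Hst Ht Hts; apply Rnot_lt_le; intros Hlt.
apply (Hh s); [lra|]; intros [x [Hx [Hsx Hhx]]]; simpl in Hsx, Hhx.
assert (Hhpos := cond_pos h); assert (Hdpos := cond_pos (d x)).
apply Rabs_def2 in Hsx.
assert (omega s t <= eps); [|lra].
apply (Hd x); try assumption; apply Rabs_def1; lra.
Qed.

End Control.

(** * Products of a second-order scheme along a grid *)

Section Sewing.

Context {V : CompleteNormedModule R_AbsRing}.
Context (T p gamma : R) (omega : R -> R -> R).
Context (Hp : 2 <= p < 3) (Hgamma : 0 < gamma <= 1) (Hpg : p < 2 + gamma).
Context (Hom : control T omega).
Implicit Types a b : V.

Definition scale (s t : R) : R := rpow (omega s t) (1 / p).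

Definition error (s t : R) : R := rpow (omega s t) ((2 + gamma) / p).

Definition is_lipschitz (P : V -> V) (L : R) : Prop :=
  forall a b, norm (minus (P b) (P a)) <= L * norm (minus b a).

(** The distance for the supremum norm together with the Lipschitz
    seminorm. *)
Definition close (c : R) (P Q : V -> V) : Prop :=
  (forall a, norm (minus (P a) (Q a)) <= c) /\
  is_lipschitz (fun a => minus (P a) (Q a)) c.

(** An almost flow whose defect is small for the Lipschitz seminorm too. This
    and [scheme_four], which controls how a step propagates a perturbation of
    its argument, are what bounds the Lipschitz constants of the products. *)
Record stable_scheme (K : R) (phi : R -> R -> V -> V) : Prop := {
  scheme_near : forall s t a, 0 <= s -> s <= t -> t <= T ->
    norm (increment (phi t s) a) <= K * scale s t;
  scheme_lip : forall s t, 0 <= s -> s <= t -> t <= T ->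
    is_lipschitz (increment (phi t s)) (K * scale s t);
  scheme_four : forall s t (a b u v : V), 0 <= s -> s <= t -> t <= T ->
    norm (minus
        (minus (increment (phi t s) (plus b v)) (increment (phi t s) b))
        (minus (increment (phi t s) (plus a u)) (increment (phi t s) a)))
      <= K * scale s t * norm (minus v u)
         + K * scale s t * norm (minus b a)
           * (norm u + scale s t * rpow (norm u) gamma);
  scheme_defect : forall r s t, 0 <= r -> r <= s -> s <= t -> t <= T ->
    close (K * error r t) (fun a => phi t s (phi s r a)) (phi t r)
}.

Lemma theta_gt1 : 1 < (2 + gamma) / p.
Proof.
apply Rmult_lt_reg_r with p; [lra|].
unfold Rdiv; rewrite Rmult_assoc, Rinv_l; lra.
Qed.

Lemma scale_ge0 (s t : R) : 0 <= scale s t.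
Proof. apply rpow_ge0. Qed.

Lemma error_ge0 (s t : R) : 0 <= error s t.
Proof. apply rpow_ge0. Qed.

Lemma scale_mono (r r' s s' : R) :
  0 <= r -> r <= r' -> r' <= s' -> s' <= s -> s <= T ->
  scale r' s' <= scale r s.
Proof.
intros; apply rpow_le; [apply Rlt_le, Rdiv_lt_0_compat; lra|].
apply control_mono with T; assumption.
Qed.

Lemma error_mono (r r' s s' : R) :
  0 <= r -> r <= r' -> r' <= s' -> s' <= s -> s <= T ->
  error r' s' <= error r s.
Proof.
intros; assert (H' := theta_gt1); apply rpow_le; [lra|].
apply control_mono with T; assumption.
Qed.

Lemma error_scale (s t : R) :
  error s t = scale s t * scale s t * rpow (scale s t) gamma.
Proof.
unfold error, scale; rewrite rpow_comp, <- !rpow_add; f_equal; field; lra.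
Qed.

Lemma scale_sqr (s t : R) : scale s t * scale s t = rpow (omega s t) (2 / p).
Proof. unfold scale; rewrite <- rpow_add; f_equal; field; lra. Qed.

Lemma error_diag (s : R) : 0 <= s -> s <= T -> error s s = 0.
Proof.
intros; unfold error; rewrite (control_diag _ _ Hom) by assumption.
apply rpow_0.
Qed.

Lemma scale_diag (s : R) : 0 <= s -> s <= T -> scale s s = 0.
Proof.
intros; unfold scale; rewrite (control_diag _ _ Hom) by assumption.
apply rpow_0.
Qed.

Lemma close_refl (P : V -> V) : close 0 P P.
Proof.
split.
- intros a; rewrite norm_minus_self; lra.
- intros a b.
  replace (minus (minus (P b) (P b)) (minus (P a) (P a))) with (zero : V)
    by vec.
  rewrite norm_0; lra.
Qed.

Lemma close_weaken (c c' : R) (P Q : V -> V) :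
  c <= c' -> close c P Q -> close c' P Q.
Proof.
intros Hc [H1 H2]; split.
- intros a; eapply Rle_trans; [apply H1|exact Hc].
- intros a b; eapply Rle_trans; [apply H2|].
  apply Rmult_le_compat_r; [apply norm_ge_0|exact Hc].
Qed.

Context (K : R) (phi : R -> R -> V -> V).
Context (HK : 1 <= K) (Hphi : stable_scheme K phi).

Lemma scheme_diag (s : R) a : 0 <= s -> s <= T -> phi s s a = a.
Proof.
intros H0 H1; apply norm_minus_eq0.
assert (H := scheme_near _ _ Hphi s s a H0 (Rle_refl s) H1).
rewrite scale_diag in H by assumption; unfold increment in H; lra.
Qed.

Lemma scheme_lipschitz (s t : R) : 0 <= s -> s <= t -> t <= T ->
  is_lipschitz (phi t s) (1 + K * scale s t).
Proof.
intros H0 H1 H2 a b.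
assert (H := scheme_lip _ _ Hphi s t H0 H1 H2 a b); unfold increment in H.
assert (E := norm_split2 (minus (phi t s b) (phi t s a)) (minus b a)
  (minus (minus (phi t s b) b) (minus (phi t s a) a)) ltac:(vec)).
lra.
Qed.

(** On a short interval, composing maps close to the scheme costs little more
    than the sum of the two distances and one defect: the perturbation of the
    argument of the second step enters only through [scheme_four]. *)
Lemma close_comp (L eta c1 c2 r s t : R) (P1 P2 : V -> V) :
  1 <= L -> 0 < eta <= 1 -> 0 <= r -> r <= s -> s <= t -> t <= T ->
  scale r t <= 1 -> (16 * K + 8 * L) * rpow (scale r t) gamma <= eta ->
  0 <= c1 <= 4 * L * error r t -> 0 <= c2 ->
  close c1 P1 (phi s r) -> close c2 P2 (phi t s) ->
  close (c2 * (1 + eta) + (1 + eta) * c1 + (eta * L + K) * error r t)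
    (fun a => P2 (P1 a)) (phi t r).
Proof.
intros HL Heta Hr Hrs Hst Ht He1 Hsmall Hc1 Hc2 [HP1 HP1l] [HP2 HP2l].
set (e := scale r t) in *; set (q := rpow e gamma) in *.
set (w := error r t) in *.
assert (He0 : 0 <= e) by apply scale_ge0.
assert (Hq0 : 0 <= q) by apply rpow_ge0.
assert (Hw0 : 0 <= w) by apply error_ge0.
assert (Hw : w = e * e * q) by apply error_scale.
assert (Heq : e <= q) by (apply rpow_ge_self; lra).
assert (Hq1 : q <= 1)
  by (unfold q; rewrite <- (rpow_base1 gamma); apply rpow_le; lra).
assert (Hers : 0 <= scale r s <= e)
  by (split; [apply scale_ge0|apply scale_mono; lra]).
assert (Hest : 0 <= scale s t <= e)
  by (split; [apply scale_ge0|apply scale_mono; lra]).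
assert (HKq : 0 <= K * q) by nra; assert (HLq : 0 <= L * q) by nra.
assert (Hee : 0 <= e * e <= 1) by nra.
assert (Hwq : w <= q) by nra.
assert (Hc1q : c1 <= 4 * L * q) by nra.
assert (HKe : K * e <= K * q) by nra.
assert (HKrs : 0 <= K * scale r s <= K * e) by nra.
assert (HKst : 0 <= K * scale s t <= K * e) by nra.
destruct (scheme_defect _ _ Hphi r s t Hr Hrs Hst Ht) as [HD HDl].
fold w in HD, HDl.
assert (Hs0 : 0 <= s) by lra; assert (HsT : s <= T) by lra.
split.
- intros a.
  assert (H := norm_split3 (minus (P2 (P1 a)) (phi t r a))
    (minus (P2 (P1 a)) (phi t s (P1 a)))
    (minus (phi t s (P1 a)) (phi t s (phi s r a)))
    (minus (phi t s (phi s r a)) (phi t r a)) ltac:(vec)).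
  assert (H1 := HP2 (P1 a)); assert (H2 := HP1 a); assert (H3 := HD a).
  assert (H4 := scheme_lipschitz s t Hs0 Hst Ht (phi s r a) (P1 a)).
  assert (Hn := norm_ge_0 (minus (P1 a) (phi s r a))).
  assert ((1 + K * scale s t) * norm (minus (P1 a) (phi s r a))
            <= (1 + eta) * c1) by (apply Rmult_le_compat; lra).
  assert (0 <= c2 * eta) by nra.
  assert (0 <= eta * L * w) by (repeat apply Rmult_le_pos; lra).
  lra.
- intros a b.
  set (n := norm (minus b a)); assert (Hn : 0 <= n) by apply norm_ge_0.
  set (ua := minus (P1 a) (phi s r a) : V).
  set (ub := minus (P1 b) (phi s r b) : V).
  assert (Hua : norm ua <= c1) by apply HP1.
  assert (Hub : norm (minus ub ua) <= c1 * n) by apply HP1l.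
  assert (Hua0 := norm_ge_0 ua).
  assert (Hxs := scheme_lipschitz r s Hr Hrs HsT a b); fold n in Hxs.
  assert (H1 : norm (minus (minus (P2 (P1 b)) (phi t s (P1 b)))
                           (minus (P2 (P1 a)) (phi t s (P1 a))))
                 <= c2 * (1 + eta) * n).
  { eapply Rle_trans; [apply HP2l|].
    rewrite Rmult_assoc; apply Rmult_le_compat_l; [exact Hc2|].
    assert (H := norm_split2 (minus (P1 b) (P1 a)) (minus ub ua)
      (minus (phi s r b) (phi s r a)) ltac:(unfold ub, ua; vec)).
    assert ((1 + K * scale r s) * n + c1 * n <= (1 + eta) * n); [|lra].
    rewrite <- Rmult_plus_distr_r; apply Rmult_le_compat_r; lra. }
  assert (H2 : norm (minus (minus (phi t s (P1 b)) (phi t s (phi s r b)))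
                           (minus (phi t s (P1 a)) (phi t s (phi s r a))))
                 <= ((1 + eta) * c1 + eta * L * w) * n).
  { assert (H := scheme_four _ _ Hphi s t (phi s r a) (phi s r b) ua ub
      Hs0 Hst Ht).
    unfold increment in H.
    replace (plus (phi s r b) ub) with (P1 b) in H by (unfold ub; vec).
    replace (plus (phi s r a) ua) with (P1 a) in H by (unfold ua; vec).
    assert (E := norm_split2
      (minus (minus (phi t s (P1 b)) (phi t s (phi s r b)))
             (minus (phi t s (P1 a)) (phi t s (phi s r a))))
      (minus ub ua)
      (minus (minus (minus (phi t s (P1 b)) (P1 b))
                    (minus (phi t s (phi s r b)) (phi s r b)))
             (minus (minus (phi t s (P1 a)) (P1 a))
                    (minus (phi t s (phi s r a)) (phi s r a))))
      ltac:(unfold ub, ua; vec)).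
    assert (Hg : rpow (norm ua) gamma <= 4 * L * (q * q)).
    { apply Rle_trans with (rpow (4 * L * (e * e)) gamma).
      - apply rpow_le; [lra|].
        assert (L * w <= L * (e * e)) by (apply Rmult_le_compat_l; nra); lra.
      - rewrite rpow_mul by nra; apply Rmult_le_compat;
          [apply rpow_ge0|apply rpow_ge0|apply rpow_le_self; lra|].
        rewrite rpow_mul by lra; apply Rle_refl. }
    assert (Hbr : K * scale s t
              * (norm ua + scale s t * rpow (norm ua) gamma)
              <= 8 * K * L * q * w).
    { assert (I1 : K * scale s t * norm ua <= K * q * (4 * L * w))
        by (apply Rmult_le_compat; lra).
      assert (I2 : scale s t * scale s t <= e * e)
        by (apply Rmult_le_compat; lra).
      assert (I3 : K * (scale s t * scale s t) * rpow (norm ua) gamma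
                     <= K * (e * e) * (4 * L * (q * q))).
      { apply Rmult_le_compat; [nra|apply rpow_ge0|nra|exact Hg]. }
      replace (K * (e * e) * (4 * L * (q * q))) with (4 * K * L * q * w) in I3
        by (rewrite Hw; ring).
      lra. }
    assert (Hbr' : K * scale s t * norm (minus (phi s r b) (phi s r a))
              * (norm ua + scale s t * rpow (norm ua) gamma)
              <= eta * L * w * n).
    { assert (I1 : norm (minus (phi s r b) (phi s r a)) <= 2 * n) by nra.
      assert (I2 : norm (minus (phi s r b) (phi s r a))
                 * (K * scale s t * (norm ua + scale s t * rpow (norm ua) gamma))
                 <= 2 * n * (8 * K * L * q * w)).
      { apply Rmult_le_compat; try assumption; [apply norm_ge_0|].
        repeat apply Rmult_le_pos; try lra.
        apply Rplus_le_le_0_compat; [lra|].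
        apply Rmult_le_pos; [lra|apply rpow_ge0]. }
      assert (I3 : 16 * K * q * (L * w * n) <= eta * (L * w * n)).
      { apply Rmult_le_compat_r; [repeat apply Rmult_le_pos|]; lra. }
      lra. }
    assert (Hb : K * scale s t * norm (minus ub ua) <= eta * (c1 * n)).
    { apply Rmult_le_compat; try lra; [apply norm_ge_0]. }
    lra. }
  assert (H3 := HDl a b); fold n in H3.
  eapply Rle_trans; [apply (norm_split3 _
    (minus (minus (P2 (P1 b)) (phi t s (P1 b)))
           (minus (P2 (P1 a)) (phi t s (P1 a))))
    (minus (minus (phi t s (P1 b)) (phi t s (phi s r b)))
           (minus (phi t s (P1 a)) (phi t s (phi s r a))))
    (minus (minus (phi t s (phi s r b)) (phi t r b))
           (minus (phi t s (phi s r a)) (phi t r a))))|].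
  { vec. }
  lra.
Qed.

(** Grids are infinite and may repeat points, so that a piece of a grid is given
    by its first index and its length, and no case is made of the ends. *)
Definition grid (u : nat -> R) : Prop :=
  (forall n, 0 <= u n <= T) /\ (forall n, u n <= u (S n)).

Fixpoint grid_product (u : nat -> R) (i k : nat) (a : V) : V :=
  match k with
  | O => a
  | S k' => grid_product u (S i) k' (phi (u (S i)) (u i) a)
  end.

Lemma grid_product_add (u : nat -> R) (k k' i : nat) a :
  grid_product u i (k + k') a = grid_product u (i + k) k' (grid_product u i k a).
Proof.
revert i a; induction k as [|k IH]; intros i a; simpl.
- rewrite Nat.add_0_r; reflexivity.
- rewrite IH, <- plus_n_Sm; reflexivity.
Qed.

Lemma grid_le (u : nat -> R) (i k : nat) : grid u -> u i <= u (i + k)%nat.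
Proof.
intros [_ Hu]; induction k as [|k IH].
- rewrite Nat.add_0_r; lra.
- rewrite <- plus_n_Sm; specialize (Hu (i + k)%nat); lra.
Qed.

Lemma grid_exit (u : nat -> R) (i k : nat) (c : R) : grid u -> 0 <= c ->
  omega (u i) (u (i + k)%nat) <= c \/
  exists j, (j < k)%nat /\ omega (u i) (u (i + j)%nat) <= c /\
    c < omega (u i) (u (i + S j)%nat).
Proof.
intros Hu Hc; induction k as [|k [IH|[j [Hj IH]]]].
- left; rewrite Nat.add_0_r, (control_diag _ _ Hom); [exact Hc|apply Hu..].
- destruct (Rle_dec (omega (u i) (u (i + S k)%nat)) c) as [H|H];
    [left; exact H|right].
  exists k; repeat split; [lia|exact IH|lra].
- right; exists j; split; [lia|exact IH].
Qed.

Lemma grid_super (u : nat -> R) (i j k : nat) : grid u -> (j <= k)%nat ->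
  omega (u i) (u (i + j)%nat) + omega (u (i + j)%nat) (u (i + k)%nat)
    <= omega (u i) (u (i + k)%nat).
Proof.
intros Hu Hj; assert (H := grid_le u (i + j) (k - j) Hu).
replace (i + j + (k - j))%nat with (i + k)%nat in H by lia.
apply (control_super _ _ Hom); [apply Hu|apply grid_le, Hu|exact H|apply Hu].
Qed.

(** Take the step during which [omega], counted from the start, passes half of
    its value; super-additivity bounds the piece after that step. *)
Lemma grid_halve (u : nat -> R) (i k : nat) : grid u ->
  exists j, (j <= k)%nat /\
    omega (u i) (u (i + j)%nat) <= omega (u i) (u (i + S k)%nat) / 2 /\
    omega (u (i + S j)%nat) (u (i + S k)%nat)
      <= omega (u i) (u (i + S k)%nat) / 2.
Proof.
intros Hu; set (W := omega (u i) (u (i + S k)%nat)).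
assert (HW : 0 <= W)
  by (apply (control_ge0 _ _ Hom); [apply Hu|apply grid_le, Hu|apply Hu]).
destruct (grid_exit u i (S k) (W / 2) Hu ltac:(lra)) as [H|[j [Hj [H H']]]].
- fold W in H; exists k; split; [lia|].
  assert (H0 := grid_super u i k (S k) Hu ltac:(lia)); fold W in H0.
  assert (H1 : 0 <= omega (u (i + k)%nat) (u (i + S k)%nat)).
  { apply (control_ge0 _ _ Hom); [apply Hu| |apply Hu].
    rewrite <- plus_n_Sm; apply Hu. }
  rewrite (control_diag _ _ Hom); [lra|apply Hu..].
- exists j; split; [lia|split; [exact H|]].
  assert (H0 := grid_super u i (S j) (S k) Hu ltac:(lia)); fold W in H0; lra.
Qed.

Lemma error_half (r r' s s' : R) :
  0 <= r -> r <= r' -> r' <= s' -> s' <= s -> s <= T ->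
  omega r' s' <= omega r s / 2 ->
  error r' s' <= rpow (1 / 2) ((2 + gamma) / p) * error r s.
Proof.
intros Hr Hrr Hrs Hss HsT H; assert (Ht := theta_gt1).
unfold error; rewrite <- rpow_mul; [apply rpow_le; lra|lra|].
apply (control_ge0 _ _ Hom); lra.
Qed.

(** Davie's argument: cut at the step given by [grid_halve]. Both outer pieces
    have at most half of [omega], hence together at most the fraction
    [2 ^ (1 - theta) < 1] of the error of the whole, which leaves room for the
    defects of the two compositions. *)
Lemma grid_product_close_local : exists L omega0 : R,
  1 <= L /\ 0 < omega0 /\
  forall u k i, grid u -> omega (u i) (u (i + k)%nat) <= omega0 ->
    close (L * error (u i) (u (i + k)%nat)) (grid_product u i k)
      (phi (u (i + k)%nat) (u i)).
Proof.
(* [error] shrinks by the factor [h] when [omega] is halved, and [2 * h < 1] *)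
set (h := rpow (1 / 2) ((2 + gamma) / p)).
assert (Hh : 0 < h < 1 / 2).
{ split; [apply rpow_gt0; lra|].
  rewrite <- (rpow_1 (1 / 2)) by lra.
  unfold h; rewrite !rpow_pos by lra.
  unfold Rpower; apply exp_increasing.
  assert (Hln : ln (1 / 2) < 0)
    by (rewrite <- ln_1; apply ln_increasing; lra).
  assert (Ht := theta_gt1); nra. }
(* the relative losses of the two compositions, at most [5 * eta], use half of
   the gap [1 - 2 * h], and [L] makes the defects use the other half *)
set (eta := (1 - 2 * h) / 10); set (L := 6 * K / (1 - 2 * h)).
assert (Heta : 0 < eta <= 1 / 10) by (unfold eta; lra).
assert (HL : L * (1 - 2 * h) = 6 * K) by (unfold L; field; lra).
assert (HL6 : 6 * K <= L) by nra.
assert (HpV : 0 < 1 / p) by (apply Rdiv_lt_0_compat; lra).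
destruct (rpow_small gamma (eta / (16 * K + 8 * L))) as [d [Hd Hsm]];
  [lra|apply Rdiv_lt_0_compat; lra|].
destruct (rpow_small (1 / p) (Rmin 1 d)) as [w0 [Hw0 Hsm0]];
  [lra|apply Rmin_glb_lt; lra|].
exists L, w0; split; [lra|split; [exact Hw0|]].
intros u k i Hu; revert i; induction k as [k IH] using lt_wf_ind; intros i Hw.
destruct k as [|k].
{ rewrite Nat.add_0_r, error_diag, Rmult_0_r by apply Hu.
  split; [intros a|intros a b]; rewrite !scheme_diag by apply Hu; simpl.
  - rewrite norm_minus_self; lra.
  - replace (minus (minus b b) (minus a a)) with (zero : V) by vec.
    rewrite norm_0; lra. }
destruct (grid_halve u i k Hu) as [j [Hj [H1 H2]]].
set (W := omega (u i) (u (i + S k)%nat)) in *.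
set (v := error (u i) (u (i + S k)%nat)).
assert (Hpos : forall n, 0 <= u n) by apply Hu.
assert (HT : forall n, u n <= T) by apply Hu.
assert (Hi1 : u i <= u (i + j)%nat) by apply grid_le, Hu.
assert (Hi2 : u (i + j)%nat <= u (i + S j)%nat)
  by (rewrite <- plus_n_Sm; apply Hu).
assert (Hi3 : u (i + S j)%nat <= u (i + S k)%nat).
{ assert (H := grid_le u (i + S j) (k - j) Hu).
  replace (i + S j + (k - j))%nat with (i + S k)%nat in H by lia; exact H. }
assert (HW0 : 0 <= W) by (apply (control_ge0 _ _ Hom); auto; lra).
assert (Hv0 : 0 <= v) by apply error_ge0.
assert (Hsmall : forall t, u i <= t -> t <= u (i + S k)%nat ->
  scale (u i) t <= 1 /\ (16 * K + 8 * L) * rpow (scale (u i) t) gamma <= eta).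
{ intros t Ht1 Ht2; assert (HtT := HT (i + S k)%nat).
  assert (Hs : scale (u i) t <= Rmin 1 d).
  { apply Hsm0; apply Rle_trans with W; [|exact Hw].
    apply control_mono with T; auto; lra. }
  assert (Hm1 := Rmin_l 1 d); assert (Hm2 := Rmin_r 1 d).
  split; [lra|].
  assert (H := Hsm (scale (u i) t) ltac:(lra)).
  apply Rle_trans with ((16 * K + 8 * L) * (eta / (16 * K + 8 * L)));
    [apply Rmult_le_compat_l; lra|right; field; lra]. }
assert (HP1 := IH j ltac:(lia) i ltac:(lra)).
assert (HP2 := IH (k - j)%nat ltac:(lia) (i + S j)%nat).
replace (i + S j + (k - j))%nat with (i + S k)%nat in HP2 by lia.
specialize (HP2 ltac:(lra)).
assert (He1 : error (u i) (u (i + j)%nat) <= h * v)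
  by (apply error_half; auto; lra).
assert (He2 : error (u (i + S j)%nat) (u (i + S k)%nat) <= h * v)
  by (apply error_half; auto; lra).
assert (He1' : error (u i) (u (i + j)%nat) <= error (u i) (u (i + S j)%nat))
  by (apply error_mono; auto; lra).
assert (He3 : error (u i) (u (i + S j)%nat) <= v)
  by (apply error_mono; auto; lra).
assert (Hn1 := error_ge0 (u i) (u (i + j)%nat)).
assert (Hn2 := error_ge0 (u (i + S j)%nat) (u (i + S k)%nat)).
assert (Hn3 := error_ge0 (u i) (u (i + S j)%nat)).
assert (HLv : 0 <= L * v) by nra.
destruct (Hsmall (u (i + S j)%nat)) as [Hs1 Hs2]; [lra|lra|].
assert (C1 := close_comp L eta (L * error (u i) (u (i + j)%nat)) 0
  (u i) (u (i + j)%nat) (u (i + S j)%nat) (grid_product u i j)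
  (phi (u (i + S j)%nat) (u (i + j)%nat)) ltac:(lra) ltac:(lra) (Hpos _)
  Hi1 Hi2 (HT _) Hs1 Hs2 ltac:(nra) (Rle_refl 0) HP1 (close_refl _)).
set (c1 := 0 * (1 + eta) + (1 + eta) * (L * error (u i) (u (i + j)%nat))
           + (eta * L + K) * error (u i) (u (i + S j)%nat)) in C1.
assert (Hc1 : 0 <= c1 <= (1 + eta) * h * (L * v) + (eta * L + K) * v).
{ assert (I1 : L * error (u i) (u (i + j)%nat) <= L * (h * v))
    by (apply Rmult_le_compat_l; lra).
  assert (I2 : 0 <= L * error (u i) (u (i + j)%nat))
    by (apply Rmult_le_pos; lra).
  assert (I3 : (eta * L + K) * error (u i) (u (i + S j)%nat)
                 <= (eta * L + K) * v)
    by (apply Rmult_le_compat_l; [nra|lra]).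
  assert (I4 : 0 <= (eta * L + K) * error (u i) (u (i + S j)%nat))
    by (apply Rmult_le_pos; [nra|lra]).
  unfold c1; split; nra. }
assert (Hc1' : (1 + eta) * h * (L * v) + (eta * L + K) * v <= 4 * L * v).
{ assert (K * v <= L * v) by (apply Rmult_le_compat_r; lra).
  assert ((1 + eta) * h <= 1) by nra.
  assert ((1 + eta) * h * (L * v) <= 1 * (L * v))
    by (apply Rmult_le_compat_r; lra).
  assert (eta * (L * v) <= 1 * (L * v)) by (apply Rmult_le_compat_r; lra).
  lra. }
destruct (Hsmall (u (i + S k)%nat)) as [Hs3 Hs4]; [lra|lra|].
fold v in Hc1'.
assert (C2 := close_comp L eta c1
  (L * error (u (i + S j)%nat) (u (i + S k)%nat))
  (u i) (u (i + S j)%nat) (u (i + S k)%nat) _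
  (grid_product u (i + S j) (k - j)) ltac:(lra) ltac:(lra) (Hpos _)
  ltac:(lra) Hi3 (HT _) Hs3 Hs4 ltac:(unfold v in *; lra) ltac:(nra) C1 HP2).
fold v in C2.
assert (HQ : forall a, grid_product u i (S k) a
  = grid_product u (i + S j) (k - j)
      (phi (u (i + S j)%nat) (u (i + j)%nat) (grid_product u i j a))).
{ intros a; replace (S k) with (j + S (k - j))%nat by lia.
  rewrite grid_product_add; simpl; rewrite <- plus_n_Sm; reflexivity. }
apply close_weaken with (c' := L * v) in C2.
- destruct C2 as [C2 C2l]; split; [intros a|intros a b]; rewrite !HQ;
    [apply C2|apply C2l].
- assert (I1 : L * error (u (i + S j)%nat) (u (i + S k)%nat) <= h * (L * v))
    by nra.
  assert (I2 : L * error (u (i + S j)%nat) (u (i + S k)%nat) * (1 + eta)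
                 <= h * (L * v) * (1 + eta))
    by (apply Rmult_le_compat_r; lra).
  assert (I3 : (1 + eta) * c1
     <= (1 + eta) * ((1 + eta) * h * (L * v) + (eta * L + K) * v))
    by (apply Rmult_le_compat_l; lra).
  assert (I4 : h * (1 + eta) + (1 + eta) * (1 + eta) * h + (1 + eta) * eta + eta
                 <= 2 * h + 5 * eta) by nra.
  assert (I5 := Rmult_le_compat_r _ _ _ HLv I4).
  assert (I6 : 0 <= K * v) by nra.
  assert (I7 : (1 + eta) * (K * v) <= 2 * (K * v))
    by (apply Rmult_le_compat_r; lra).
  assert (I8 : (2 * h + 5 * eta) * (L * v) + 3 * (K * v) = L * v).
  { replace (5 * eta) with ((1 - 2 * h) / 2) by (unfold eta; field).
    replace (3 * (K * v)) with (L * (1 - 2 * h) / 2 * v)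
      by (rewrite HL; field); field. }
  lra.
Qed.

(** Long products are cut greedily into short ones separated by single steps;
    by super-additivity the number of pieces is controlled by [omega 0 T]. *)
Lemma grid_product_close : exists L : R, 1 <= L /\
  forall u k i, grid u ->
    is_lipschitz (grid_product u i k) L /\
    forall a, norm (minus (grid_product u i k a) (phi (u (i + k)%nat) (u i) a))
                <= L * error (u i) (u (i + k)%nat).
Proof.
destruct grid_product_close_local as [L [w0 [HL [Hw0 Hloc]]]].
set (B := K * scale 0 T + L * error 0 T).
assert (Hbase : forall u, grid u -> forall n m, u n <= u m ->
  scale (u n) (u m) <= scale 0 T /\ error (u n) (u m) <= error 0 T).
{ intros u Hu n m Hnm; destruct (proj1 Hu n) as [Nn _], (proj1 Hu m) as [_ Nm].
  split; [apply scale_mono|apply error_mono]; lra. }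
assert (HB : 0 <= B).
{ assert (H := scale_ge0 0 T); assert (H' := error_ge0 0 T).
  unfold B; nra. }
assert (Hstep : forall u, grid u -> forall n m, u n <= u m ->
  is_lipschitz (phi (u m) (u n)) (1 + B) /\
  forall a, norm (minus (phi (u m) (u n) a) a) <= B).
{ intros u Hu n m Hnm; destruct (proj1 Hu n) as [Nn _], (proj1 Hu m) as [_ Nm].
  destruct (Hbase u Hu n m Hnm) as [Hs _].
  assert (HE := error_ge0 0 T).
  assert (HKB : K * scale (u n) (u m) <= B) by (unfold B; nra).
  split.
  - intros a b; assert (Hn := norm_ge_0 (minus b a)).
    eapply Rle_trans; [apply scheme_lipschitz; lra|].
    apply Rmult_le_compat_r; lra.
  - intros a.
    eapply Rle_trans; [apply (scheme_near _ _ Hphi (u n) (u m) a); lra|lra]. }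
assert (Hshort : forall u, grid u -> forall k i,
  omega (u i) (u (i + k)%nat) <= w0 ->
  is_lipschitz (grid_product u i k) (1 + B) /\
  forall a, norm (minus (grid_product u i k a) a) <= B).
{ intros u Hu k i Hw; assert (Hle := grid_le u i k Hu).
  destruct (Hbase u Hu i (i + k)%nat Hle) as [Hs He].
  destruct (proj1 Hu i) as [Ni _], (proj1 Hu (i + k)%nat) as [_ Nk].
  destruct (Hloc u k i Hu Hw) as [H1 H2].
  assert (HKB : K * scale (u i) (u (i + k)%nat)
                  + L * error (u i) (u (i + k)%nat) <= B) by (unfold B; nra).
  split.
  - intros a b; assert (Hn := norm_ge_0 (minus b a)).
    assert (E := norm_split2
      (minus (grid_product u i k b) (grid_product u i k a))
      (minus (minus (grid_product u i k b) (phi (u (i + k)%nat) (u i) b))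
             (minus (grid_product u i k a) (phi (u (i + k)%nat) (u i) a)))
      (minus (phi (u (i + k)%nat) (u i) b) (phi (u (i + k)%nat) (u i) a))
      ltac:(vec)).
    assert (E1 := H2 a b).
    assert (E2 := scheme_lipschitz (u i) (u (i + k)%nat) ltac:(lra) Hle
      ltac:(lra) a b).
    assert (E3 := Rmult_le_compat_r _ _ _ Hn HKB); lra.
  - intros a.
    assert (E := norm_split2 (minus (grid_product u i k a) a)
      (minus (grid_product u i k a) (phi (u (i + k)%nat) (u i) a))
      (minus (phi (u (i + k)%nat) (u i) a) a) ltac:(vec)).
    assert (E1 := H1 a).
    assert (E2 := scheme_near _ _ Hphi (u i) (u (i + k)%nat) a ltac:(lra) Hle
      ltac:(lra)); unfold increment in E2; lra. }
set (Lam := fun m => (1 + B) ^ (2 * m + 1)).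
assert (Hlong : forall m u, grid u -> forall k i,
  omega (u i) (u (i + k)%nat) <= INR (S m) * w0 ->
  is_lipschitz (grid_product u i k) (Lam m) /\
  forall a, norm (minus (grid_product u i k a) a) <= INR (2 * m + 1) * B).
{ intros m u Hu; induction m as [|m IH]; intros k i Hw.
  - unfold Lam; simpl in Hw |- *; rewrite Rmult_1_r, Rmult_1_l.
    apply Hshort; [exact Hu|lra].
  - destruct (grid_exit u i k w0 Hu ltac:(lra)) as [H|[j [Hj [H H']]]].
    + destruct (Hshort u Hu k i H) as [H1 H2]; split; [intros a b|intros a].
      * eapply Rle_trans; [apply H1|].
        apply Rmult_le_compat_r; [apply norm_ge_0|].
        unfold Lam; rewrite <- (pow_1 (1 + B)) at 1.
        apply Rle_pow; [lra|lia].
      * eapply Rle_trans; [apply H2|].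
        assert (1 <= INR (2 * S m + 1)) by (apply (le_INR 1); lia); nra.
    + destruct (Hshort u Hu j i H) as [H1 H2].
      assert (Hj' : u (i + j)%nat <= u (i + S j)%nat)
        by (rewrite <- plus_n_Sm; apply Hu).
      destruct (Hstep u Hu (i + j)%nat (i + S j)%nat Hj') as [H3 H4].
      assert (Hsup := grid_super u i (S j) k Hu ltac:(lia)).
      assert (Hrest := IH (k - S j)%nat (i + S j)%nat).
      replace (i + S j + (k - S j))%nat with (i + k)%nat in Hrest by lia.
      destruct Hrest as [H5 H6]; [rewrite S_INR in Hw; lra|].
      assert (HQ : forall a, grid_product u i k a
        = grid_product u (i + S j) (k - S j)
            (phi (u (i + S j)%nat) (u (i + j)%nat) (grid_product u i j a))).
      { intros a; replace k with (j + S (k - S j))%nat at 1 by lia.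
        rewrite grid_product_add; simpl; rewrite <- plus_n_Sm; reflexivity. }
      assert (HLam : 0 <= Lam m) by (apply pow_le; lra).
      split; [intros a b|intros a]; rewrite !HQ.
      * eapply Rle_trans; [apply H5|].
        replace (Lam (S m)) with (Lam m * ((1 + B) * (1 + B)))
          by (unfold Lam; replace (2 * S m + 1)%nat with (S (S (2 * m + 1)))
                by lia; simpl; ring).
        rewrite Rmult_assoc; apply Rmult_le_compat_l; [exact HLam|].
        eapply Rle_trans; [apply H3|].
        rewrite Rmult_assoc; apply Rmult_le_compat_l; [lra|apply H1].
      * set (x := grid_product u i j a) in *.
        assert (E := norm_split3
          (minus (grid_product u (i + S j) (k - S j)
             (phi (u (i + S j)%nat) (u (i + j)%nat) x)) a)
          (minus (grid_product u (i + S j) (k - S j)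
             (phi (u (i + S j)%nat) (u (i + j)%nat) x))
             (phi (u (i + S j)%nat) (u (i + j)%nat) x))
          (minus (phi (u (i + S j)%nat) (u (i + j)%nat) x) x)
          (minus x a) ltac:(vec)).
        assert (E1 := H6 (phi (u (i + S j)%nat) (u (i + j)%nat) x)).
        assert (E2 := H4 x); assert (E3 := H2 a); fold x in E3.
        replace (INR (2 * S m + 1)) with (INR (2 * m + 1) + 2)
          by (replace (2 * S m + 1)%nat with (S (S (2 * m + 1))) by lia;
              rewrite !S_INR; ring).
        lra. }
destruct (INR_unbounded (omega 0 T / w0)) as [m Hm].
(* where [omega] exceeds [w0], [error] is bounded below and the displacements
   are bounded *)
set (C := (INR (2 * m + 1) * B + B) / rpow w0 ((2 + gamma) / p)).
assert (Hrw0 := rpow_gt0 w0 ((2 + gamma) / p) Hw0).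
assert (HC : 0 <= C).
{ assert (H := pos_INR (2 * m + 1)).
  apply Rmult_le_pos; [nra|apply Rlt_le, Rinv_0_lt_compat, Hrw0]. }
assert (HLam : 1 <= Lam m) by (apply pow_R1_Rle; lra).
exists (Lam m + L + C); split; [lra|].
intros u k i Hu; assert (Hle := grid_le u i k Hu).
destruct (proj1 Hu i) as [Ni _], (proj1 Hu (i + k)%nat) as [_ Nk].
assert (Hall : omega (u i) (u (i + k)%nat) <= INR (S m) * w0).
{ apply Rle_trans with (omega 0 T); [apply control_mono with T; auto; lra|].
  rewrite S_INR; apply Rlt_le.
  apply Rlt_le_trans with (INR m * w0); [|nra].
  apply Rmult_lt_reg_r with (/ w0); [apply Rinv_0_lt_compat, Hw0|].
  rewrite Rmult_assoc, Rinv_r by lra; unfold Rdiv in Hm; lra. }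
destruct (Hlong m u Hu k i Hall) as [H1' H2'].
assert (HE := error_ge0 (u i) (u (i + k)%nat)).
split.
- intros a b; eapply Rle_trans; [apply H1'|].
  apply Rmult_le_compat_r; [apply norm_ge_0|lra].
- intros a; destruct (Rle_dec (omega (u i) (u (i + k)%nat)) w0) as [Hw|Hw].
  + eapply Rle_trans; [apply Hloc; assumption|].
    apply Rmult_le_compat_r; lra.
  + assert (E := norm_split2
      (minus (grid_product u i k a) (phi (u (i + k)%nat) (u i) a))
      (minus (grid_product u i k a) a)
      (opp (minus (phi (u (i + k)%nat) (u i) a) a)) ltac:(vec)).
    rewrite norm_opp_eq in E.
    assert (E1 := H2' a).
    assert (E2 := proj2 (Hstep u Hu i (i + k)%nat Hle) a).
    assert (E3 : rpow w0 ((2 + gamma) / p) <= error (u i) (u (i + k)%nat))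
      by (assert (Ht := theta_gt1); apply rpow_le; lra).
    assert (E4 : C * rpow w0 ((2 + gamma) / p) = INR (2 * m + 1) * B + B)
      by (unfold C; field; lra).
    assert (C * rpow w0 ((2 + gamma) / p) <= C * error (u i) (u (i + k)%nat))
      by (apply Rmult_le_compat_l; assumption).
    assert (0 <= Lam m * error (u i) (u (i + k)%nat)) by nra.
    assert (0 <= L * error (u i) (u (i + k)%nat)) by nra.
    lra.
Qed.

(** Telescoping from the left: replacing the product along [v] over one step
    of [u] by that step costs one error, which the rest of the product along
    [v] magnifies by a bounded factor. *)
Lemma grid_product_refine (L kappa : R) (u v : nat -> R) (sigma : nat -> nat) :
  (forall w k i, grid w ->
    is_lipschitz (grid_product w i k) L /\
    forall a, norm (minus (grid_product w i k a) (phi (w (i + k)%nat) (w i) a))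
                <= L * error (w i) (w (i + k)%nat)) ->
  0 <= L -> 0 <= kappa -> grid u -> grid v ->
  (forall n, u n = v (sigma n)) -> (forall n, (sigma n <= sigma (S n))%nat) ->
  (forall n, error (u n) (u (S n)) <= kappa * omega (u n) (u (S n))) ->
  forall k i a,
    norm (minus (grid_product v (sigma i) (sigma (i + k)%nat - sigma i) a)
                (grid_product u i k a))
      <= L * L * kappa * omega (u i) (u (i + k)%nat).
Proof.
intros HL HL0 Hkap Hu Hv Huv Hsig Hstep.
assert (Hmono : forall i k, (sigma i <= sigma (i + k))%nat).
{ intros i k; induction k as [|k IH]; [rewrite Nat.add_0_r; lia|].
  rewrite <- plus_n_Sm; specialize (Hsig (i + k)%nat); lia. }
induction k as [|k IH]; intros i a.
- rewrite Nat.add_0_r, Nat.sub_diag, (control_diag _ _ Hom) by apply Hu.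
  simpl; rewrite norm_minus_self; lra.
- set (d := (sigma (S i) - sigma i)%nat).
  assert (Hd : (sigma i + d = sigma (S i))%nat)
    by (unfold d; specialize (Hsig i); lia).
  replace (sigma (i + S k)%nat - sigma i)%nat
    with (d + (sigma (S i + k)%nat - sigma (S i)))%nat
    by (specialize (Hmono (S i) k); unfold d; rewrite <- plus_n_Sm; simpl in *;
        specialize (Hsig i); lia).
  rewrite grid_product_add, Hd; simpl grid_product at 3.
  set (m := (sigma (S i + k)%nat - sigma (S i))%nat).
  set (x := grid_product v (sigma i) d a); set (x' := phi (u (S i)) (u i) a).
  assert (E := norm_split2
    (minus (grid_product v (sigma (S i)) m x) (grid_product u (S i) k x'))
    (minus (grid_product v (sigma (S i)) m x)
           (grid_product v (sigma (S i)) m x'))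
    (minus (grid_product v (sigma (S i)) m x') (grid_product u (S i) k x'))
    ltac:(vec)).
  assert (E1 := IH (S i) x'); fold m in E1.
  assert (E2 := proj1 (HL v m (sigma (S i)) Hv) x' x).
  assert (E3 := proj2 (HL v d (sigma i) Hv) a); fold x in E3.
  rewrite Hd, <- !Huv in E3; fold x' in E3.
  assert (E4 := Hstep i).
  assert (E5 := grid_super u i 1 (S k) Hu ltac:(lia)).
  replace (i + 1)%nat with (S i) in E5 by lia.
  replace (S i + k)%nat with (i + S k)%nat in E1 by lia.
  assert (Hk : 0 <= kappa * omega (u i) (u (S i)))
    by (eapply Rle_trans; [apply error_ge0|exact E4]).
  assert (I1 : L * norm (minus x x') <= L * (L * (kappa * omega (u i) (u (S i))))).
  { apply Rmult_le_compat_l; [exact HL0|].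
    eapply Rle_trans; [exact E3|apply Rmult_le_compat_l; assumption]. }
  assert (HLk : 0 <= L * L * kappa) by (repeat apply Rmult_le_pos; lra).
  assert (I2 := Rmult_le_compat_l _ _ _ HLk E5); lra.
Qed.

Lemma grid_product_ext (u v : nat -> R) (k i j : nat) a :
  (forall n, (n <= k)%nat -> u (i + n)%nat = v (j + n)%nat) ->
  grid_product u i k a = grid_product v j k a.
Proof.
revert i j a; induction k as [|k IH]; intros i j a H; simpl; [reflexivity|].
assert (H0 := H O ltac:(lia)); rewrite !Nat.add_0_r in H0.
assert (H1 := H 1%nat ltac:(lia)); rewrite !Nat.add_1_r in H1.
rewrite H0, H1; apply IH; intros n Hn.
specialize (H (S n) ltac:(lia)); rewrite <- !plus_n_Sm in H; exact H.
Qed.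

Lemma error_small (kappa : R) : 0 < kappa -> exists h, 0 < h /\
  forall s t, 0 <= s -> s <= t -> t <= T -> t - s <= h ->
    error s t <= kappa * omega s t.
Proof.
intros Hk; assert (Ht := theta_gt1).
destruct (rpow_small ((2 + gamma) / p - 1) kappa) as [d [Hd Hs]];
  [lra|exact Hk|].
destruct (control_small T omega Hom d Hd) as [h [Hh Hsm]].
exists h; split; [exact Hh|intros s t H0 Hst HT Hts].
assert (Hw := control_ge0 _ _ Hom s t H0 Hst HT).
unfold error; replace ((2 + gamma) / p) with ((2 + gamma) / p - 1 + 1) by ring.
rewrite rpow_add, rpow_1 by exact Hw.
apply Rmult_le_compat_r; [exact Hw|apply Hs, Hsm; assumption].
Qed.

(** The dyadic points of [0, T] moved to the nearest point of [s, t]; the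
    repeated points at both ends are harmless as the scheme is the identity on
    the diagonal. *)
Definition dyadic_grid (s t : R) (n k : nat) : R :=
  Rmax s (Rmin t (INR k * (T / 2 ^ n))).

Definition dyadic_product (n : nat) (s t : R) : V -> V :=
  grid_product (dyadic_grid s t n) 0 (2 ^ n).

Lemma dyadic_mesh_ge0 (n : nat) : 0 <= T -> 0 <= T / 2 ^ n.
Proof.
intros HT; apply Rmult_le_pos; [exact HT|].
apply Rlt_le, Rinv_0_lt_compat, pow_lt; lra.
Qed.

Lemma dyadic_grid_start (s t : R) (n : nat) :
  0 <= s -> s <= t -> dyadic_grid s t n 0 = s.
Proof.
intros; unfold dyadic_grid; simpl; rewrite Rmult_0_l.
rewrite Rmin_right, Rmax_left; lra.
Qed.

Lemma dyadic_grid_end (s t : R) (n k : nat) :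
  0 <= T -> s <= t -> t <= T -> (2 ^ n <= k)%nat -> dyadic_grid s t n k = t.
Proof.
intros H0 Hst HtT Hk; unfold dyadic_grid.
assert (T <= INR k * (T / 2 ^ n)).
{ apply Rle_trans with (2 ^ n * (T / 2 ^ n)).
  - right; field; apply pow_nonzero; lra.
  - apply Rmult_le_compat_r; [apply dyadic_mesh_ge0, H0|].
    change 2 with (INR 2); rewrite <- pow_INR; apply le_INR, Hk. }
rewrite Rmin_left, Rmax_right; lra.
Qed.

Lemma dyadic_grid_step (s t : R) (n k : nat) : 0 <= T ->
  dyadic_grid s t n k <= dyadic_grid s t n (S k)
    <= dyadic_grid s t n k + T / 2 ^ n.
Proof.
intros H0; assert (H := dyadic_mesh_ge0 n H0).
unfold dyadic_grid; rewrite S_INR, Rmult_plus_distr_r, Rmult_1_l.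
set (x := INR k * (T / 2 ^ n)); set (d := T / 2 ^ n) in *.
unfold Rmax, Rmin; repeat destruct (Rle_dec _ _); lra.
Qed.

Lemma dyadic_grid_grid (s t : R) (n : nat) :
  0 <= s -> s <= t -> t <= T -> grid (dyadic_grid s t n).
Proof.
intros H0 Hst HtT; split; intros k; [|apply dyadic_grid_step; lra].
unfold dyadic_grid; unfold Rmax, Rmin; repeat destruct (Rle_dec _ _); lra.
Qed.

Lemma dyadic_grid_refine (s t : R) (n m k : nat) :
  dyadic_grid s t n k = dyadic_grid s t (n + m) (2 ^ m * k).
Proof.
unfold dyadic_grid; do 2 f_equal.
rewrite mult_INR, pow_INR, pow_add; simpl INR.
replace (1 + 1) with 2 by ring.
field; split; apply pow_nonzero; lra.
Qed.

Lemma dyadic_mesh_small (h : R) : 0 < h -> exists N, forall n, (N <= n)%nat ->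
  T / 2 ^ n <= h.
Proof.
intros Hh; destruct (Pow_x_infinity 2 ltac:(rewrite Rabs_pos_eq; lra) (T / h))
  as [N HN].
exists N; intros n Hn; specialize (HN n Hn).
assert (Hp2 : 0 < 2 ^ n) by (apply pow_lt; lra).
rewrite Rabs_pos_eq in HN by lra.
apply Rmult_le_reg_r with (2 ^ n); [exact Hp2|].
unfold Rdiv; rewrite Rmult_assoc, Rinv_l, Rmult_1_r by lra.
apply Rge_le in HN.
apply Rmult_le_reg_r with (/ h); [apply Rinv_0_lt_compat, Hh|].
replace (h * 2 ^ n * / h) with (2 ^ n) by (field; lra); exact HN.
Qed.

(** The limit of the products along the dyadic grids. Two applications of
    [grid_product_refine] carry the argument: for successive dyadic grids it
    gives the convergence, and for the concatenation of the grids of [[r, s]]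
    and [[s, t]], which refines the grid of [[r, t]], the flow property. *)
Theorem scheme_flow : exists psi : R -> R -> V -> V,
  lipschitz_flow T psi /\
  exists C, 0 <= C /\ forall s t a, 0 <= s -> s <= t -> t <= T ->
    norm (minus (psi t s a) (phi t s a)) <= C * error s t.
Proof.
destruct grid_product_close as [L [HL1 HL]].
assert (HL0 : 0 <= L) by lra.
destruct (Rle_dec 0 T) as [H0T|H0T].
2: { exists (fun _ _ a => a); split; [split; [split|exists 1]|exists 0];
  try (split; [lra|]); intros; try lra; reflexivity. }
assert (HW0 := control_ge0 _ _ Hom 0 T (Rle_refl 0) H0T (Rle_refl T)).
set (W := omega 0 T) in *.
assert (Hfine : forall eps, 0 < eps -> exists N, forall n, (N <= n)%nat ->
  forall r t v sigma k, 0 <= r -> r <= t -> t <= T -> grid v ->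
    (forall j, dyadic_grid r t n j = v (sigma j)) ->
    (forall j, (sigma j <= sigma (S j))%nat) -> sigma O = O ->
    sigma (2 ^ n)%nat = k ->
    forall a, norm (minus (grid_product v 0 k a) (dyadic_product n r t a))
                <= eps).
{ intros eps Heps.
  assert (HLW : 0 < L * L * (W + 1)) by (repeat apply Rmult_lt_0_compat; lra).
  assert (Hk : 0 < eps / (L * L * (W + 1)))
    by (apply Rdiv_lt_0_compat; assumption).
  destruct (error_small _ Hk) as [h [Hh Herr]].
  destruct (dyadic_mesh_small h Hh) as [N HN]; exists N.
  intros n Hn r t v sigma k Hr Hrt Ht Hv Huv Hsig Hs0 Hsk a.
  assert (Hg := dyadic_grid_grid r t n Hr Hrt Ht).
  assert (H := grid_product_refine L _ (dyadic_grid r t n) v sigma HL HL0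
    (Rlt_le _ _ Hk) Hg Hv Huv Hsig).
  eapply Rle_trans.
  - specialize (H ltac:(intros j; apply Herr; try apply Hg;
      destruct (dyadic_grid_step r t n j H0T), (HN n Hn); lra) (2 ^ n)%nat O a).
    rewrite Nat.add_0_l, Hs0, Nat.sub_0_r, Hsk in H; exact H.
  - rewrite (dyadic_grid_start r t n Hr Hrt).
    rewrite (dyadic_grid_end r t n _ H0T Hrt Ht (le_n _)).
    assert (Hw : omega r t <= W) by (apply control_mono with T; auto; lra).
    apply Rle_trans with (L * L * (eps / (L * L * (W + 1))) * (W + 1));
      [|right; field; lra].
    apply Rmult_le_compat_l; [|lra].
    apply Rmult_le_pos; [nra|lra]. }
assert (Hcauchy : forall eps, 0 < eps -> exists N, forall n m,
  (N <= n)%nat -> (n <= m)%nat -> forall s t a, 0 <= s -> s <= t -> t <= T ->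
    norm (minus (dyadic_product m s t a) (dyadic_product n s t a)) <= eps).
{ intros eps Heps; destruct (Hfine eps Heps) as [N HN]; exists N.
  intros n m Hn Hnm s t a Hs Hst Ht.
  apply (HN n Hn s t (dyadic_grid s t m) (fun j => 2 ^ (m - n) * j)%nat);
    try assumption; try lia.
  - apply dyadic_grid_grid; assumption.
  - intros j; replace m with (n + (m - n))%nat at 1 by lia.
    apply dyadic_grid_refine.
  - rewrite <- Nat.pow_add_r; f_equal; lia. }
set (psi := fun t s a => iota (fun y : V =>
  filterlim (fun n => dyadic_product n s t a) eventually (locally y))).
assert (Hlim : forall eps, 0 < eps -> exists N, forall n, (N <= n)%nat ->
  forall s t a, 0 <= s -> s <= t -> t <= T ->
    norm (minus (dyadic_product n s t a) (psi t s a)) <= eps).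
{ intros eps Heps; destruct (Hcauchy (eps / 2)) as [N HN]; [lra|].
  exists N; intros n Hn s t a Hs Hst Ht.
  assert (Hex : exists y : V,
    filterlim (fun n => dyadic_product n s t a) eventually (locally y)).
  { apply (filterlim_locally_cauchy (fun n => dyadic_product n s t a)).
    intros e; assert (He := cond_pos e).
    destruct (Hcauchy (e / 2)) as [M HM]; [lra|].
    exists (fun n => (M <= n)%nat); split; [exists M; auto|].
    intros i j Hi Hj; 
    apply (norm_compat1 (dyadic_product i s t a) (dyadic_product j s t a) e).
    change (norm (minus (dyadic_product j s t a) (dyadic_product i s t a)) < e).
    destruct (Nat.le_ge_cases i j) as [Hij|Hij].
    - eapply Rle_lt_trans; [apply HM; assumption|lra].
    - rewrite norm_minus_sym; eapply Rle_lt_trans; [apply HM; assumption|lra]. }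
  destruct Hex as [y Hy].
  replace (psi t s a) with y
    by (symmetry; apply (iota_filterlim_locally _ _ Hy)).
  assert (He2 : 0 < eps / 2) by lra.
  destruct (proj1 (filterlim_locally_ball_norm _ y) Hy (mkposreal _ He2))
    as [M HM].
  assert (H1 := HM (Nat.max n M) (Nat.le_max_r n M)).
  change (norm (minus (dyadic_product (Nat.max n M) s t a) y) < eps / 2) in H1.
  assert (H2 := HN n (Nat.max n M) Hn (Nat.le_max_l n M) s t a Hs Hst Ht).
  assert (E := norm_split2 (minus (dyadic_product n s t a) y)
    (opp (minus (dyadic_product (Nat.max n M) s t a) (dyadic_product n s t a)))
    (minus (dyadic_product (Nat.max n M) s t a) y) ltac:(vec)).
  rewrite norm_opp_eq in E; lra. }
assert (Hprod : forall n s t, 0 <= s -> s <= t -> t <= T ->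
  is_lipschitz (dyadic_product n s t) L /\
  forall a, norm (minus (dyadic_product n s t a) (phi t s a))
              <= L * error s t).
{ intros n s t Hs Hst Ht.
  assert (H := HL (dyadic_grid s t n) (2 ^ n)%nat O
    (dyadic_grid_grid s t n Hs Hst Ht)).
  rewrite Nat.add_0_l, dyadic_grid_start in H by assumption.
  rewrite (dyadic_grid_end s t n _ H0T Hst Ht (le_n _)) in H; exact H. }
assert (Hclose : forall s t a, 0 <= s -> s <= t -> t <= T ->
  norm (minus (psi t s a) (phi t s a)) <= L * error s t).
{ intros s t a Hs Hst Ht; apply Rle_plus_epsilon; intros eps Heps.
  destruct (Hlim eps Heps) as [N HN].
  assert (H := HN N (le_n N) s t a Hs Hst Ht).
  assert (E := norm_split2 (minus (psi t s a) (phi t s a))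
    (opp (minus (dyadic_product N s t a) (psi t s a)))
    (minus (dyadic_product N s t a) (phi t s a)) ltac:(vec)).
  rewrite norm_opp_eq in E.
  assert (E1 := proj2 (Hprod N s t Hs Hst Ht) a); lra. }
assert (Hlip : forall s t, 0 <= s -> s <= t -> t <= T ->
  is_lipschitz (psi t s) L).
{ intros s t Hs Hst Ht a b; apply Rle_plus_epsilon; intros eps Heps.
  destruct (Hlim (eps / 2)) as [N HN]; [lra|].
  assert (Ha := HN N (le_n N) s t a Hs Hst Ht).
  assert (Hb := HN N (le_n N) s t b Hs Hst Ht).
  assert (E := norm_split3 (minus (psi t s b) (psi t s a))
    (opp (minus (dyadic_product N s t b) (psi t s b)))
    (minus (dyadic_product N s t a) (psi t s a))
    (minus (dyadic_product N s t b) (dyadic_product N s t a)) ltac:(vec)).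
  rewrite norm_opp_eq in E.
  assert (E1 := proj1 (Hprod N s t Hs Hst Ht) a b); lra. }
assert (Hid : forall t a, 0 <= t -> t <= T -> psi t t a = a).
{ intros t a Ht HtT; apply norm_minus_eq0.
  assert (H := Hclose t t a Ht (Rle_refl t) HtT).
  rewrite error_diag, scheme_diag in H by assumption; lra. }
exists psi; split; [split; [split; [exact Hid|]|]|].
- intros r s t a Hr Hrs Hst Ht.
  destruct (Req_dec r s) as [<-|Hrs'];
    [rewrite (Hid r a); [reflexivity|lra|lra]|].
  destruct (Req_dec s t) as [->|Hst']; [apply Hid; lra|].
  apply norm_minus_eq0, Rle_plus_epsilon; intros eps Heps.
  rewrite Rplus_0_l.
  assert (HsT : s <= T) by lra; assert (Hs0 : 0 <= s) by lra.
  assert (Hrt : r <= t) by lra.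
  assert (He : 0 < eps / (L + 3)) by (apply Rdiv_lt_0_compat; lra).
  destruct (Hfine _ He) as [N1 HN1]; destruct (Hlim _ He) as [N2 HN2].
  set (n := Nat.max N1 N2); set (e := eps / (L + 3)) in *.
  assert (Hn2 : (N2 <= n)%nat) by apply Nat.le_max_r.
  set (x := dyadic_product n r s a).
  (* the concatenated grid, written without cases: one of the two terms is
     constant *)
  set (v := fun k => dyadic_grid r s n k + dyadic_grid s t n (k - 2 ^ n) - s).
  assert (Hv1 : forall k, (k <= 2 ^ n)%nat -> v k = dyadic_grid r s n k).
  { intros k Hk; unfold v; replace (k - 2 ^ n)%nat with O by lia.
    rewrite (dyadic_grid_start s t) by assumption; ring. }
  assert (Hv2 : forall k, (2 ^ n <= k)%nat ->
            v k = dyadic_grid s t n (k - 2 ^ n)).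
  { intros k Hk; unfold v; rewrite (dyadic_grid_end r s) by assumption; ring. }
  assert (Hg1 := dyadic_grid_grid r s n Hr Hrs HsT).
  assert (Hg2 := dyadic_grid_grid s t n Hs0 Hst Ht).
  assert (Hv : grid v).
  { split; intros k; destruct (Nat.lt_ge_cases k (2 ^ n)) as [Hk|Hk].
    - rewrite Hv1 by lia; apply Hg1.
    - rewrite Hv2 by lia; apply Hg2.
    - rewrite !Hv1 by lia; apply Hg1.
    - rewrite !Hv2, Nat.sub_succ_l by lia; apply Hg2. }
  assert (Hcat : grid_product v 0 (2 ^ n + 2 ^ n) a = dyadic_product n s t x).
  { rewrite grid_product_add; unfold x, dyadic_product.
    rewrite (grid_product_ext v (dyadic_grid r s n) (2 ^ n) 0 0)
      by (intros j Hj; apply Hv1; lia).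
    apply grid_product_ext; intros j Hj; rewrite Hv2 by lia; f_equal; lia. }
  set (sigma := fun k => if Rle_dec (INR k * (T / 2 ^ n)) s
                         then k else (k + 2 ^ n)%nat).
  assert (Hmid : forall k, INR k * (T / 2 ^ n) <= s -> (k <= 2 ^ n)%nat).
  { intros k Hk; apply Nat.lt_succ_r, INR_lt; rewrite S_INR, pow_INR.
    simpl INR; replace (1 + 1) with 2 by ring.
    assert (Hm : 0 < T / 2 ^ n)
      by (apply Rdiv_lt_0_compat; [lra|apply pow_lt; lra]).
    apply Rmult_lt_reg_r with (T / 2 ^ n); [exact Hm|].
    apply Rle_lt_trans with T; [lra|].
    apply Rlt_le_trans with (T + T / 2 ^ n); [lra|].
    right; field; apply pow_nonzero; lra. }
  assert (H1 : norm (minus (dyadic_product n s t x) (dyadic_product n r t a))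
                 <= e).
  { rewrite <- Hcat.
    apply (HN1 n (Nat.le_max_l N1 N2) r t v sigma); try assumption.
    - intros j; unfold sigma; destruct (Rle_dec (INR j * (T / 2 ^ n)) s) as [Hj|Hj].
      + rewrite Hv1 by (apply Hmid, Hj); unfold dyadic_grid.
        rewrite !Rmin_right by lra; reflexivity.
      + rewrite Hv2 by lia; rewrite Nat.add_sub; unfold dyadic_grid.
        unfold Rmax, Rmin; repeat destruct (Rle_dec _ _); lra.
    - intros j; unfold sigma.
      assert (H := dyadic_mesh_ge0 n H0T).
      assert (INR j * (T / 2 ^ n) <= INR (S j) * (T / 2 ^ n))
        by (rewrite S_INR; lra).
      repeat destruct (Rle_dec _ _); try lia; lra.
    - unfold sigma; simpl INR; rewrite Rmult_0_l.
      destruct (Rle_dec 0 s); [reflexivity|lra].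
    - unfold sigma; rewrite pow_INR; simpl INR.
      replace ((1 + 1) ^ n * (T / 2 ^ n)) with T
        by (replace (1 + 1) with 2 by ring; field; apply pow_nonzero; lra).
      destruct (Rle_dec T s); [lra|reflexivity]. }
  assert (H2 := HN2 n Hn2 s t x Hs0 Hst Ht).
  assert (H3 := HN2 n Hn2 r s a Hr Hrs HsT); fold x in H3.
  assert (H4 := HN2 n Hn2 r t a Hr Hrt Ht).
  assert (H5 := Hlip s t Hs0 Hst Ht x (psi s r a)).
  rewrite (norm_minus_sym (psi s r a) x) in H5.
  assert (H6 : L * norm (minus x (psi s r a)) <= L * e)
    by (apply Rmult_le_compat_l; assumption).
  assert (E := norm_split4 (minus (psi t s (psi s r a)) (psi t r a))
    (minus (psi t s (psi s r a)) (psi t s x))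
    (opp (minus (dyadic_product n s t x) (psi t s x)))
    (minus (dyadic_product n s t x) (dyadic_product n r t a))
    (minus (dyadic_product n r t a) (psi t r a)) ltac:(vec)).
  rewrite norm_opp_eq in E.
  assert ((L + 3) * e = eps) by (unfold e; field; lra).
  lra.
- exists L; intros s t a b Hs Hst Ht; apply Hlip; assumption.
- exists L; split; [exact HL0|exact Hclose].
Qed.

End Sewing.

(** * Iterated products along partitions *)

Section Partitions.

Fixpoint fine (h s : R) (us : list R) (t : R) : Prop :=
  match us with
  | nil => s <= t /\ t - s <= h
  | u :: us' => s <= u /\ u <= t /\ u - s <= h /\ fine h u us' t
  end.

Lemma seq_step_cons (x y : R) (l : list R) :
  seq_step (x :: y :: l) = Rmax (Rabs (y - x)) (seq_step (y :: l)).
Proof. reflexivity. Qed.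

Lemma points_in_above (s t x : R) (us : list R) :
  sorted Rlt (x :: us) -> t < x -> points_in s t us = nil.
Proof.
revert x; induction us as [|u us IH]; intros x Hs Hx; [reflexivity|].
destruct Hs as [Hxu Hs]; simpl.
destruct (Rle_dec u t); [lra|].
destruct (Rle_dec s u); apply (IH u Hs); lra.
Qed.

Lemma fine_points_from (h s t : R) (us : list R) : forall x,
  0 <= h -> s <= x -> x <= t ->
  match us with nil => t - x <= h | u :: _ => x <= u /\ u - x <= h end ->
  sorted Rlt us -> seq_step us <= h ->
  (us <> nil -> t <= seq.last 0 us) ->
  fine h x (points_in s t us) t.
Proof.
induction us as [|u us IH]; intros x Hh Hsx Hxt Hu Hsort Hstep Hlast.
- split; assumption.
- destruct Hu as [Hxu Hux]; simpl.
  destruct (Rle_dec s u) as [Hsu|]; [|lra].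
  destruct (Rle_dec u t) as [Hut|Hut].
  + repeat split; try assumption.
    specialize (Hlast ltac:(discriminate)).
    apply IH; try assumption; destruct us as [|u' us].
    * simpl in Hlast; lra.
    * destruct Hsort as [Huu' _]; rewrite seq_step_cons in Hstep.
      assert (H := Rmax_l (Rabs (u' - u)) (seq_step (u' :: us))).
      assert (H' := Rle_abs (u' - u)); split; lra.
    * exact I.
    * apply Hsort.
    * exact Hh.
    * rewrite seq_step_cons in Hstep.
      assert (H := Rmax_r (Rabs (u' - u)) (seq_step (u' :: us))); lra.
    * intros H; contradiction H; reflexivity.
    * intros _; exact Hlast.
  + change (fine h x (points_in s t us) t).
    rewrite (points_in_above s t u us Hsort) by lra; split; lra.
Qed.

(** Both the step from [s] to the first point of the partition and the one from
    the last point to [t] lie inside a gap of the partition, because its ends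
    enclose [s] and [t]. *)
Lemma fine_points (h s t : R) (pi : list R) :
  pi <> nil -> sorted Rlt pi -> seq_step pi <= h -> 0 <= h ->
  seq.head 0 pi <= s -> s <= t -> t <= seq.last 0 pi ->
  fine h s (points_in s t pi) t.
Proof.
intros Hne Hsort Hstep Hh Hhead Hst Hlast.
induction pi as [|x us IH]; [contradiction Hne; reflexivity|clear Hne].
simpl in Hhead; destruct (Rle_dec s x) as [Hsx|Hsx].
- apply fine_points_from; auto; lra.
- change (fine h s (points_in s t (x :: us)) t); simpl.
  destruct (Rle_dec s x) as [H|_]; [contradiction|].
  destruct us as [|u us]; [simpl in Hlast; lra|].
  change (fine h s (points_in s t (u :: us)) t).
  destruct Hsort as [Hxu Hsort]; rewrite seq_step_cons in Hstep.
  assert (H1 := Rmax_l (Rabs (u - x)) (seq_step (u :: us))).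
  assert (H2 := Rmax_r (Rabs (u - x)) (seq_step (u :: us))).
  assert (H3 := Rle_abs (u - x)).
  destruct (Rle_dec u s) as [Hus|Hus].
  + apply IH; auto; [discriminate|lra].
  + apply fine_points_from; auto; try lra; split; lra.
Qed.

Context {V : CompleteNormedModule R_AbsRing}.
Context (T p gamma : R) (omega : R -> R -> R).
Context (Hp : 2 <= p < 3) (Hgamma : 0 < gamma <= 1) (Hpg : p < 2 + gamma).
Context (Hom : control T omega).
Implicit Types a b : V.

(** Telescoping from the left against a Lipschitz flow, the local errors add up
    to at most [sup (omega ^ (theta - 1))] times [omega s t]. *)
Lemma iterated_product_cvg_of_close (C : R) (chi psi : R -> R -> V -> V) :
  0 < T -> 0 <= C -> lipschitz_flow T psi ->
  (forall s t a, 0 <= s -> s <= t -> t <= T ->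
     norm (minus (chi t s a) (psi t s a)) <= C * error p gamma omega s t) ->
  iterated_product_cvg T chi psi.
Proof.
intros HT HC [[Hid Hflow] [L0 HL0]] Hclose.
set (L := Rmax L0 1).
assert (HL1 : 1 <= L) by apply Rmax_r.
assert (HL : forall s t a b, 0 <= s -> s <= t -> t <= T ->
  norm (minus (psi t s b) (psi t s a)) <= L * norm (minus b a)).
{ intros s t a b Hs Hst Ht; eapply Rle_trans; [apply HL0; assumption|].
  apply Rmult_le_compat_r; [apply norm_ge_0|apply Rmax_l]. }
assert (Hchain : forall h kappa, 0 <= kappa ->
  (forall s t, 0 <= s -> s <= t -> t <= T -> t - s <= h ->
     error p gamma omega s t <= kappa * omega s t) ->
  forall us s t a, 0 <= s -> t <= T -> fine h s us t ->
    s <= t /\ norm (minus (chain chi us t s a) (psi t s a))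
      <= L * C * kappa * omega s t).
{ intros h kappa Hk Herr.
  assert (Hone : forall s t a, 0 <= s -> s <= t -> t <= T -> t - s <= h ->
    norm (minus (chi t s a) (psi t s a)) <= C * kappa * omega s t).
  { intros s t a Hs Hst Ht Hts; eapply Rle_trans; [apply Hclose; assumption|].
    rewrite Rmult_assoc; apply Rmult_le_compat_l; auto. }
  induction us as [|u us IH]; intros s t a Hs Ht Hfine; simpl in Hfine |- *.
  - destruct Hfine as [Hst Hts]; split; [exact Hst|].
    eapply Rle_trans; [apply Hone; assumption|].
    assert (Hw := control_ge0 _ _ Hom s t Hs Hst Ht).
    assert (H0 : 0 <= C * kappa * omega s t)
      by (repeat apply Rmult_le_pos; assumption).
    nra.
  - destruct Hfine as [Hsu [Hut [Hus Hfine]]].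
    destruct (IH u t (chi u s a) ltac:(lra) Ht Hfine) as [_ H1].
    split; [lra|].
    assert (H2 := HL u t (psi u s a) (chi u s a) ltac:(lra) Hut Ht).
    assert (H3 := Hone s u a Hs Hsu ltac:(lra) Hus).
    rewrite (Hflow s u t a Hs Hsu Hut Ht) in H2.
    assert (E := norm_split2
      (minus (chain chi us t u (chi u s a)) (psi t s a))
      (minus (chain chi us t u (chi u s a)) (psi t u (chi u s a)))
      (minus (psi t u (chi u s a)) (psi t s a)) ltac:(vec)).
    assert (I1 : L * norm (minus (chi u s a) (psi u s a))
                   <= L * (C * kappa * omega s u))
      by (apply Rmult_le_compat_l; lra).
    assert (I2 := control_super _ _ Hom s u t Hs Hsu Hut Ht).
    assert (HLC : 0 <= L * C * kappa) by (repeat apply Rmult_le_pos; lra).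
    assert (I3 := Rmult_le_compat_l _ _ _ HLC I2); lra. }
intros s t a Hs Hst Ht P [eps HP]; assert (Heps := cond_pos eps).
assert (Hw := control_ge0 _ _ Hom s t Hs Hst Ht).
assert (HLC : 0 <= L * C) by nra.
assert (Hden : 0 < (L * C + 1) * (omega s t + 1))
  by (apply Rmult_lt_0_compat; lra).
assert (Hk : 0 < eps / ((L * C + 1) * (omega s t + 1)))
  by (apply Rdiv_lt_0_compat; assumption).
destruct (error_small T p gamma omega Hp Hpg Hom _ Hk) as [h [Hh Herr]].
set (kappa := eps / ((L * C + 1) * (omega s t + 1))) in *.
exists (mkposreal h Hh); intros pi Hstep [Hsort [Hhead Hlast]]; apply HP.
apply (norm_compat1 (psi t s a) (iterated_product chi pi t s a) eps).
change (norm (minus (iterated_product chi pi t s a) (psi t s a)) < eps).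
simpl in Hstep.
eapply Rle_lt_trans.
- apply (Hchain h kappa ltac:(lra) Herr (points_in s t pi) s t a Hs Ht).
  apply fine_points; try assumption; try lra.
  intros ->; simpl in Hlast; lra.
- assert (E : kappa * ((L * C + 1) * (omega s t + 1)) = eps)
    by (unfold kappa; field; lra).
  clearbody kappa; rewrite <- E.
  assert (0 <= kappa * omega s t * (L * C)) by (repeat apply Rmult_le_pos; lra).
  assert (0 <= kappa * omega s t) by (apply Rmult_le_pos; lra).
  assert (0 <= kappa * (L * C)) by (apply Rmult_le_pos; lra).
  lra.
Qed.

End Partitions.

(** * Autonomous differential equations on the unit interval *)

Section Autonomous.

Context {V : CompleteNormedModule R_AbsRing}.
Implicit Types a b : V.

Definition solves (F : V -> V) a (z : R -> V) : Prop :=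
  forall alpha, 0 <= alpha <= 1 ->
    is_RInt (fun beta => F (z beta)) 0 alpha (minus (z alpha) a).

Lemma is_RInt_bound (g : R -> V) (alpha M : R) (v : V) :
  0 <= alpha <= 1 -> 0 <= M -> (forall beta, 0 <= beta <= alpha -> norm (g beta) <= M) ->
  is_RInt g 0 alpha v -> norm v <= M.
Proof.
intros Ha HM Hg Hv.
assert (H := norm_RInt_le_const g 0 alpha v M (proj1 Ha) Hg Hv).
assert (H' : norm v <= (alpha - 0) * M) by exact H; nra.
Qed.

Lemma solves_bound (F : V -> V) (M : R) a z :
  (forall b, norm (F b) <= M) -> solves F a z ->
  forall alpha, 0 <= alpha <= 1 -> norm (minus (z alpha) a) <= M.
Proof.
intros HF Hz alpha Ha.
assert (HM : 0 <= M) by (assert (H := norm_ge_0 (F a)); specialize (HF a); lra).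
apply (is_RInt_bound (fun beta => F (z beta)) alpha); auto.
Qed.

(** Grönwall's inequality by iteration: a bound [B exp (2 kappa alpha)] on the
    distance of two solutions improves to [(n + B / 2) exp (2 kappa alpha)],
    where [n] is the initial distance. *)
Lemma solves_lipschitz (F : V -> V) (kappa M : R) a b z z' :
  0 <= kappa -> (forall x y : V, norm (minus (F y) (F x)) <= kappa * norm (minus y x)) ->
  (forall x, norm (F x) <= M) -> solves F a z -> solves F b z' ->
  norm (minus (z' 1) (z 1))
    <= (1 + 2 * kappa * exp (2 * kappa)) * norm (minus b a).
Proof.
intros Hk HF HM Hz Hz'.
set (n := norm (minus b a)); assert (Hn : 0 <= n) by apply norm_ge_0.
assert (HM0 : 0 <= M) by (assert (H := norm_ge_0 (F a)); specialize (HM a); lra).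
assert (Hint : forall (g : R -> R) (alpha I : R), 0 <= alpha <= 1 ->
  (forall beta, 0 <= beta <= alpha ->
     kappa * norm (minus (z' beta) (z beta)) <= g beta) ->
  is_RInt g 0 alpha I -> norm (minus (z' alpha) (z alpha)) <= n + I).
{ intros g alpha I Ha Hg HI.
  assert (HD := is_RInt_minus _ _ _ _ _ _ (Hz' alpha Ha) (Hz alpha Ha)).
  assert (H := norm_RInt_le _ g 0 alpha _ I (proj1 Ha)
    (fun beta Hb => Rle_trans _ _ _ (HF (z beta) (z' beta)) (Hg beta Hb)) HD HI).
  assert (H' : norm (minus (minus (z' alpha) b) (minus (z alpha) a)) <= I)
    by exact H.
  assert (E := norm_split2 (minus (z' alpha) (z alpha)) (minus b a)
    (minus (minus (z' alpha) b) (minus (z alpha) a)) ltac:(vec)).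
  fold n in E; lra. }
assert (Hexp1 : forall alpha, 0 <= alpha -> 1 <= exp (2 * kappa * alpha)).
{ intros alpha Ha; rewrite <- exp_0.
  assert (H : 0 <= 2 * kappa * alpha) by (repeat apply Rmult_le_pos; lra).
  destruct (Rle_lt_or_eq_dec _ _ H) as [H'|<-]; [|lra].
  apply Rlt_le, exp_increasing, H'. }
assert (Hstep : forall B, 0 <= B ->
  (forall alpha, 0 <= alpha <= 1 ->
     norm (minus (z' alpha) (z alpha)) <= B * exp (2 * kappa * alpha)) ->
  forall alpha, 0 <= alpha <= 1 -> norm (minus (z' alpha) (z alpha))
     <= (n + B / 2) * exp (2 * kappa * alpha)).
{ intros B HB Hall alpha Ha.
  assert (HI : is_RInt (fun beta => kappa * B * exp (2 * kappa * beta)) 0 alpha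
    (minus (B / 2 * exp (2 * kappa * alpha)) (B / 2 * exp (2 * kappa * 0)))).
  { apply (is_RInt_derive (fun beta => B / 2 * exp (2 * kappa * beta))).
    - intros x _; auto_derive; [exact Logic.I|field].
    - intros x _; apply (ex_derive_continuous (V := R_NormedModule)).
      auto_derive; exact Logic.I. }
  assert (H := Hint _ alpha _ Ha (fun beta Hb => ltac:(
    rewrite Rmult_assoc; apply Rmult_le_compat_l; [exact Hk|apply Hall; lra]))
    HI).
  change (minus (B / 2 * exp (2 * kappa * alpha)) (B / 2 * exp (2 * kappa * 0)))
    with (B / 2 * exp (2 * kappa * alpha) - B / 2 * exp (2 * kappa * 0)) in H.
  rewrite Rmult_0_r, exp_0 in H.
  assert (He := Hexp1 alpha (proj1 Ha)); nra. }
assert (Hiter : forall m alpha, 0 <= alpha <= 1 ->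
  norm (minus (z' alpha) (z alpha))
    <= (2 * n + (n + 2 * M) / 2 ^ m) * exp (2 * kappa * alpha)).
{ induction m as [|m IH]; intros alpha Ha.
  - assert (E := norm_split3 (minus (z' alpha) (z alpha))
      (minus b a) (minus (z' alpha) b) (opp (minus (z alpha) a)) ltac:(vec)).
    rewrite norm_opp_eq in E; fold n in E.
    assert (E1 := solves_bound F M a z HM Hz alpha Ha).
    assert (E2 := solves_bound F M b z' HM Hz' alpha Ha).
    assert (He := Hexp1 alpha (proj1 Ha)); simpl; unfold Rdiv.
    rewrite Rinv_1; nra.
  - assert (Hpm : 0 < 2 ^ m) by (apply pow_lt; lra).
    replace (2 * n + (n + 2 * M) / 2 ^ S m)
      with (n + (2 * n + (n + 2 * M) / 2 ^ m) / 2) by (simpl; field; lra).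
    apply Hstep; try assumption.
    assert (0 <= (n + 2 * M) / 2 ^ m)
      by (apply Rmult_le_pos; [lra|apply Rlt_le, Rinv_0_lt_compat, Hpm]).
    lra. }
assert (Hlim : forall alpha, 0 <= alpha <= 1 ->
  norm (minus (z' alpha) (z alpha)) <= 2 * n * exp (2 * kappa)).
{ intros alpha Ha; apply Rle_trans with (2 * n * exp (2 * kappa * alpha)).
  - set (x := exp (2 * kappa * alpha)).
    assert (Hx : 1 <= x) by (apply Hexp1; lra).
    apply Rle_plus_epsilon; intros eps Heps.
    destruct (Pow_x_infinity 2 ltac:(rewrite Rabs_pos_eq; lra)
      ((n + 2 * M) * x / eps)) as [m Hm].
    specialize (Hm m (le_n m)); specialize (Hiter m alpha Ha); fold x in Hiter.
    assert (Hpm : 0 < 2 ^ m) by (apply pow_lt; lra).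
    rewrite Rabs_pos_eq in Hm by lra; apply Rge_le in Hm.
    assert ((n + 2 * M) / 2 ^ m * x <= eps); [|lra].
    apply Rmult_le_reg_r with (2 ^ m / eps);
      [apply Rdiv_lt_0_compat; assumption|].
    replace ((n + 2 * M) / 2 ^ m * x * (2 ^ m / eps))
      with ((n + 2 * M) * x / eps) by (field; lra).
    replace (eps * (2 ^ m / eps)) with (2 ^ m) by (field; lra); exact Hm.
  - apply Rmult_le_compat_l; [lra|].
    destruct (Req_dec (2 * kappa * alpha) (2 * kappa)) as [->|Hne]; [lra|].
    apply Rlt_le, exp_increasing; nra. }
assert (H := Hint (fun _ => kappa * (2 * n * exp (2 * kappa))) 1 _ ltac:(lra)
  (fun beta Hb => Rmult_le_compat_l _ _ _ Hk (Hlim beta Hb))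
  (is_RInt_const 0 1 _)).
change (scal (1 - 0) (kappa * (2 * n * exp (2 * kappa))))
  with ((1 - 0) * (kappa * (2 * n * exp (2 * kappa)))) in H.
lra.
Qed.

(** Over the unit time the solution is known up to third order from
    [F1 (z beta) = F1 a + beta dF1(a) (F1 a) + O(eps ^ 3)]. *)
Lemma solves_expansion (gamma K E eps : R) (F1 F2 : V -> V) (dF1 : V -> V -> V)
    a z :
  0 < gamma <= 1 -> 1 <= K -> 0 <= eps <= E ->
  C2_holder gamma (K * eps) F1 dF1 -> C1_holder gamma (K * (eps * eps)) F2 ->
  solves (fun x => plus (F1 x) (scal (1 / 2) (F2 x))) a z ->
  norm (minus (z 1) (plus a (plus (F1 a)
      (scal (1 / 2) (plus (dF1 a (F1 a)) (F2 a))))))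
    <= 4 * (K * (1 + E) * (K * (1 + E)) * (K * (1 + E))) * (eps * eps * eps).
Proof.
intros Hgamma HK Heps HF1 HF2 Hz.
set (K' := K * (1 + E)).
assert (HKK : K <= K') by (unfold K'; nra).
assert (Hee : 0 <= eps * eps) by nra.
assert (HKe : 0 <= K * eps <= K' * eps) by nra.
assert (HKee : K * eps + K * (eps * eps) <= K' * eps).
{ assert (K * eps * eps <= K * eps * E) by (apply Rmult_le_compat_l; nra).
  unfold K'; lra. }
assert (Hhalf : forall x : V, norm (scal (1 / 2) x) <= norm x).
{ intros x; assert (H := norm_scal_le (1 / 2) x).
  rewrite Rabs_pos_eq in H by lra; assert (H' := norm_ge_0 x); lra. }
assert (HFb : forall x, norm (plus (F1 x) (scal (1 / 2) (F2 x))) <= K' * eps).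
{ intros x; eapply Rle_trans; [apply norm_plus_le|].
  assert (H1 := C2_bound _ _ _ _ HF1 x); assert (H2 := C1_bound _ _ _ HF2 x).
  assert (H3 := Hhalf (F2 x)); lra. }
assert (Hh : forall beta, 0 <= beta <= 1 -> norm (minus (z beta) a) <= K' * eps)
  by (intros beta Hb; apply (solves_bound _ _ a z HFb Hz beta Hb)).
assert (HP : 0 <= K' * K' * (eps * eps)) by (repeat apply Rmult_le_pos; lra).
assert (HKK2 : K * K' <= K' * K') by nra.
assert (HK2 : K <= K' * K') by nra.
assert (Hh1 : forall beta, 0 <= beta <= 1 ->
  norm (minus (minus (z beta) a) (scal beta (F1 a)))
    <= 2 * (K' * K' * (eps * eps))).
{ intros beta Hb.
  assert (HI := is_RInt_minus _ _ _ _ _ _ (Hz beta Hb)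
    (is_RInt_const 0 beta (F1 a))).
  assert (HI' : is_RInt (fun x => minus (plus (F1 (z x)) (scal (1 / 2) (F2 (z x))))
      (F1 a)) 0 beta (minus (minus (z beta) a) (scal (beta - 0) (F1 a))))
    by exact HI.
  rewrite Rminus_0_r in HI'.
  apply (is_RInt_bound _ beta _ _ Hb) with (3 := HI'); [lra|].
  intros x Hx.
  assert (S := norm_split2
    (minus (plus (F1 (z x)) (scal (1 / 2) (F2 (z x)))) (F1 a))
    (minus (F1 (z x)) (F1 a)) (scal (1 / 2) (F2 (z x))) ltac:(vec)).
  assert (S1 := C2_lip _ _ _ _ HF1 a (z x)); assert (S2 := Hh x ltac:(lra)).
  assert (S3 := Hhalf (F2 (z x))); assert (S4 := C1_bound _ _ _ HF2 (z x)).
  assert (I1 : K * eps * norm (minus (z x) a) <= K * eps * (K' * eps))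
    by (apply Rmult_le_compat_l; lra).
  assert (I2 := Rmult_le_compat_r _ _ _ Hee HKK2).
  assert (I3 := Rmult_le_compat_r _ _ _ Hee HK2).
  lra. }
set (w := plus (F1 a) (scal (1 / 2) (F2 a)) : V).
set (d := dF1 a (F1 a)).
assert (HI : is_RInt (fun beta => minus
      (plus (F1 (z beta)) (scal (1 / 2) (F2 (z beta)))) (plus w (scal beta d)))
    0 1 (minus (minus (z 1) a) (plus w (scal (1 / 2) d)))).
{ assert (Hlin : is_RInt (fun beta => plus w (scal beta d)) 0 1
            (minus (plus (scal 1 w) (scal (1 / 2 * 1 * 1) d))
                   (plus (scal 0 w) (scal (1 / 2 * 0 * 0) d)))).
  { apply (is_RInt_derive
      (fun beta => plus (scal beta w) (scal (1 / 2 * beta * beta) d))).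
    - intros x _.
      apply (is_derive_plus (K := R_AbsRing) (V := V) (fun beta => scal beta w)
        (fun beta => scal (1 / 2 * beta * beta) d)); [apply is_derive_scal_id|].
      apply (is_derive_scal_l (K := R_AbsRing) (V := V)
        (fun beta => 1 / 2 * beta * beta) x x d).
      auto_derive; [exact Logic.I|field].
    - intros x _.
      apply (ex_derive_continuous (K := R_AbsRing) (V := V)).
      exists (plus zero d).
      apply (is_derive_plus (K := R_AbsRing) (V := V) (fun _ => w)
        (fun beta => scal beta d) x zero d (is_derive_const w x)
        (is_derive_scal_id d x)). }
  assert (H := is_RInt_minus _ _ _ _ _ _ (Hz 1 ltac:(lra)) Hlin).
  replace (minus (minus (z 1) a) (plus w (scal (1 / 2) d)))
    with (minus (minus (z 1) a) (minus (plus (scal 1 w) (scal (1 / 2 * 1 * 1) d))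
                   (plus (scal 0 w) (scal (1 / 2 * 0 * 0) d)))) by vec.
  exact H. }
replace (minus (z 1) (plus a (plus (F1 a) (scal (1 / 2) (plus d (F2 a))))))
  with (minus (minus (z 1) a) (plus w (scal (1 / 2) d))) by (unfold w; vec).
assert (Heee : 0 <= eps * eps * eps) by (apply Rmult_le_pos; lra).
assert (HK3 : K * (K' * K') <= K' * K' * K')
  by (rewrite (Rmult_assoc K'); apply Rmult_le_compat_r; nra).
assert (HK3' : K * K' <= K' * K' * K').
{ apply Rle_trans with (K' * K' * 1); [lra|].
  apply Rmult_le_compat_l; [nra|lra]. }
apply (is_RInt_bound _ 1 _ _ ltac:(lra)) with (3 := HI).
{ repeat apply Rmult_le_pos; lra. }
intros x Hx.
set (h := minus (z x) a : V).
assert (Hz' : z x = plus a h) by (unfold h; vec).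
assert (S := norm_split3
  (minus (plus (F1 (z x)) (scal (1 / 2) (F2 (z x)))) (plus w (scal x d)))
  (minus (minus (F1 (plus a h)) (F1 a)) (dF1 a h))
  (dF1 a (minus h (scal x (F1 a))))
  (scal (1 / 2) (minus (F2 (z x)) (F2 a)))
  ltac:(rewrite (C2_diff_minus _ _ _ _ HF1), (C2_diff_scal _ _ _ _ HF1),
          <- Hz'; unfold w, d; vec)).
assert (S1 := C2_taylor _ _ _ _ HF1 a h).
assert (S2 := C2_diff_bound _ _ _ _ HF1 a (minus h (scal x (F1 a)))).
assert (S3 := Hhalf (minus (F2 (z x)) (F2 a))).
assert (S4 := C1_lip _ _ _ HF2 a (z x)); fold h in S4.
assert (S5 := Hh x Hx); fold h in S5.
assert (S6 := Hh1 x Hx); fold h in S6.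
assert (Hh0 := norm_ge_0 h).
assert (J1 : K * eps * norm h * norm h <= K * eps * (K' * eps) * (K' * eps)).
{ rewrite (Rmult_assoc (K * eps)), (Rmult_assoc (K * eps) (K' * eps)).
  apply Rmult_le_compat_l; [lra|apply Rmult_le_compat; lra]. }
assert (J2 : K * eps * norm (minus h (scal x (F1 a)))
               <= K * eps * (2 * (K' * K' * (eps * eps))))
  by (apply Rmult_le_compat_l; lra).
assert (J3 : K * (eps * eps) * norm h <= K * (eps * eps) * (K' * eps))
  by (apply Rmult_le_compat_l; [nra|lra]).
assert (J4 := Rmult_le_compat_r _ _ _ Heee HK3).
assert (J5 := Rmult_le_compat_r _ _ _ Heee HK3').
lra.
Qed.

End Autonomous.

(** * The two schemes driven by a rough path *)

Section Sums.

Context {V : CompleteNormedModule R_AbsRing}.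
Implicit Types u v : nat -> V.

Definition vsum (l : nat) u : V := sum_idx l u.

Lemma vsum_0 u : vsum 0 u = zero.
Proof. apply (sum_n_m_zero u 1 0); lia. Qed.

Lemma vsum_S (l : nat) u : vsum (S l) u = plus (vsum l u) (u (S l)).
Proof. apply (sum_n_Sm u 1 l); lia. Qed.

Lemma vsum_ext (l : nat) u v :
  (forall i, in_idx l i -> u i = v i) -> vsum l u = vsum l v.
Proof. intros H; apply (sum_n_m_ext_loc u v); intros i Hi; apply H, Hi. Qed.

Lemma vsum_plus (l : nat) u v :
  vsum l (fun i => plus (u i) (v i)) = plus (vsum l u) (vsum l v).
Proof.
induction l as [|l IH]; [rewrite !vsum_0|rewrite !vsum_S, IH]; vec.
Qed.

Lemma vsum_scal (l : nat) (r : R) u :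
  vsum l (fun i => scal r (u i)) = scal r (vsum l u).
Proof.
induction l as [|l IH]; [rewrite !vsum_0|rewrite !vsum_S, IH]; vec.
Qed.

Lemma vsum_swap (l m : nat) (u : nat -> nat -> V) :
  vsum l (fun i => vsum m (fun j => u i j))
  = vsum m (fun j => vsum l (fun i => u i j)).
Proof.
induction l as [|l IH].
- rewrite vsum_0; induction m as [|m IH]; [rewrite vsum_0; reflexivity|].
  rewrite vsum_S, <- IH, vsum_0; vec.
- rewrite vsum_S, IH.
  rewrite (vsum_ext m (fun j => vsum (S l) (fun i => u i j))
    (fun j => plus (vsum l (fun i => u i j)) (u (S l) j)))
    by (intros; apply vsum_S).
  symmetry; apply vsum_plus.
Qed.

Lemma C2_diff_sum (gamma K : R) (f : V -> V) (df : V -> V -> V) (l : nat) a u :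
  C2_holder gamma K f df ->
  df a (vsum l u) = vsum l (fun i => df a (u i)).
Proof.
intros H; induction l as [|l IH].
- rewrite !vsum_0; replace (zero : V) with (scal 0 (zero : V)) at 1 by vec.
  rewrite (C2_diff_scal _ _ _ _ H); vec.
- rewrite !vsum_S, <- IH.
  replace (plus (vsum l u) (u (S l)))
    with (minus (vsum l u) (scal (-1) (u (S l)))) by vec.
  rewrite (C2_diff_minus _ _ _ _ H), (C2_diff_scal _ _ _ _ H); vec.
Qed.

End Sums.

Section Driven.

Context {V : CompleteNormedModule R_AbsRing}.
Context (T p gamma : R) (l : nat) (omega : R -> R -> R).
Context (x1 : nat -> R -> R -> R) (x2 : nat -> nat -> R -> R -> R).
Context (f : nat -> V -> V).
Context (Hp : 2 <= p < 3) (Hgamma : 0 < gamma <= 1).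
Context (Hom : control T omega).
Context (Hx : weak_geometric_rough_path l p T omega x1 x2).
Context (Hf : forall i, in_idx l i -> Cb_2plus gamma (f i)).
Implicit Types a b : V.

Notation scale := (scale p omega).
Notation error := (error p gamma omega).

Definition diff_drift1 (s t : R) a (v : V) : V :=
  vsum l (fun i => scal (x1 i s t) (diff (f i) a v)).

Definition second_order (s t : R) a : V :=
  vsum l (fun i => vsum l (fun j =>
    scal (x2 i j s t) (vf (f i) (f j) a))).

Lemma vector_fields_C2_holder : exists K, 0 <= K /\
  forall i, in_idx l i -> C2_holder gamma K (f i) (diff (f i)).
Proof.
assert (H : forall m, (m <= l)%nat -> exists K, 0 <= K /\
  forall i, in_idx m i -> C2_holder gamma K (f i) (diff (f i))).
{ induction m as [|m IH]; intros Hm.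
  - exists 0; split; [lra|intros i [H1 H2]; lia].
  - destruct (IH ltac:(lia)) as [K [HK HKi]].
    destruct (Cb_2plus_C2_holder gamma Hgamma (f (S m))
      (Hf (S m) ltac:(unfold in_idx; lia))) as [K' [HK' HKm]].
    exists (K + K'); split; [lra|intros i Hi].
    destruct (Nat.eq_dec i (S m)) as [->|Hne].
    + apply C2_holder_weaken with K'; [lra|exact HKm].
    + apply C2_holder_weaken with K; [lra|].
      apply HKi; unfold in_idx in *; lia. }
apply (H l (le_n l)).
Qed.

Lemma increments_bound : exists C, 0 <= C /\
  (forall i s t, in_idx l i -> 0 <= s -> s <= t -> t <= T ->
     Rabs (x1 i s t) <= C * scale s t) /\
  (forall i j s t, in_idx l i -> in_idx l j -> 0 <= s -> s <= t -> t <= T ->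
     Rabs (x2 i j s t) <= C * (scale s t * scale s t)).
Proof.
destruct (rough_bound _ _ _ _ _ _ Hx) as [C [H1 H2]].
exists (Rmax C 0); split; [apply Rmax_r|split].
- intros i s t Hi Hs Hst Ht; eapply Rle_trans; [apply H1; assumption|].
  apply Rmult_le_compat_r; [apply rpow_ge0|apply Rmax_l].
- intros i j s t Hi Hj Hs Hst Ht; eapply Rle_trans; [apply H2; assumption|].
  rewrite scale_sqr by exact Hp.
  apply Rmult_le_compat_r; [apply rpow_ge0|apply Rmax_l].
Qed.

Lemma drift_regularity : exists K, 1 <= K /\
  forall s t, 0 <= s -> s <= t -> t <= T ->
    C2_holder gamma (K * scale s t) (drift1 l f x1 s t) (diff_drift1 s t) /\
    C1_holder gamma (K * (scale s t * scale s t)) (second_order s t) /\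
    C1_holder gamma (K * (scale s t * scale s t)) (drift2 l f x2 s t).
Proof.
destruct vector_fields_C2_holder as [Kf [HKf HfK]].
destruct increments_bound as [C [HC [HC1 HC2]]].
assert (Hl := pos_INR l).
set (K1 := INR l * (C * Kf)).
set (K2 := INR l * (INR l * (C * (10 * (Kf * Kf))))).
assert (HK1 : 0 <= K1) by (unfold K1; repeat apply Rmult_le_pos; lra).
assert (HKK : 0 <= Kf * Kf) by nra.
assert (HK2 : 0 <= K2) by (unfold K2; repeat apply Rmult_le_pos; lra).
assert (Hdouble : forall (e : R) (c : nat -> nat -> R) (g : nat -> nat -> V -> V),
  0 <= e ->
  (forall i j, in_idx l i -> in_idx l j -> Rabs (c i j) <= C * e) ->
  (forall i j, in_idx l i -> in_idx l j ->
     C1_holder gamma (10 * (Kf * Kf)) (g i j)) ->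
  C1_holder gamma ((1 + K1 + K2) * e) (fun a =>
    vsum l (fun i => vsum l (fun j => scal (c i j) (g i j a))))).
{ intros e c g He Hc Hg.
  apply C1_holder_weaken with (K2 * e); [nra|].
  replace (K2 * e) with (INR l * (INR l * (C * e * (10 * (Kf * Kf)))))
    by (unfold K2; ring).
  apply (C1_holder_sum gamma _ l
    (fun i a => vsum l (fun j => scal (c i j) (g i j a)))); intros i Hi.
  apply (C1_holder_sum gamma _ l (fun j a => scal (c i j) (g i j a))).
  intros j Hj; eapply C1_holder_weaken; [|apply C1_holder_scal, Hg; assumption].
  apply Rmult_le_compat_r; [nra|auto]. }
exists (1 + K1 + K2); split; [lra|intros s t Hs Hst Ht].
assert (He : 0 <= scale s t) by apply rpow_ge0.
split; [|split].
- apply C2_holder_weaken with (INR l * (C * scale s t * Kf)).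
  + assert (0 <= K2 * scale s t) by (apply Rmult_le_pos; lra).
    unfold K1; lra.
  + apply (C2_holder_sum gamma _ l (fun i a => scal (x1 i s t) (f i a))
      (fun i a v => scal (x1 i s t) (diff (f i) a v))); intros i Hi.
    eapply C2_holder_weaken; [|apply C2_holder_scal, HfK, Hi].
    apply Rmult_le_compat_r; auto.
- apply (Hdouble _ (fun i j => x2 i j s t) (fun i j => vf (f i) (f j)));
    [nra|intros; apply HC2; assumption|intros i j Hi Hj].
  apply C1_holder_weaken with (5 * (Kf * Kf)); [lra|].
  apply (C1_holder_vf gamma Hgamma Kf (f i) (f j) _ _ (HfK i Hi) (HfK j Hj)).
- apply (Hdouble _ (fun i j => x2 i j s t) (fun i j => lie (f i) (f j)));
    [nra|intros; apply HC2; assumption|intros i j Hi Hj].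
  apply C1_holder_lie; auto.
Qed.

(** The cross term [x^i_(r,s) x^j_(s,t)] of Chen's relation for the second level
    is carried by the derivative of the drift over [s, t] along the drift over
    [r, s]. *)
Lemma davie_chen (r s t : R) a : 0 <= r -> r <= s -> s <= t -> t <= T ->
  davie l f x1 x2 t r a
  = step (fun b => plus (drift1 l f x1 r s b) (drift1 l f x1 s t b))
      (fun b => plus (plus (second_order r s b) (second_order s t b))
                     (diff_drift1 s t b (drift1 l f x1 r s b))) a.
Proof.
intros Hr Hrs Hst Ht; destruct vector_fields_C2_holder as [Kf [_ HfK]].
unfold davie, step; f_equal.
assert (E1 : vsum l (fun i => scal (x1 i r t) (f i a))
  = plus (drift1 l f x1 r s a) (drift1 l f x1 s t a)).
{ etransitivity; [|apply vsum_plus]; apply vsum_ext; intros i Hi.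
  rewrite (rough_chen1 _ _ _ _ _ _ Hx i r s t) by assumption; vec. }
assert (E2 : diff_drift1 s t a (drift1 l f x1 r s a)
  = vsum l (fun i => vsum l (fun j =>
      scal (x1 i r s * x1 j s t) (vf (f i) (f j) a)))).
{ rewrite vsum_swap; unfold diff_drift1; apply vsum_ext; intros j Hj.
  change (drift1 l f x1 r s a) with (vsum l (fun i => scal (x1 i r s) (f i a))).
  rewrite (C2_diff_sum gamma Kf (f j) (diff (f j)) l a _ (HfK j Hj)).
  rewrite <- vsum_scal; apply vsum_ext; intros i Hi.
  rewrite (C2_diff_scal _ _ _ _ (HfK j Hj)); unfold vf; vec. }
assert (E3 : vsum l (fun i => vsum l (fun j =>
      scal (x2 i j r t) (vf (f i) (f j) a)))
  = plus (plus (second_order r s a) (second_order s t a))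
      (diff_drift1 s t a (drift1 l f x1 r s a))).
{ rewrite E2; unfold second_order; rewrite <- !vsum_plus.
  apply vsum_ext; intros i Hi; rewrite <- !vsum_plus.
  apply vsum_ext; intros j Hj.
  rewrite (rough_chen2 _ _ _ _ _ _ Hx i j r s t) by assumption; vec. }
exact (f_equal2 plus E1 E3).
Qed.

(** On the field [vf (f i) (f j)], the derivative of the first drift along
    itself has the coefficient [x^i x^j = x^ij + x^ji], and the bracket has
    [x^ij - x^ji]. *)
Lemma log_drift_second_order (s t : R) a : 0 <= s -> s <= t -> t <= T ->
  scal (1 / 2) (plus (diff_drift1 s t a (drift1 l f x1 s t a))
                     (drift2 l f x2 s t a)) = second_order s t a.
Proof.
intros Hs Hst Ht; destruct vector_fields_C2_holder as [Kf [_ HfK]].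
assert (E1 : diff_drift1 s t a (drift1 l f x1 s t a)
  = vsum l (fun i => vsum l (fun j =>
      scal (x1 i s t * x1 j s t) (vf (f i) (f j) a)))).
{ rewrite vsum_swap; unfold diff_drift1; apply vsum_ext; intros j Hj.
  change (drift1 l f x1 s t a) with (vsum l (fun i => scal (x1 i s t) (f i a))).
  rewrite (C2_diff_sum gamma Kf (f j) (diff (f j)) l a _ (HfK j Hj)).
  rewrite <- vsum_scal; apply vsum_ext; intros i Hi.
  rewrite (C2_diff_scal _ _ _ _ (HfK j Hj)); unfold vf; vec. }
assert (E2 : drift2 l f x2 s t a
  = minus (second_order s t a) (vsum l (fun i => vsum l (fun j =>
      scal (x2 j i s t) (vf (f i) (f j) a))))).
{ rewrite vsum_swap.
  match goal with |- _ = minus ?u ?v =>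
    replace (minus u v) with (plus u (scal (-1) v)) by vec end.
  rewrite <- vsum_scal; unfold second_order.
  change (drift2 l f x2 s t a) with (vsum l (fun i => vsum l (fun j =>
    scal (x2 i j s t) (lie (f i) (f j) a)))).
  rewrite <- vsum_plus; apply vsum_ext; intros i Hi.
  rewrite <- vsum_scal, <- vsum_plus; apply vsum_ext; intros j Hj.
  unfold lie; vec. }
assert (E3 : plus (second_order s t a) (vsum l (fun i => vsum l (fun j =>
      scal (x2 j i s t) (vf (f i) (f j) a))))
  = diff_drift1 s t a (drift1 l f x1 s t a)).
{ rewrite E1; unfold second_order; rewrite <- vsum_plus.
  apply vsum_ext; intros i Hi; rewrite <- vsum_plus.
  apply vsum_ext; intros j Hj.
  rewrite <- (rough_geometric _ _ _ _ _ _ Hx i j s t) by assumption; vec. }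
rewrite <- E3, E2; vec.
Qed.


Lemma scale_le (s t : R) : 0 <= s -> s <= t -> t <= T ->
  0 <= scale s t <= scale 0 T.
Proof.
intros Hs Hst Ht; split; [apply scale_ge0|].
apply (scale_mono T p omega Hp Hom); lra.
Qed.

Lemma davie_stable_scheme : exists K, 1 <= K /\
  stable_scheme T p gamma omega K (davie l f x1 x2).
Proof.
destruct drift_regularity as [K [HK Hreg]].
set (E := scale 0 T); assert (HE : 0 <= E) by apply scale_ge0.
set (K' := K * (1 + E)); assert (HK' : 1 <= K') by (unfold K'; nra).
set (K4 := 8 * (K' * K' * K' * K')).
assert (HK4 : 2 * K' <= K4).
{ assert (1 <= K' * K') by nra; assert (1 <= K' * K' * K') by nra.
  unfold K4; nra. }
exists K4; split; [lra|].
split.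
- intros s t a Hs Hst Ht; destruct (Hreg s t Hs Hst Ht) as [HA [HB _]].
  destruct (scale_le s t Hs Hst Ht) as [H0 H1].
  replace (increment (davie l f x1 x2 t s) a)
    with (plus (drift1 l f x1 s t a) (second_order s t a)).
  2: { change (davie l f x1 x2 t s a)
         with (plus a (plus (drift1 l f x1 s t a) (second_order s t a))).
       unfold increment.
       change (plus (drift1 l f x1 s t a) (second_order s t a) =
         minus (plus a (plus (drift1 l f x1 s t a) (second_order s t a))) a).
       vec. }
  eapply Rle_trans; [apply (step_increment_bound gamma K E _ HK (conj H0 H1)
    _ _ _ a HA HB)|].
  apply Rmult_le_compat_r; [exact H0|fold K'; lra].
- intros s t Hs Hst Ht a b; destruct (Hreg s t Hs Hst Ht) as [HA [HB _]].
  destruct (scale_le s t Hs Hst Ht) as [H0 H1].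
  replace (minus (increment (davie l f x1 x2 t s) b)
                 (increment (davie l f x1 x2 t s) a))
    with (minus (plus (drift1 l f x1 s t b) (second_order s t b))
                (plus (drift1 l f x1 s t a) (second_order s t a))).
  2: { change (davie l f x1 x2 t s)
         with (step (drift1 l f x1 s t) (second_order s t)).
       unfold increment, step; vec. }
  eapply Rle_trans; [apply (step_increment_lip gamma K E _ HK (conj H0 H1)
    _ _ _ a b HA HB)|].
  apply Rmult_le_compat_r; [apply norm_ge_0|].
  apply Rmult_le_compat_r; [exact H0|fold K'; lra].
- intros s t a b u v Hs Hst Ht; destruct (Hreg s t Hs Hst Ht) as [HA [HB _]].
  destruct (scale_le s t Hs Hst Ht) as [H0 H1].
  change (davie l f x1 x2 t s)
    with (step (drift1 l f x1 s t) (second_order s t)).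
  eapply Rle_trans; [apply (step_increment_four gamma Hgamma K E _ HK
    (conj H0 H1) _ _ _ a b u v HA HB)|].
  fold K'; assert (Hr := rpow_ge0 (norm u) gamma); assert (Hu := norm_ge_0 u).
  assert (Hk : K' * scale s t <= K4 * scale s t)
    by (apply Rmult_le_compat_r; lra).
  assert (Hk2 : 2 * K' * scale s t <= K4 * scale s t)
    by (apply Rmult_le_compat_r; lra).
  apply Rplus_le_compat.
  + apply Rmult_le_compat_r; [apply norm_ge_0|exact Hk].
  + apply Rmult_le_compat_r; [nra|].
    apply Rmult_le_compat_r; [apply norm_ge_0|exact Hk2].
- intros r s t Hr Hrs Hst Ht.
  destruct (scale_le r t Hr ltac:(lra) Ht) as [H0 H1].
  assert (Hsub : forall r' s', r <= r' -> r' <= s' -> s' <= t ->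
    C2_holder gamma (K * scale r t) (drift1 l f x1 r' s') (diff_drift1 r' s') /\
    C1_holder gamma (K * (scale r t * scale r t)) (second_order r' s')).
  { intros r' s' Hr' Hrs' Hs'.
    destruct (Hreg r' s') as [HA [HB _]]; [lra|lra|lra|].
    assert (Hs0 : 0 <= scale r' s') by apply scale_ge0.
    assert (Hsc : scale r' s' <= scale r t)
      by (apply (scale_mono T p omega Hp Hom); lra).
    split; [apply C2_holder_weaken with (2 := HA)
           |apply C1_holder_weaken with (2 := HB)];
      apply Rmult_le_compat_l; nra. }
  destruct (Hsub r s) as [HA1 HB1]; [lra|lra|lra|].
  destruct (Hsub s t) as [HA2 HB2]; [lra|lra|lra|].
  destruct (step_comp_defect gamma Hgamma K E _ HK (conj H0 H1)
    _ _ _ _ _ _ HA1 HA2 HB1 HB2) as [D1 D2].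
  fold K' K4 in D1, D2.
  rewrite <- (error_scale p gamma omega Hp r t) in D1, D2.
  split; [intros a|intros a b]; rewrite !(davie_chen r s t) by assumption;
    [apply D1|apply D2].
Qed.

Lemma log_ode_solves (s t : R) a z : log_ode_solution l f x1 x2 s t a z ->
  solves (fun b => plus (drift1 l f x1 s t b)
                        (scal (1 / 2) (drift2 l f x2 s t b))) a z.
Proof.
intros H alpha Ha; destruct (H alpha Ha) as [H1 [H2 E]].
assert (HI := is_RInt_plus _ _ _ _ _ _ (RInt_correct _ _ _ H1)
  (is_RInt_scal _ _ _ (1 / 2) _ (RInt_correct _ _ _ H2))).
replace (minus (z alpha) a) with
  (plus (RInt (fun beta => drift1 l f x1 s t (z beta)) 0 alpha)
        (scal (1 / 2) (RInt (fun beta => drift2 l f x2 s t (z beta)) 0 alpha)));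
  [exact HI|rewrite E; vec].
Qed.

(** Only the value at time [1] of the solutions enters, so that the estimates
    hold for whichever solutions define [chi]. *)
Lemma log_ode_step : exists K, 0 <= K /\
  forall s t, 0 <= s -> s <= t -> t <= T -> forall chi : V -> V,
    (forall a, exists z, log_ode_solution l f x1 x2 s t a z /\ chi a = z 1) ->
    (forall a, norm (minus (chi a) a) <= K * scale s t) /\
    is_lipschitz chi (1 + K * scale s t) /\
    (forall a, norm (minus (chi a) (davie l f x1 x2 t s a)) <= K * error s t).
Proof.
destruct drift_regularity as [K [HK Hreg]].
set (E := scale 0 T); assert (HE : 0 <= E) by apply scale_ge0.
set (K' := K * (1 + E)); assert (HK' : 1 <= K') by (unfold K'; nra).
set (Kl := 2 * K' * exp (2 * (K' * E))).
assert (HKl : 2 * K' <= Kl).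
{ assert (1 <= exp (2 * (K' * E))).
  { assert (H : 0 <= 2 * (K' * E)) by nra.
    destruct (Rle_lt_or_eq_dec _ _ H) as [H'|H']; [|rewrite <- H', exp_0; lra].
    rewrite <- exp_0; apply Rlt_le, exp_increasing, H'. }
  unfold Kl; nra. }
set (Ke := 4 * (K' * K' * K') * K').
assert (HKe : 0 <= Ke) by (unfold Ke; repeat apply Rmult_le_pos; lra).
exists (Kl + Ke); split; [lra|].
intros s t Hs Hst Ht chi Hchi.
destruct (Hreg s t Hs Hst Ht) as [HA [_ HB]].
destruct (scale_le s t Hs Hst Ht) as [H0 H1]; fold E in H1.
set (F := fun b => plus (drift1 l f x1 s t b)
                        (scal (1 / 2) (drift2 l f x2 s t b)) : V).
assert (Hsol : forall a, exists z, solves F a z /\ chi a = z 1).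
{ intros a; destruct (Hchi a) as [z [Hz Hc]]; exists z; split; [|exact Hc].
  apply log_ode_solves, Hz. }
assert (Hhalf : forall x : V, norm (scal (1 / 2) x) <= norm x).
{ intros x; assert (H := norm_scal_le (1 / 2) x).
  rewrite Rabs_pos_eq in H by lra; assert (H' := norm_ge_0 x); lra. }
assert (HKK : K * scale s t + K * (scale s t * scale s t) <= K' * scale s t).
{ assert (K * scale s t * scale s t <= K * scale s t * E)
    by (apply Rmult_le_compat_l; nra).
  unfold K'; lra. }
assert (HFb : forall x, norm (F x) <= K' * scale s t).
{ intros x; eapply Rle_trans; [apply norm_plus_le|].
  assert (B1 := C2_bound _ _ _ _ HA x); assert (B2 := C1_bound _ _ _ HB x).
  assert (B3 := Hhalf (drift2 l f x2 s t x)); lra. }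
assert (HFl : forall x x', norm (minus (F x') (F x))
                <= K' * scale s t * norm (minus x' x)).
{ intros x x'.
  assert (S := norm_split2 (minus (F x') (F x))
    (minus (drift1 l f x1 s t x') (drift1 l f x1 s t x))
    (scal (1 / 2) (minus (drift2 l f x2 s t x') (drift2 l f x2 s t x)))
    ltac:(unfold F; vec)).
  assert (B1 := C2_lip _ _ _ _ HA x x'); assert (B2 := C1_lip _ _ _ HB x x').
  assert (B3 := Hhalf (minus (drift2 l f x2 s t x') (drift2 l f x2 s t x))).
  assert (B4 := Rmult_le_compat_r _ _ _ (norm_ge_0 (minus x' x)) HKK); lra. }
assert (Hks : 0 <= K' * scale s t) by nra.
split; [|split].
- intros a; destruct (Hsol a) as [z [Hz ->]].
  eapply Rle_trans; [apply (solves_bound F _ a z HFb Hz); lra|].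
  apply Rmult_le_compat_r; lra.
- intros a b; destruct (Hsol a) as [z [Hz ->]]; destruct (Hsol b) as [z' [Hz' ->]].
  eapply Rle_trans;
    [apply (solves_lipschitz F _ _ a b z z' Hks HFl HFb Hz Hz')|].
  apply Rmult_le_compat_r; [apply norm_ge_0|].
  assert (exp (2 * (K' * scale s t)) <= exp (2 * (K' * E))).
  { assert (H : 2 * (K' * scale s t) <= 2 * (K' * E)) by nra.
    destruct (Rle_lt_or_eq_dec _ _ H) as [H'|H']; [|rewrite H'; lra].
    apply Rlt_le, exp_increasing, H'. }
  assert (2 * (K' * scale s t) * exp (2 * (K' * scale s t))
            <= 2 * (K' * scale s t) * exp (2 * (K' * E)))
    by (apply Rmult_le_compat_l; lra).
  assert (0 <= Ke * scale s t) by nra.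
  unfold Kl; lra.
- intros a; destruct (Hsol a) as [z [Hz ->]].
  assert (H := solves_expansion gamma K E (scale s t) _ _ _ a z Hgamma HK
    (conj H0 H1) HA HB Hz).
  fold K' in H; rewrite log_drift_second_order in H by assumption.
  change (plus a (plus (drift1 l f x1 s t a) (second_order s t a)))
    with (davie l f x1 x2 t s a) in H.
  eapply Rle_trans; [exact H|].
  assert (H3 := eps3_le gamma Hgamma K E (scale s t) HK (conj H0 H1)).
  fold K' in H3; rewrite <- (error_scale p gamma omega Hp s t) in H3.
  assert (Herr := error_ge0 p gamma omega s t).
  apply Rle_trans with (4 * (K' * K' * K') * (K' * error s t)).
  + apply Rmult_le_compat_l; [repeat apply Rmult_le_pos; lra|exact H3].
  + rewrite <- Rmult_assoc; fold Ke; apply Rmult_le_compat_r; lra.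
Qed.

End Driven.

(** * Schemes close to a stable scheme *)

Section CloseScheme.

Context {V : CompleteNormedModule R_AbsRing}.
Context (T p gamma : R) (omega : R -> R -> R).
Context (HT : 0 < T).
Context (Hp : 2 <= p < 3) (Hgamma : 0 < gamma <= 1) (Hpg : p < 2 + gamma).
Context (Hom : control T omega).
Context (K : R) (phi : R -> R -> V -> V).
Context (HK : 1 <= K) (Hphi : stable_scheme T p gamma omega K phi).
Context (C : R) (chi : R -> R -> V -> V).
Context (HC : 0 <= C).
Implicit Types a b : V.

Notation scale := (scale p omega).
Notation error := (error p gamma omega).
Notation varpi := (fun tau => rpow tau ((2 + gamma) / p)).

Context (Hnear : forall s t a, 0 <= s -> s <= t -> t <= T ->
  norm (minus (chi t s a) a) <= C * scale s t).
Context (Hlip : forall s t, 0 <= s -> s <= t -> t <= T ->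
  is_lipschitz (chi t s) (1 + C * scale s t)).
Context (Hclose : forall s t a, 0 <= s -> s <= t -> t <= T ->
  norm (minus (chi t s a) (phi t s a)) <= C * error s t).

Lemma scale_small (eps : R) : 0 < eps -> exists h, 0 < h /\
  forall s t, 0 <= s -> s <= t -> t <= T -> t - s <= h ->
    scale s t <= eps /\ error s t <= eps /\ rpow (error s t) gamma <= eps.
Proof.
intros Heps; assert (Hth := theta_gt1 p gamma Hp Hpg).
assert (Hp1 : 0 < 1 / p) by (apply Rdiv_lt_0_compat; lra).
destruct (rpow_small (1 / p) eps Hp1 Heps) as [d1 [Hd1 H1]].
destruct (rpow_small ((2 + gamma) / p) eps ltac:(lra) Heps) as [d2 [Hd2 H2]].
destruct (rpow_small ((2 + gamma) / p * gamma) eps ltac:(nra) Heps)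
  as [d3 [Hd3 H3]].
set (d := Rmin d1 (Rmin d2 d3)).
assert (Hd : 0 < d) by (repeat apply Rmin_glb_lt; assumption).
assert (Hdd : d <= d1 /\ d <= d2 /\ d <= d3).
{ assert (M1 := Rmin_l d1 (Rmin d2 d3)); assert (M2 := Rmin_r d1 (Rmin d2 d3)).
  assert (M3 := Rmin_l d2 d3); assert (M4 := Rmin_r d2 d3); unfold d; lra. }
destruct (control_small T omega Hom d Hd) as [h [Hh Hs]].
exists h; split; [exact Hh|intros s t H0 Hst Ht Hts].
specialize (Hs s t H0 Hst Ht Hts); split; [|split].
- apply H1; lra.
- apply H2; lra.
- change (error s t) with (rpow (omega s t) ((2 + gamma) / p)).
  rewrite rpow_comp; apply H3; lra.
Qed.

(** As [chi] is Lipschitz with constants tending to [1], the Hölder term in the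
    definition of an almost flow may be as small as one likes; [eta = varpi] is
    a convenient choice. The modulus [delta] tends to [0] because [omega] does
    on [0, T'] as [T'] tends to [0]. *)
Lemma close_scheme_almost_flow : almost_flow T omega varpi gamma chi.
Proof.
assert (Hth := theta_gt1 p gamma Hp Hpg).
set (delta := fun u => C * scale 0 (Rmin u T) + rpow (error 0 (Rmin u T)) gamma).
assert (Hscale : forall s t T', 0 <= s -> s <= t -> t <= T' -> 0 < T' <= T ->
  scale s t <= scale 0 (Rmin T' T) /\ error s t <= error 0 (Rmin T' T)).
{ intros s t T' Hs Hst Ht HT'; rewrite Rmin_left by lra; split.
  - apply (scale_mono T p omega Hp Hom); lra.
  - apply (error_mono T p gamma omega Hp Hpg Hom); lra. }
split.
{ intros s t a Hs Hst Ht P [eps HP].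
  assert (Hk : 0 < 1 + C * scale s t).
  { assert (H := scale_ge0 p omega s t); nra. }
  assert (He : 0 < eps / (1 + C * scale s t))
    by (apply Rdiv_lt_0_compat; [apply cond_pos|exact Hk]).
  assert (Hn := @norm_factor_gt_0 R_AbsRing V).
  assert (He' : 0 < eps / (1 + C * scale s t) / @norm_factor R_AbsRing V)
    by (apply Rdiv_lt_0_compat; assumption).
  exists (mkposreal _ He'); intros b Hb; apply HP.
  apply (norm_compat1 (chi t s a) (chi t s b) eps).
  change (norm (minus (chi t s b) (chi t s a)) < eps).
  eapply Rle_lt_trans; [apply Hlip; assumption|].
  assert (H : norm (minus b a) < @norm_factor R_AbsRing V *
     (eps / (1 + C * scale s t) / @norm_factor R_AbsRing V))
    by exact (norm_compat2 a b (mkposreal _ He') Hb).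
  replace (@norm_factor R_AbsRing V *
     (eps / (1 + C * scale s t) / @norm_factor R_AbsRing V))
    with (eps / (1 + C * scale s t)) in H by (field; lra).
  apply Rlt_le_trans with ((1 + C * scale s t) * (eps / (1 + C * scale s t)));
    [apply Rmult_lt_compat_l; assumption|right; field; lra]. }
set (M := C + (1 + K * scale 0 T) * C + K + C).
assert (HM : 0 <= M).
{ assert (H := scale_ge0 p omega 0 T).
  assert (H' : 0 <= K * scale 0 T) by (apply Rmult_le_pos; lra).
  assert (H'' : 0 <= (1 + K * scale 0 T) * C) by (apply Rmult_le_pos; lra).
  unfold M; lra. }
exists delta, M, varpi; split; [|split; [exact HM|split; [|split; [|split]]]].
- split; [|split].
  + intros u Hu; assert (H1 := scale_ge0 p omega 0 (Rmin u T)).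
    assert (H2 := rpow_ge0 (error 0 (Rmin u T)) gamma); unfold delta; nra.
  + intros u v Hu Huv; unfold delta.
    assert (Hmin : 0 <= Rmin u T <= Rmin v T /\ Rmin v T <= T).
    { unfold Rmin; repeat destruct (Rle_dec _ _); lra. }
    apply Rplus_le_compat; [apply Rmult_le_compat_l; [exact HC|]|].
    * apply (scale_mono T p omega Hp Hom); lra.
    * apply rpow_le; [lra|].
      apply (error_mono T p gamma omega Hp Hpg Hom); lra.
  + intros P [eps HP]; assert (Heps := cond_pos eps).
    assert (He : 0 < eps / (2 * (C + 1))) by (apply Rdiv_lt_0_compat; lra).
    destruct (scale_small _ He) as [h [Hh Hs]].
    exists (mkposreal h Hh); intros u Hu Hu0; apply HP.
    change (Rabs (u - 0) < h) in Hu; apply Rabs_def2 in Hu.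
    assert (Hmin : 0 <= Rmin u T <= u /\ Rmin u T <= T).
    { unfold Rmin; destruct (Rle_dec u T); lra. }
    destruct (Hs 0 (Rmin u T)) as [H1 [_ H2]]; try lra.
    assert (H3 := scale_ge0 p omega 0 (Rmin u T)).
    assert (H4 := rpow_ge0 (error 0 (Rmin u T)) gamma).
    assert (H5 : (C + 1) * (eps / (2 * (C + 1))) = eps / 2) by (field; lra).
    assert (H6 := Rmult_le_compat_l C _ _ HC H1).
    change (Rabs (delta u - 0) < eps); unfold delta.
    rewrite Rminus_0_r, Rabs_pos_eq; nra.
- intros u _; apply rpow_ge0.
- intros u v Hu Huv _; apply rpow_lt; lra.
- intros u Hu P HP.
  destruct (rpow_continuous ((2 + gamma) / p) u ltac:(lra) (proj1 Hu) P HP)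
    as [d Hd].
  exists d; intros v Hv _; apply Hd, Hv.
- intros T' HT'; split; [|split; [|split; [|split]]].
  + intros s t Hs Hst Ht; destruct (Hscale s t T' Hs Hst Ht HT') as [_ H].
    assert (Hr : rpow (error s t) gamma <= delta T').
    { unfold delta; apply Rle_trans with (rpow (error 0 (Rmin T' T)) gamma);
        [apply rpow_le; lra|].
      assert (H1 := scale_ge0 p omega 0 (Rmin T' T)); nra. }
    change (error s t * rpow (error s t) gamma <= delta T' * error s t).
    rewrite Rmult_comm; apply Rmult_le_compat_r; [apply error_ge0|exact Hr].
  + intros t a Ht HtT; apply norm_minus_eq0.
    assert (H := Hnear t t a Ht (Rle_refl t) ltac:(lra)).
    rewrite (scale_diag T p omega Hom) in H by lra; lra.
  + intros s t a Hs Hst Ht; destruct (Hscale s t T' Hs Hst Ht HT') as [H _].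
    eapply Rle_trans; [apply Hnear; lra|].
    assert (H2 := rpow_ge0 (error 0 (Rmin T' T)) gamma).
    assert (H3 := Rmult_le_compat_l C _ _ HC H); unfold delta; lra.
  + intros s t a b Hs Hst Ht; destruct (Hscale s t T' Hs Hst Ht HT') as [H _].
    assert (H1 := Hlip s t Hs Hst ltac:(lra) a b).
    assert (H2 := rpow_ge0 (error 0 (Rmin T' T)) gamma).
    assert (H3 := Rmult_le_compat_l C _ _ HC H).
    assert (H4 : 1 + C * scale s t <= 1 + delta T') by (unfold delta; lra).
    assert (H5 := Rmult_le_compat_r _ _ _ (norm_ge_0 (minus b a)) H4).
    assert (0 <= varpi (omega s t) * rpow (norm (minus b a)) gamma)
      by (apply Rmult_le_pos; apply rpow_ge0).
    lra.
  + intros r s t a Hr Hrs Hst Ht.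
    assert (HtT : t <= T) by lra.
    change (norm (minus (chi t s (chi s r a)) (chi t r a)) <= M * error r t).
    assert (S := norm_split4 (minus (chi t s (chi s r a)) (chi t r a))
      (minus (chi t s (chi s r a)) (phi t s (chi s r a)))
      (minus (phi t s (chi s r a)) (phi t s (phi s r a)))
      (minus (phi t s (phi s r a)) (phi t r a))
      (opp (minus (chi t r a) (phi t r a))) ltac:(vec)).
    rewrite norm_opp_eq in S.
    assert (S1 := Hclose s t (chi s r a) ltac:(lra) Hst HtT).
    assert (S2 := scheme_lipschitz T p gamma omega K phi Hphi s t
      ltac:(lra) Hst HtT (phi s r a) (chi s r a)).
    assert (S3 := Hclose r s a Hr Hrs ltac:(lra)).
    assert (S4 := proj1 (scheme_defect _ _ _ _ _ _ Hphi r s t Hr Hrs Hst HtT) a).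
    assert (S5 := Hclose r t a Hr ltac:(lra) HtT).
    assert (E1 := error_mono T p gamma omega Hp Hpg Hom r s t t
      Hr Hrs Hst (Rle_refl t) HtT).
    assert (E2 := error_mono T p gamma omega Hp Hpg Hom r r t s
      Hr (Rle_refl r) Hrs Hst HtT).
    assert (E3 := scale_mono T p omega Hp Hom 0 s T t
      (Rle_refl 0) ltac:(lra) Hst HtT (Rle_refl T)).
    assert (N := scale_ge0 p omega s t).
    assert (I1 := Rmult_le_compat_l C _ _ HC E1).
    assert (I2 := Rmult_le_compat_l C _ _ HC E2).
    assert (I3 : (1 + K * scale s t) * norm (minus (chi s r a) (phi s r a))
                   <= (1 + K * scale 0 T) * (C * error r t)).
    { apply Rmult_le_compat; [nra|apply norm_ge_0|nra|lra]. }
    unfold M; lra.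
Qed.

(** Lipschitz flows are insensitive to local errors of order [varpi]: the flow
    of the stable scheme is also that of any scheme within this distance. *)
Lemma close_scheme_solutions : exists psi : R -> R -> V -> V,
  lipschitz_flow T psi /\
  manifold_of_solutions T omega varpi chi (fun r t a => psi t r a) /\
  lipschitz_manifold T (fun r t a => psi t r a) /\
  iterated_product_cvg T phi psi /\ iterated_product_cvg T chi psi.
Proof.
destruct (scheme_flow T p gamma omega Hp Hgamma Hpg Hom K phi HK Hphi)
  as [psi [Hpsi [C' [HC' Hpsi']]]].
destruct (Hpsi) as [[Hid Hflow] [L HL]].
assert (Hchi : forall s t a, 0 <= s -> s <= t -> t <= T ->
  norm (minus (chi t s a) (psi t s a)) <= (C + C') * error s t).
{ intros s t a Hs Hst Ht.
  assert (S := norm_split2 (minus (chi t s a) (psi t s a))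
    (minus (chi t s a) (phi t s a)) (opp (minus (psi t s a) (phi t s a)))
    ltac:(vec)).
  rewrite norm_opp_eq in S.
  assert (S1 := Hclose s t a Hs Hst Ht); assert (S2 := Hpsi' s t a Hs Hst Ht).
  lra. }
assert (Hmove : forall eps, 0 < eps -> exists h, 0 < h /\
  forall s t a, 0 <= s -> s <= t -> t <= T -> t - s <= h ->
    norm (minus (psi t s a) a) <= eps).
{ intros eps Heps.
  assert (He : 0 < eps / (2 * C + C' + 1)) by (apply Rdiv_lt_0_compat; lra).
  destruct (scale_small _ He) as [h [Hh Hs]]; exists h; split; [exact Hh|].
  intros s t a Hs0 Hst Ht Hts; destruct (Hs s t Hs0 Hst Ht Hts) as [H1 [H2 _]].
  assert (S := norm_split2 (minus (psi t s a) a)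
    (opp (minus (chi t s a) (psi t s a))) (minus (chi t s a) a) ltac:(vec)).
  rewrite norm_opp_eq in S.
  assert (S1 := Hchi s t a Hs0 Hst Ht); assert (S2 := Hnear s t a Hs0 Hst Ht).
  assert (HCC : 0 <= C + C') by lra.
  assert (I1 := Rmult_le_compat_l _ _ _ HCC H2).
  assert (I2 := Rmult_le_compat_l _ _ _ HC H1).
  assert (E : (2 * C + C' + 1) * (eps / (2 * C + C' + 1)) = eps)
    by (field; lra).
  lra. }
exists psi; split; [exact Hpsi|split; [|split; [|split]]].
- split; [intros r a Hr HrT; apply Hid; assumption|].
  intros r a Hr HrT; exists (C + C'); intros s t Hrs Hst Ht.
  rewrite <- (Hflow r s t a Hr Hrs Hst Ht), norm_minus_sym.
  apply Hchi; lra.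
- split; [|exists L; intros r a b t Hr Hrt Ht; apply HL; assumption].
  intros r a t Hr Hrt Ht P [eps HP].
  assert (He : 0 < eps / 2) by apply is_pos_div_2.
  destruct (Hmove _ He) as [h [Hh Hs]].
  exists (mkposreal h Hh); intros u Hu [Hru HuT]; apply HP.
  apply (norm_compat1 (psi t r a) (psi u r a) eps).
  change (norm (minus (psi u r a) (psi t r a)) < eps).
  change (Rabs (u - t) < h) in Hu; apply Rabs_def2 in Hu.
  assert (Heps := cond_pos eps).
  apply Rle_lt_trans with (eps / 2); [|lra].
  destruct (Rle_dec t u) as [Htu|Htu].
  + rewrite <- (Hflow r t u a) by lra; apply Hs; lra.
  + rewrite <- (Hflow r u t a), norm_minus_sym by lra; apply Hs; lra.
- apply (iterated_product_cvg_of_close T p gamma omega Hp Hpg Hom C');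
    try assumption.
  intros s t a Hs Hst Ht; rewrite norm_minus_sym; apply Hpsi'; assumption.
- apply (iterated_product_cvg_of_close T p gamma omega Hp Hpg Hom (C + C'));
    try assumption; lra.
Qed.

End CloseScheme.

Theorem proposition14 :
  forall (V : CompleteNormedModule R_AbsRing) (T p gamma : R) (l : nat)
    (omega : R -> R -> R)
    (x1 : nat -> R -> R -> R) (x2 : nat -> nat -> R -> R -> R)
    (f : nat -> V -> V) (y : R -> R -> R -> V -> V),
  0 < T ->
  2 <= p < 3 ->
  0 < gamma <= 1 ->
  p < 2 + gamma ->
  control T omega ->
  weak_geometric_rough_path l p T omega x1 x2 ->
  (forall i, in_idx l i -> Cb_2plus gamma (f i)) ->
  (forall s t a, 0 <= s -> s <= t -> t <= T ->
     log_ode_solution l f x1 x2 s t a (fun alpha => y s t alpha a)) ->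
  let varpi := fun tau => rpow tau ((2 + gamma) / p) in
  let chi := fun t s a => y s t 1 a in
  let phi := davie l f x1 x2 in
  almost_flow T omega varpi gamma chi /\
  (exists Y : R -> R -> V -> V,
     manifold_of_solutions T omega varpi chi Y /\ lipschitz_manifold T Y) /\
  (exists psi : R -> R -> V -> V,
     lipschitz_flow T psi /\
     iterated_product_cvg T phi psi /\
     iterated_product_cvg T chi psi).
Proof.
intros V T p gamma l omega x1 x2 f y HT Hp Hgamma Hpg Hom Hx Hf Hy varpi chi phi.
destruct (davie_stable_scheme T p gamma l omega x1 x2 f Hp Hgamma Hom Hx Hf)
  as [K [HK Hphi]].
destruct (log_ode_step T p gamma l omega x1 x2 f Hp Hgamma Hom Hx Hf)
  as [C [HC Hchi]].
assert (Hstep := fun s t Hs Hst Ht => Hchi s t Hs Hst Ht (chi t s)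
  (fun a => ex_intro _ _ (conj (Hy s t a Hs Hst Ht) eq_refl))).
split.
- apply (close_scheme_almost_flow T p gamma omega HT Hp Hgamma Hpg Hom K phi
    HK Hphi C chi HC); intros; apply Hstep; assumption.
- destruct (close_scheme_solutions T p gamma omega HT Hp Hgamma Hpg Hom K phi
    HK Hphi C chi HC) as [psi [H1 [H2 [H3 [H4 H5]]]]];
    try (intros; apply Hstep; assumption).
  split; [exists (fun r t a => psi t r a); split; assumption|].
  exists psi; auto.
Qed.
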